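(* Let $r\in C^2(\mathbb R)$ satisfy $\int_{-\infty}^0\frac{dy}{|r(y)|+1}=\int_0^\infty\frac{dy}{|r(y)|+1}=\infty$, $r(0)=r'(0)=0$ and $r''(0)\neq0$, and consider the reaction--diffusion equation $y_t=y_{xx}+r(y)$ on $[0,1]\times(0,\infty)$ with $y(0,t)=y(1,t)=0$. Let $H:L^2(0,1)\to\mathbb R$ be $Hu=\int_0^1u(x)\sin(\pi x)\,dx$ (projection onto the first Fourier coefficient) and $R=1$. Then for any positive integer $k$, any $\sigma>0$ and any times $0<t_1<\dots<t_N$, there exist data $z_1,\dots,z_N\in\mathbb R$ and a prior mean $u_0\in V$ such that $u\equiv0$ is a critical point of $$J(u)=\frac12\sum_{i=1}^N\big(Hy(t_i)-z_i\big)^2+\frac1{2\sigma^2}\|u-u_0\|_V^2$$ whose Morse index is at least $k$.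
   Context: $\|\cdot\|$ denotes the $L^2(0,1)$ norm; $V=H^1_0(0,1)$ with norm $\|u\|_V=\|u_x\|$. For $u\in V$, $y$ denotes the solution of the stated equation with $y(\cdot,0)=u$. The Morse index of a critical point $u$ of $J$ is the maximal dimension of a subspace of $V$ on which the second derivative $D^2J(u)$ is negative definite. *)

(* Defs.v *)
From HB Require Import structures.
From mathcomp Require Import all_boot all_order all_algebra.
From mathcomp Require Import all_classical all_reals all_analysis.
From Stdlib Require Import ClassicalEpsilon.
Set Implicit Arguments. Unset Strict Implicit. Unset Printing Implicit Defensive.
Import Order.TTheory GRing.Theory Num.Theory.
Import numFieldNormedType.Exports.
Local Open Scope classical_set_scope.
Local Open Scope ring_scope.

Section Defs.
Variable R : realType.
Local Notation mu := (@lebesgue_measure R).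

Definition C2 (r : R -> R) : Prop :=
  (forall x, derivable r x 1) /\ (forall x, derivable (derive1 r) x 1) /\
  continuous (derive1n 2 r).

Definition growth_cond (r : R -> R) : Prop :=
  (\int[mu]_(y in `]-oo, 0%R]) ((`|r y| + 1)^-1)%:E = +oo)%E /\
  (\int[mu]_(y in `[0%R, +oo[) ((`|r y| + 1)^-1)%:E = +oo)%E.

(* g is an L^2(0,1) derivative of u and u(0)=u(1)=0: u(x) = int_0^x g *)
Definition H10rep (u g : R -> R) : Prop :=
  mu.-integrable `[0%R, 1%R] (EFin \o g) /\
  mu.-integrable `[0%R, 1%R] (EFin \o (fun x => g x ^+ 2)) /\
  (forall x, 0 <= x <= 1 -> u x = \int[mu]_(s in `[0%R, x]) g s) /\
  u 1 = 0.

(* V = H^1_0(0,1) (functions are considered through their values on [0,1]) *)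
Definition Vset : set (R -> R) := [set u | exists g, H10rep u g].

Definition Vder (u : R -> R) : R -> R :=
  epsilon (inhabits (fun _ : R => 0)) (H10rep u).

Definition Vnorm (u : R -> R) : R :=
  Num.sqrt (\int[mu]_(x in `[0%R, 1%R]) (Vder u x ^+ 2)).

Definition is_solution (r : R -> R) (u : R -> R) (y : R -> R -> R) : Prop :=
  {within [set p : R * R | 0 <= p.1 <= 1 /\ 0 <= p.2],
     continuous (fun p : R * R => y p.1 p.2)} /\
  (forall x t, 0 < x < 1 -> 0 < t ->
     derivable (fun s => y x s) t 1 /\
     derivable (fun s => y s t) x 1 /\
     derivable (derive1 (fun s => y s t)) x 1 /\
     derive1 (fun s => y x s) t = derive1n 2 (fun s => y s t) x + r (y x t)) /\
  (forall t, 0 <= t -> y 0 t = 0 /\ y 1 t = 0) /\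
  (forall x, 0 <= x <= 1 -> y x 0 = u x).

Definition Hobs (f : R -> R) : R :=
  \int[mu]_(x in `[0%R, 1%R]) (f x * sin (pi * x)).

(* the functional J, with S u the solution of the PDE with initial datum u *)
Definition Jfun (N : nat) (S : (R -> R) -> R -> R -> R) (ts zs : 'I_N -> R)
  (sigma : R) (u0 : R -> R) (u : R -> R) : R :=
  2^-1 * \sum_(i < N) (Hobs (fun x => S u x (ts i)) - zs i) ^+ 2
  + (2 * sigma ^+ 2)^-1 * Vnorm (fun x => u x - u0 x) ^+ 2.

Definition Vbdd_linear (L : (R -> R) -> R) : Prop :=
  (forall a b h k, Vset h -> Vset k ->
     L (fun x => a * h x + b * k x) = a * L h + b * L k) /\
  exists C, forall h, Vset h -> `|L h| <= C * Vnorm h.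

Definition Vfrechet (J : (R -> R) -> R) (u : R -> R) (L : (R -> R) -> R) :=
  Vbdd_linear L /\
  forall eps : R, 0 < eps -> exists2 delta : R, 0 < delta &
    forall h, Vset h -> Vnorm h < delta ->
      `|J (fun x => u x + h x) - J u - L h| <= eps * Vnorm h.

Definition Vbdd_bilinear (B : (R -> R) -> (R -> R) -> R) : Prop :=
  (forall h, Vset h -> Vbdd_linear (B h)) /\
  (forall k, Vset k -> Vbdd_linear (fun h => B h k)) /\
  exists C, forall h k, Vset h -> Vset k -> `|B h k| <= C * Vnorm h * Vnorm k.

Definition Vtwice_frechet (J : (R -> R) -> R) (u : R -> R)
  (DJ : (R -> R) -> (R -> R) -> R) (B : (R -> R) -> (R -> R) -> R) : Prop :=
  (exists2 rho : R, 0 < rho & forall v, Vset v ->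
      Vnorm (fun x => v x - u x) < rho -> Vfrechet J v (DJ v)) /\
  Vbdd_bilinear B /\
  forall eps : R, 0 < eps -> exists2 delta : R, 0 < delta &
    forall h, Vset h -> Vnorm h < delta -> forall k, Vset k ->
      `|DJ (fun x => u x + h x) k - DJ u k - B h k|
        <= eps * Vnorm h * Vnorm k.

(* B is negative definite on a subspace of V of dimension k,
   i.e. the Morse index (max. such dimension) is >= k *)
Definition neg_def_dim_ge (B : (R -> R) -> (R -> R) -> R) (k : nat) : Prop :=
  exists e : 'I_k -> R -> R,
    (forall i, Vset (e i)) /\
    (forall c : 'I_k -> R,
       (forall x, 0 <= x <= 1 -> \sum_(i < k) c i * e i x = 0) ->
       forall i, c i = 0) /\
    (forall c : 'I_k -> R, (exists i, c i != 0) ->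
       B (fun x => \sum_(i < k) c i * e i x)
         (fun x => \sum_(i < k) c i * e i x) < 0).

Definition critical_Morse_ge (J : (R -> R) -> R) (u : R -> R) (k : nat) : Prop :=
  Vset u /\
  exists DJ B, Vtwice_frechet J u DJ B /\
    (forall h, Vset h -> DJ u h = 0) /\ neg_def_dim_ge B k.

End Defs.

(* Main.v *)
(** At the zero solution the linearised flow is the heat flow, so the observation
    [G_i u = H y(t_i)] has gradient [h |-> exp(-pi^2 t_i) H h] at [0], a multiple of
    [<sin (pi x), h>_V]; a prior mean proportional to [sin (pi x)] therefore cancels the
    derivative of [J] for every choice of data.  With [c = r''(0)] and [v] the heat
    solution starting at [h], the second variation of the flow solves
    [w_t = w_xx + c v^2], [w(0) = 0].  As [(t v^2)_t - (t v^2)_xx <= v^2], the function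
    [c^2 t v^2] lies below [c w], which gives [c D^2G_i(0)(h, h)] a positive lower bound on
    the span of the modes [sin (3 j pi x)], [1 <= j <= k].  Taking the first datum equal to
    a large multiple of [c] and the others zero makes [D^2J(0)] negative definite there.

    Differentiability is obtained without linearising the equation: the maximum principle
    applied to combinations of actual solutions shows that the first and second differences
    of [G_i] are almost linear near [0], and the derivatives are recovered as limits along
    [2^-m h].  The gradient is computed on sine polynomials, which are dense for the
    uniform norm. *)
Require Import Defs.
From HB Require Import structures.
From mathcomp Require Import all_boot all_order all_algebra.
From mathcomp Require Import all_classical all_reals all_analysis.
From mathcomp Require Import measurable_realfun lra ring zify.
Import Order.TTheory GRing.Theory Num.Theory.
Import numFieldNormedType.Exports.
Local Open Scope classical_set_scope.
Local Open Scope ring_scope.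
Set Implicit Arguments.
Unset Strict Implicit.
Unset Printing Implicit Defensive.

(** [S] is any family of classical solutions: the equation holds pointwise inside the strip, and
    nothing is assumed about integrability of the derivatives or about the dependence of [S u] on
    [u]. The maximum principle is therefore the tool, not energy estimates or a Duhamel formula. It
    works in the supremum norm, so estimates are proved there and passed to $V$ through
    $|u(x)|\le\|u\|_V$. Explicit heat solutions are used only for finite sine sums, hence the
    density argument for the gradient and the restriction of the second variation to a span of
    modes. As $r$ is merely $C^2$, second-order remainders carry an arbitrarily small factor [w]
    instead of a third power of the norm.

    At $0$ the second derivative of $J$ is
    $\sum_i(DG_ih)^2-\sum_iz_iD^2G_i(h,h)+\sigma^{-2}\|h\|_V^2$. The outer terms are bounded on a
    finite-dimensional span, while the middle one grows linearly with the data; a datum proportional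
    to $c$ produces $c\,D^2G_1$, so the sign of $r''(0)$ is irrelevant. *)

Section RealAnalysis.
Variable R : realType.
Implicit Types (f g : R -> R) (x a b : R).

(** * Derivative tests at a maximum, and remainders of a $C^2$ function with a double zero *)

Lemma derive1n2E f x : derive1n 2 f x = derive1 (derive1 f) x.
Proof. by []. Qed.

Lemma is_derive_derive1 f x : derivable f x 1 -> is_derive x 1 f (derive1 f x).
Proof. by move=> df; rewrite derive1E; exact: DeriveDef. Qed.

Lemma is_derive_expansion f x (l e : R) : is_derive x 1 f l -> 0 < e ->
  exists2 d : R, 0 < d & forall h, `|h| < d ->
    `|f (x + h) - f x - l * h| <= e * `|h|.
Proof.
move=> [df lE] e0; have := df; rewrite /derivable => /cvg_ex[l' hl].
have {lE}lE : l = l' by rewrite -lE /derive; apply: cvg_lim hl.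
move/cvgrPdist_le : hl => /(_ _ e0) /nbhs_ballP [d /= d0 hd].
exists d => // h hhd; have [->|h0] := eqVneq h 0.
  by rewrite addr0 mulr0 !subr0 subrr normr0 mulr0.
have := hd h; rewrite /ball /= sub0r normrN => /(_ hhd h0).
rewrite -lE /= => H.
have -> : f (x + h) - f x - l * h = - (l - h^-1 *: (f (h *: 1 + x) - f x)) * h.
  rewrite /GRing.scale /= mulr1 [h + x]addrC opprB mulrBl [h^-1 * _]mulrC.
  by rewrite mulfVK.
by rewrite normrM normrN ler_wpM2r.
Qed.

(** Only points to the left of [x] are compared, so the test applies to a time derivative at a first
    hitting time, where nothing is known about later times. *)
Lemma derive_ge0_left_max f x a (l : R) : a < x -> is_derive x 1 f l ->
  (forall y, a < y < x -> f y <= f x) -> 0 <= l.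
Proof.
move=> ax df fm; rewrite leNgt; apply/negP => l0.
have e0 : 0 < - l / 2 by rewrite divr_gt0// oppr_gt0.
have [d d0 H] := is_derive_expansion df e0.
pose h := - Num.min (d / 2) ((x - a) / 2).
have hm : 0 < Num.min (d / 2) ((x - a) / 2).
  by rewrite lt_min !divr_gt0// subr_gt0.
have m1 : Num.min (d / 2) ((x - a) / 2) <= d / 2 by rewrite ge_min lexx.
have m2 : Num.min (d / 2) ((x - a) / 2) <= (x - a) / 2 by rewrite ge_min lexx orbT.
have hE : `|h| = - h by rewrite ltr0_norm// /h oppr_lt0.
have hd : `|h| < d by rewrite hE /h opprK; lra.
have := H _ hd; have := fm (x + h); rewrite /h in hE *.
move: (f (x - _)) => F fF; rewrite hE ler_norml.
have {}fF : F <= f x by apply: fF; apply/andP; split; lra.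
by nra.
Qed.

(** The second derivative is given at [x] alone. If it were positive, [f'] would be positive just to
    the right of its zero [x], and the mean value theorem would give a value above [f x]. *)
Lemma derive2_le0_at_max f (f' : R -> R) x a b (l : R) : a < x < b ->
  (forall y, a < y < b -> is_derive y 1 f (f' y)) -> is_derive x 1 f' l ->
  (forall y, a < y < b -> f y <= f x) -> l <= 0.
Proof.
move=> /andP[ax xb] df ddf fm; rewrite leNgt; apply/negP => l0.
have f'0 : f' x = 0.
  have xab : a < x < b by rewrite ax.
  have [_ <-] := df x xab.
  have [|||? E] := @derive1_at_max R f a b x (ltW (lt_trans ax xb)).
  - by move=> t; rewrite in_itv/= => /df[].
  - by rewrite in_itv/= ax.
  - by move=> t; rewrite in_itv/=; apply: fm.
  exact: E.
have e0 : 0 < l / 2 by rewrite divr_gt0.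
have [d d0 H] := is_derive_expansion ddf e0.
have {}H h : 0 < h -> h < d -> 0 < f' (x + h).
  move=> h0 hd; have := H h; rewrite gtr0_norm// f'0 subr0 => /(_ hd).
  by rewrite ler_norml; nra.
pose h := Num.min (d / 2) ((b - x) / 2).
have hm : 0 < h by rewrite lt_min !divr_gt0// subr_gt0.
have m1 : h <= d / 2 by rewrite ge_min lexx.
have m2 : h <= (b - x) / 2 by rewrite ge_min lexx orbT.
have xxh : x < x + h by lra.
have [||c] := @MVT R f f' x (x + h) xxh.
- by move=> y; rewrite in_itv/= => /andP[? ?]; apply: df; apply/andP; split; lra.
- apply: derivable_within_continuous => y; rewrite in_itv/= => /andP[? ?].
  have yab : a < y < b by apply/andP; split; lra.
  by have [] := df y yab.
rewrite in_itv/= => /andP[xc cxh]; rewrite addrAC subrr add0r => E.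
have : 0 < f' c by have := H (c - x); rewrite subrKC; apply; lra.
have : f (x + h) <= f x by apply: fm; apply/andP; split; lra.
by nra.
Qed.

Lemma lipschitz_of_is_derive f (f' : R -> R) a b (K : R) :
  (forall y : R, is_derive y 1 f (f' y)) ->
  (forall y, Num.min a b <= y <= Num.max a b -> `|f' y| <= K) ->
  `|f b - f a| <= K * `|b - a|.
Proof.
move=> df; wlog ab : a b / a <= b => [H|].
  case/orP: (le_total a b) => [/H//|/H {}H hK].
  by rewrite distrC [`|b - a|]distrC; apply: H; rewrite minC maxC.
rewrite (min_idPl ab) (max_idPr ab) => hK.
have [|c] := @MVT_segment R f f' a b ab (fun y _ => df y).
  by apply: derivable_within_continuous => y _; have [] := df y.
by rewrite in_itv/= => cab ->; rewrite normrM ler_wpM2r// hK.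
Qed.

Lemma between_norm_le x a b (d : R) : Num.min a b <= x <= Num.max a b ->
  `|a| <= d -> `|b| <= d -> `|x| <= d.
Proof.
rewrite ge_min le_max !ler_norml => /andP[/orP[?|?] /orP[?|?]] /andP[? ?] /andP[? ?];
by apply/andP; split; lra.
Qed.

Lemma continuous_at_le f x (e : R) : {for x, continuous f} -> 0 < e ->
  exists2 d : R, 0 < d & forall y, `|y - x| <= d -> `|f y - f x| <= e.
Proof.
move=> /cvgrPdist_le /(_ _ _)/[apply] /nbhs_ballP[d /= d0 H].
exists (d / 2); first by rewrite divr_gt0.
move=> y yx; rewrite distrC; apply: H; rewrite /ball /= distrC.
by apply: le_lt_trans yx _; rewrite ltr_pdivrMr// ltr_pMr// ltr1n.
Qed.

Section C2_at_0.
Variable r : R -> R.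
Hypotheses (hr : C2 r) (r0 : r 0 = 0) (r'0 : derive1 r 0 = 0).

Let dr y : derivable r y 1. Proof. by case: hr. Qed.
Let ddr y : derivable (derive1 r) y 1. Proof. by case: hr => _ []. Qed.
Let isdr (y : R) : is_derive y 1 r (derive1 r y).
Proof. exact/is_derive_derive1/dr. Qed.
Let isddr (y : R) : is_derive y 1 (derive1 r) (derive1 (derive1 r) y).
Proof. exact/is_derive_derive1/ddr. Qed.
Let cr' : {for 0, continuous (derive1 r)}.
Proof. exact/differentiable_continuous/derivable1_diffP. Qed.

Lemma C2_small_lipschitz (w : R) : 0 < w -> exists2 d : R, 0 < d &
  forall p q, `|p| <= d -> `|q| <= d -> `|r p - r q| <= w * `|p - q|.
Proof.
move=> w0; have [d d0 H] := continuous_at_le cr' w0; exists d => // p q pd qd.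
apply: (lipschitz_of_is_derive isdr) => y yqp.
by have := H y; rewrite r'0 !subr0; apply; exact: between_norm_le yqp qd pd.
Qed.

(** The mean value theorem is used twice, in $p$ and then in $q$, so the error is the product
    $|p||q|$ times the oscillation of $r''$ near $0$. *)
Lemma C2_mixed_difference (w : R) : 0 < w -> exists2 d : R, 0 < d &
  forall p q, `|p| <= d -> `|q| <= d ->
    `|r (p + q) - r p - r q - derive1n 2 r 0 * p * q| <= w * `|p| * `|q|.
Proof.
move=> w0; have [_ [_ /(_ 0) cr2]] := hr.
have [d d0 H] := continuous_at_le cr2 w0; exists (d / 2); first by rewrite divr_gt0.
set c : R := derive1n 2 r 0.
move=> p q pd qd; pose g s := r (s + q) - r s - c * q * s.
have dg (s : R) : is_derive s 1 g (derive1 r (s + q) - derive1 r s - c * q).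
  rewrite /g.
  have h1 : is_derive s 1 (fun s => r (s + q)) (derive1 r (s + q)).
    have h2 : is_derive (s + q) 1 r (derive1 r (s + q)).
      exact: isdr.
    have h3 : is_derive s 1 (fun s => s + q) 1.
      by apply: is_derive_eq; rewrite addr0.
    by have := @is_derive1_comp R r (fun s => s + q) s _ _ h2 h3; rewrite mulr1.
  have h2 : is_derive s 1 r (derive1 r s).
    exact: isdr.
  apply: is_derive_eq.
  by rewrite /GRing.scale/= mulr1.
have -> : r (p + q) - r p - r q - c * p * q = g p - g 0.
  by rewrite /g add0r r0; ring.
have -> : w * `|p| * `|q| = w * `|q| * `|p - 0| by rewrite subr0; ring.
apply: (lipschitz_of_is_derive dg) => y yp.
pose k s := derive1 r s - c * s.
have dk (s : R) : is_derive s 1 k (derive1n 2 r s - c).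
  rewrite /k derive1n2E.
  have h2 : is_derive s 1 (derive1 r) (derive1 (derive1 r) s).
    exact: isddr.
  by apply: is_derive_eq; rewrite /GRing.scale/= mulr1.
have -> : derive1 r (y + q) - derive1 r y - c * q = k (y + q) - k y.
  by rewrite /k; ring.
have -> : `|q| = `|y + q - y| by rewrite addrAC subrr add0r.
apply: (lipschitz_of_is_derive dk) => z zy.
have y2 : `|y| <= d / 2 by apply: between_norm_le yp _ pd; rewrite normr0 divr_ge0// ltW.
apply: H; rewrite subr0; apply: between_norm_le zy _ _.
  by apply: le_trans y2 _; lra.
by apply: le_trans (ler_normD _ _) _; lra.
Qed.

(** Expansion at an arbitrary base point near $0$ with one constant: the Frechet derivative of $J$
    is required on a whole ball, not only at $0$. *)
Lemma C2_taylor1 : exists2 M : R, 0 < M & exists2 d : R, 0 < d &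
  forall p q, `|p| <= d -> `|p + q| <= d ->
    `|derive1 r p| <= 1 /\ `|r (p + q) - r p - derive1 r p * q| <= M * q ^+ 2.
Proof.
have [_ [_ /(_ 0) cr2]] := hr.
have [d1 d10 H1] := continuous_at_le cr2 ltr01.
have [d2 d20 H2] := continuous_at_le cr' ltr01.
exists (`|derive1n 2 r 0| + 1); first by rewrite ltr_wpDl.
have d12 : 0 < Num.min d1 d2 by rewrite lt_min d10 d20.
exists (Num.min d1 d2) => // p q; rewrite !le_min => /andP[p1 p2] /andP[q1 q2].
split; first by have := H2 p; rewrite r'0 !subr0; apply.
pose g s := r s - derive1 r p * s.
have dg (s : R) : is_derive s 1 g (derive1 r s - derive1 r p).
  rewrite /g; have h2 : is_derive s 1 r (derive1 r s).
    exact: isdr.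
  by apply: is_derive_eq; rewrite /GRing.scale/= mulr1.
have -> : r (p + q) - r p - derive1 r p * q = g (p + q) - g p by rewrite /g; ring.
rewrite -real_normK ?num_real// expr2 mulrA.
have qE : p + q - p = q by rewrite addrAC subrr add0r.
rewrite -[X in _ <= _ * `|X|]qE; apply: (lipschitz_of_is_derive dg) => y ypq.
apply: (@le_trans _ _ ((`|derive1n 2 r 0| + 1) * `|y - p|)); last first.
  rewrite ler_wpM2l// ?addr_ge0//; move: ypq; rewrite ge_min le_max => /andP[].
  rewrite ler_norml; have := ler_norm q; have := ler_norm (- q); rewrite normrN.
  by move=> ? ? /orP[?|?] /orP[?|?]; apply/andP; split; lra.
apply: (lipschitz_of_is_derive isddr) => z zy.
rewrite -derive1n2E -(subrK (derive1n 2 r 0) (derive1n 2 r z)).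
rewrite addrC; apply: le_trans (ler_normD _ _) _; rewrite lerD2l.
apply: H1; rewrite subr0; apply: (between_norm_le zy p1).
exact: (between_norm_le ypq p1 q1).
Qed.

End C2_at_0.
End RealAnalysis.

(** * The heat equation with a source, and a maximum principle *)

Section HeatEquation.
Variable R : realType.
Implicit Types (d e f g : R -> R -> R).

Definition strip : set (R * R) := [set p | 0 <= p.1 <= 1 /\ 0 <= p.2].

(** The source [f] is an arbitrary function without regularity, so that combinations of solutions,
    and even $t v^2$, solve an equation of the same kind. The function [dx] has to exist along the
    whole segment because [dxx] is its derivative at [x]. *)
Definition heat_solution d f : Prop :=
  {within strip, continuous (fun p : R * R => d p.1 p.2)} /\
  (forall x t : R, 0 < x < 1 -> 0 < t -> exists dt dxx : R, exists dx : R -> R,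
     [/\ is_derive t 1 (d x) dt,
         forall y : R, 0 < y < 1 -> is_derive y 1 (d ^~ t) (dx y),
         is_derive x 1 dx dxx & dt = dxx + f x t]) /\
  (forall t : R, 0 <= t -> d 0 t = 0 /\ d 1 t = 0).

Lemma is_solution_heat (r u : R -> R) (y : R -> R -> R) :
  is_solution r u y -> heat_solution y (fun x t => r (y x t)).
Proof.
move=> [cy [dy [y0 _]]]; split => //; split => // x t x01 t0.
have [d1 [d2 [d3 d4]]] := dy x t x01 t0.
exists (derive1 (y x) t), (derive1n 2 (y ^~ t) x), (derive1 (y ^~ t)); split.
- exact: (is_derive_derive1 d1).
- by move=> z z01; have [_ [dz _]] := dy z t z01 t0; exact: (is_derive_derive1 dz).
- exact: (is_derive_derive1 d3).
- exact: d4.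
Qed.

Lemma heat_solution_lin (a b : R) d e f g :
  heat_solution d f -> heat_solution e g ->
  heat_solution (fun x t => a * d x t + b * e x t)
                (fun x t => a * f x t + b * g x t).
Proof.
move=> [cd [dd d0]] [ce [de e0]]; split; [|split].
- apply/subspace_continuousP => p sp.
  move/subspace_continuousP : cd => /(_ p sp) cd.
  move/subspace_continuousP : ce => /(_ p sp) ce.
  by apply: cvgD; apply: cvgM => //; exact: cvg_cst.
- move=> x t x01 t0; have [dt [dxx [dx [d1 d2 d3 d4]]]] := dd x t x01 t0.
  have [et [exx [ex [e1 e2 e3 e4]]]] := de x t x01 t0.
  exists (a * dt + b * et), (a * dxx + b * exx), (fun y => a * dx y + b * ex y); split.
  - exact: is_derive_eq.
  - by move=> y y01; have ? := d2 y y01; have ? := e2 y y01; exact: is_derive_eq.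
  - exact: is_derive_eq.
  - by rewrite d4 e4; ring.
- move=> t t0; have [-> ->] := d0 t t0; have [-> ->] := e0 t t0.
  by rewrite !mulr0 addr0.
Qed.

Lemma heat_solution_cont_x d f (t : R) : heat_solution d f -> 0 <= t ->
  {within `[0, 1], continuous (fun x => d x t)}.
Proof.
move=> [cd _] t0; apply/subspace_continuousP => x /=; rewrite in_itv/= => x01.
have /subspace_continuousP/(_ (x, t)) cx := cd.
have := cx (conj x01 t0) => {}cx.
apply: (@cvg_comp _ _ _ (fun x => (x, t)) (fun p : R * R => d p.1 p.2) _
   (within strip (nbhs (x, t)))); last exact: cx.
move=> B /=; rewrite /within /= => /nbhs_ballP[e /= e0 H].
rewrite /nbhs /=; apply/nbhs_ballP; exists e => // z xz; rewrite /= in_itv/= => z01.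
by apply: H => //; split => //; exact: ballxx.
Qed.

Lemma heat_solution_cont_t d f (x t : R) : heat_solution d f -> 0 <= x <= 1 -> 0 < t ->
  {for t, continuous (fun s => d x s)}.
Proof.
move=> [cd _] x01 t0.
have /subspace_continuousP/(_ (x, t)) cx := cd.
have := cx (conj x01 (ltW t0)) => {}cx.
apply: (@cvg_comp _ _ _ (fun s => (x, s)) (fun p : R * R => d p.1 p.2) _
   (within strip (nbhs (x, t)))); last exact: cx.
move=> B /=; rewrite /within /= => /nbhs_ballP[e /= e0 H].
change (\forall z \near t, B (x, z)); near=> z; apply: H.
  by split => /=; [exact: ballxx|near: z; exact: nbhsx_ballx].
split => //=; apply: ltW; near: z; exact: lt_nbhsr.
Unshelve. all: by end_near. Qed.

(** The source bound is demanded only while $0<d\le\rho$, since the nonlinearity is controlled only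
    near $0$; the last hypothesis keeps $d$ in that range. Put $l=M+1$. At the first time when
    $z=d\,e^{-lt}$ reaches a level $A>D+K$ one has $d_{xx}\le0$ and $d_t\ge l\,d$, hence $(M+1)d\le
    Md+K$, which contradicts $d\ge A>K$. *)
Lemma max_principle d f (T D K M rho : R) :
  heat_solution d f -> 0 <= D -> 0 <= K -> 0 <= M ->
  (forall x : R, 0 <= x <= 1 -> d x 0 <= D) ->
  (forall x t : R, 0 < x < 1 -> 0 < t <= T -> 0 < d x t <= rho ->
     f x t <= M * d x t + K) ->
  (D + K) * expR ((M + 1) * T) < rho ->
  forall x t : R, 0 <= x <= 1 -> 0 <= t <= T -> d x t <= (D + K) * expR ((M + 1) * T).
Proof.
move=> hd D0 K0 M0 dD fK rhoP x1 t1 x101 t10T; rewrite leNgt; apply/negP => dgt.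
have [cd [dd dB]] := hd; have /andP[t10 t1T] := t10T.
set l := M + 1; have l0 : 0 < l by rewrite ltr_wpDl.
pose z (p : R * R) := d p.1 p.2 * expR (- l * p.2).
have ee (t : R) : expR (- l * t) * expR (l * t) = 1.
  by rewrite -expRD mulNr addNr expR0.
have eT0 := expR_gt0 (l * T).
have zgt : D + K < z (x1, t1).
  rewrite /z /=; apply: le_lt_trans (_ : _ <= (D + K) * expR (l * T) * expR (- l * t1)) _.
    rewrite -mulrA -expRD ler_peMr// ?addr_ge0// -expR0 ler_expR mulNr.
    by rewrite subr_ge0 ler_wpM2l// ltW.
  by rewrite ltr_pM2r// expR_gt0.
(* The level lies above $D+K$, yet so low that $z\le A$ forces $d\le\rho$ up to time $T$. *)
have [A [DKA Az Arho]] : exists A, [/\ D + K < A, A <= z (x1, t1) & A * expR (l * T) <= rho].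
  exists (Num.min (z (x1, t1)) (rho * expR (- l * T))); split.
  - by rewrite lt_min zgt/= mulNr expRN ltr_pdivlMr.
  - by rewrite ge_min lexx.
  - rewrite -ler_pdivlMr// -expRN -mulNr; rewrite ge_min lexx orbT //.
have A0 : 0 < A by apply: le_lt_trans DKA; exact: addr_ge0.
pose rect : set (R * R) := `[0, 1] `*` `[0, T].
have rect_strip p : rect p -> strip p.
  by move=> [/=]; rewrite !in_itv/= => h1 /andP[h2 _].
have crect : compact rect by apply: compact_setX; exact: segment_compact.
have cz : {within strip, continuous z}.
  apply/subspace_continuousP => p sp; move/subspace_continuousP : cd => /(_ p sp) cd.
  apply: cvgM => //; apply: cvg_within_filter.
  apply: (@continuous_comp _ _ _ (fun p : R * R => - l * p.2) expR); last exact: continuous_expR.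
  by apply: cvgM; [exact: cvg_cst|exact: cvg_snd].
(* A point of this compact superlevel set with least time coordinate is a first hitting point. *)
pose Z := rect `&` [set p | A <= z p].
have clZ : closed Z.
  move=> p pZ.
  have rp : rect p.
    apply: (compact_closed (@norm_hausdorff R (R * R)%type) crect).
    by apply: closure_subset pZ; exact: subIsetl.
  split => //; rewrite /= leNgt; apply/negP => zpA.
  move/subspace_continuousP : cz => /(_ p (rect_strip _ rp)).
  move/cvgr_lt => /(_ _ zpA) /pZ[q [[rq /= Aq]]] /(_ (rect_strip _ rq)).
  by rewrite ltNge Aq.
have cZ : compact Z by apply: (subclosed_compact clZ crect); exact: subIsetl.
have Z0 : Z !=set0 by exists (x1, t1); split => //; split; rewrite /= in_itv/=.
have csnd : continuous (fun p : R * R => p.2) by move=> p; exact: cvg_snd.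
have [[xs ts]] := @compact_EVT_min _ R (fun p : R * R => p.2) Z Z0 cZ
  (continuous_subspaceT csnd).
rewrite inE => -[[/= xs01 ts0T] zs] tsmin.
move: xs01 ts0T; rewrite !in_itv/= => xs01 /andP[ts0 tsT].
have zlt x t : 0 <= x <= 1 -> 0 <= t < ts -> z (x, t) < A.
  move=> x01 /andP[t0 tts]; rewrite ltNge; apply/negP => Azx.
  have /tsmin /= : (x, t) \in Z.
    rewrite inE; split => //; split => /=; rewrite in_itv/= ?x01// t0/=.
    by rewrite (le_trans (ltW tts)).
  by rewrite leNgt tts.
have ts_gt0 : 0 < ts.
  rewrite lt_neqAle ts0 andbT eq_sym; apply/eqP => ts00; move: zs.
  rewrite ts00 /z /= mulr0 expR0 mulr1 leNgt => /negP; apply.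
  by apply: le_lt_trans (dD _ xs01) _; apply: le_lt_trans DKA; rewrite lerDl.
(* The strict inequality before [ts] passes to the limit: at time [ts] no point of the segment
   exceeds [A]. *)
have zle x : 0 <= x <= 1 -> z (x, ts) <= A.
  move=> x01; rewrite leNgt; apply/negP => Azx.
  have ct : {for ts, continuous (fun s => z (x, s))}.
    apply: cvgM; first exact: (heat_solution_cont_t hd).
    apply: (@continuous_comp _ _ _ (fun s : R => - l * s) expR); last exact: continuous_expR.
    by apply: cvgM; [exact: cvg_cst|exact: cvg_id].
  move/cvgr_gt : ct => /(_ _ Azx) /nbhs_ballP[e /= e0 H].
  pose s := ts - Num.min (e / 2) (ts / 2).
  have m0 : 0 < Num.min (e / 2) (ts / 2) by rewrite lt_min !divr_gt0.
  have m1 : Num.min (e / 2) (ts / 2) <= e / 2 by rewrite ge_min lexx.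
  have m2 : Num.min (e / 2) (ts / 2) <= ts / 2 by rewrite ge_min lexx orbT.
  have : A < z (x, s).
    by apply: H; rewrite /ball /= /s opprB addrC subrK gtr0_norm//; lra.
  by rewrite ltNge ltW// zlt// /s; apply/andP; split; lra.
have zsA : z (xs, ts) = A by apply/eqP; rewrite eq_le zs zle.
have dsE : d xs ts = A * expR (l * ts).
  by rewrite -zsA /z /= -mulrA ee mulr1.
have ds0 : 0 < d xs ts by rewrite dsE mulr_gt0// expR_gt0.
have xs01' : 0 < xs < 1.
  have [h0 h1] := dB ts ts0.
  rewrite !lt_neqAle; move: xs01 => /andP[-> ->]; rewrite !andbT.
  by apply/andP; split; apply/eqP => E; move: ds0; rewrite -?E ?h0 ?h1 ?ltxx// E h1 ltxx.
have [dt [dxx [dx [d1 d2 d3 d4]]]] := dd xs ts xs01' ts_gt0.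
have dxx0 : dxx <= 0.
  apply: (derive2_le0_at_max xs01' d2 d3) => y /andP[y0 y1]; rewrite dsE.
  have := zle y; rewrite (ltW y0) (ltW y1) => /(_ isT); rewrite /z /=.
  by rewrite mulNr expRN ler_pdivrMr// expR_gt0.
have dt0 : l * d xs ts <= dt.
  (* Before [ts] the curve stays below the barrier $A e^{ls}$, and it touches the barrier at [ts];
     comparing slopes gives $d_t\ge l\,d$. *)
  pose g s := d xs s - A * expR (l * s).
  have D2 : is_derive ts 1 (fun s : R => expR (l * s)) (expR (l * ts) * l).
    have h3 : is_derive ts 1 (fun s : R => l * s) l.
      by apply: is_derive_eq; rewrite /GRing.scale/= mulr1.
    exact: (@is_derive1_comp R expR (fun s => l * s)).
  have D3 : is_derive ts 1 g (dt - A * (expR (l * ts) * l)).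
    exact: is_derive_eq.
  have -> : l * d xs ts = A * (expR (l * ts) * l) by rewrite dsE; ring.
  rewrite -subr_ge0.
  apply: (derive_ge0_left_max ts_gt0 D3) => y /andP[y0 yts].
  rewrite /g dsE subrr subr_le0.
  have := zlt xs y xs01; rewrite (ltW y0) yts => /(_ isT); rewrite /z /=.
  by rewrite mulNr expRN ltr_pdivrMr ?expR_gt0// => /ltW.
have fs : f xs ts <= M * d xs ts + K.
  apply: fK => //; rewrite ?ts_gt0 ?ds0//=; rewrite dsE.
  by apply: le_trans Arho; rewrite ler_pM2l// ler_expR ler_pM2l.
have KA : K < d xs ts.
  rewrite dsE; apply: lt_le_trans (_ : A <= _).
    by apply: le_lt_trans DKA; rewrite lerDr.
  by rewrite ler_peMr// 1?ltW// -expR0 ltr_expR mulr_gt0.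
by move: dt0; rewrite /l d4; lra.
Qed.

End HeatEquation.

(** * Linear parts of nonlinear functionals as dyadic limits *)

Section DyadicLimits.
Variable R : realType.

Lemma half_pow_small (y d : R) : 0 < d -> exists m : nat, 2 ^- m * y <= d.
Proof.
move=> d0; have [y0|y0] := leP y 0.
  by exists 0%N; rewrite expr0 invr1 mul1r (le_trans y0 (ltW d0)).
have : (fun m => (2^-1 : R) ^+ m) @ \oo --> (0 : R).
  by apply: cvg_expr; rewrite ger0_norm ?invr_ge0// invf_lt1// ltr1n.
move/cvgrPdist_le => /(_ (d / y) (divr_gt0 d0 y0)) [m _ /(_ m (leqnn m))].
rewrite sub0r normrN exprVn ger0_norm ?invr_ge0 ?exprn_ge0// ler_pdivlMr// => H.
by exists m.
Qed.

Lemma half_pow_le (m p : nat) (y : R) : 0 <= y -> (m <= p)%N -> 2 ^- p * y <= 2 ^- m * y.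
Proof.
move=> y0 mp; rewrite ler_wpM2r// lef_pV2 ?posrE ?exprn_gt0// ler_weXn2l//.
by rewrite ler1n.
Qed.

(** The denominator [s + 1] allows a tolerance to be divided by a norm that may vanish. *)
Lemma frac_succ_le (e s x : R) : 0 <= e -> 0 <= s -> x <= s -> e / (s + 1) * x <= e.
Proof.
move=> e0 s0 xs; have s1 : 0 < s + 1 by rewrite ltr_wpDl.
rewrite mulrAC ler_pdivrMr// ler_wpM2l//.
by rewrite (le_trans xs)// lerDl.
Qed.

Lemma cvg_dist_le (u : nat -> R) (l c K : R) (m0 : nat) : u @ \oo --> l ->
  (forall m, (m0 <= m)%N -> `|u m - c| <= K) -> `|l - c| <= K.
Proof.
move=> ul H; rewrite leNgt; apply/negP => lc.
have : (fun m => `|u m - c|) @ \oo --> `|l - c|.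
  by apply: cvg_norm; apply: cvgB => //; exact: cvg_cst.
move/cvgr_gt => /(_ _ lc) [m _ Hm].
have := Hm (maxn m m0) (leq_maxl _ _); rewrite /= ltNge.
by rewrite H// leq_maxr.
Qed.

Lemma cvg_comb3 (u v w : nat -> R) (lu lv lw a b : R) :
  u @ \oo --> lu -> v @ \oo --> lv -> w @ \oo --> lw ->
  (fun m => u m - a * v m - b * w m) @ \oo --> lu - a * lv - b * lw.
Proof.
move=> cu cv cw; apply: cvgB; first apply: cvgB => //.
all: by apply: cvgM => //; exact: cvg_cst.
Qed.

Lemma cauchy_criterion (u : nat -> R) :
  (forall e : R, 0 < e -> exists m, forall p, (m <= p)%N -> `|u p - u m| <= e) ->
  cvg (u @ \oo).
Proof.
move=> H; apply/cauchy_cvgP/cauchy_exP => e e0.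
have [m Hm] := H (e / 2) (divr_gt0 e0 (ltr0Sn _ 1)).
exists (u m); exists m => // p /= mp; rewrite /ball /= distrC.
by apply: le_lt_trans (Hm p mp) _; rewrite ltr_pdivrMr// ltr_pMr// ltr1n.
Qed.

End DyadicLimits.

Section LinearPart.
Variables (R : realType) (V : set (R -> R)) (n : (R -> R) -> R).
Hypothesis VL : forall a b h k, V h -> V k -> V (fun x => a * h x + b * k x).
Hypothesis n_ge0 : forall h, 0 <= n h.
Hypothesis nZ : forall a h, V h -> n (fun x => a * h x) = `|a| * n h.
Implicit Types (phi : (R -> R) -> R) (h k : R -> R) (a b e d : R).

(** The error is homogeneous of degree one, so the rescaling $2^m\varphi(2^{-m}h)$ leaves its size
    unchanged. *)
Definition almost_linear phi e d := forall a b h k, `|a| <= 1 -> `|b| <= 1 ->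
  V h -> V k -> n h <= d -> n k <= d ->
  `|phi (fun x => a * h x + b * k x) - a * phi h - b * phi k|
    <= e * (`|a| * n h + `|b| * n k).

Definition infinitesimally_linear phi :=
  forall e : R, 0 < e -> exists2 d : R, 0 < d & almost_linear phi e d.

Definition dyadic phi h (m : nat) : R := 2 ^+ m * phi (fun x => 2 ^- m * h x).

(** Directional derivative at $0$ along the single sequence $2^{-m}$; infinitesimal linearity
    upgrades it to a Frechet derivative. *)
Definition linear_part phi h : R := lim (dyadic phi h @ \oo).

Lemma V_scale a h : V h -> V (fun x => a * h x).
Proof.
move=> Vh; rewrite (_ : (fun x => _) = (fun x => a * h x + 0 * h x)); last first.
  by apply/funext => x; rewrite mul0r addr0.
exact: VL.
Qed.

Let pow2_gt0 (m : nat) : 0 < 2 ^+ m :> R. Proof. exact: exprn_gt0. Qed.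
Let pow2V m : 2 ^+ m * 2 ^- m = 1 :> R. Proof. by rewrite divff// gt_eqF. Qed.
Let norm2V m : `|2 ^- m| = 2 ^- m :> R.
Proof. by rewrite ger0_norm// invr_ge0 ltW. Qed.
Let half_pow_le1 m : 2 ^- m <= 1 :> R.
Proof. by have := @half_pow_le R 0 m 1 ler01 (leq0n m); rewrite !mulr1 expr0 invr1. Qed.

Lemma almost_linear_scale phi e d a h : almost_linear phi e d -> `|a| <= 1 ->
  V h -> n h <= d -> `|phi (fun x => a * h x) - a * phi h| <= e * (`|a| * n h).
Proof.
move=> H a1 Vh hd; have := H a 0 h h a1 _ Vh Vh hd hd.
rewrite normr0 !mul0r subr0 addr0 => /(_ ler01).
by rewrite (_ : (fun x => _) = (fun x => a * h x))//; apply/funext => x; rewrite mul0r addr0.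
Qed.

(** Almost linearity at $2^{-m}h$ with the coefficient $2^{m-p}$ has an error $e\,2^{-p}n(h)$, and
    the factor $2^p$ of the quotient undoes $2^{-p}$. The sequence of quotients is therefore
    Cauchy. *)
Lemma almost_linear_dyadic phi e d h m p : almost_linear phi e d -> V h ->
  2 ^- m * n h <= d -> (m <= p)%N -> `|dyadic phi h p - dyadic phi h m| <= e * n h.
Proof.
move=> H Vh hd mp; rewrite /dyadic -(subnKC mp); set q := (p - m)%N.
have Vm := V_scale (2 ^- m) Vh.
have nm : n (fun x => 2 ^- m * h x) <= d by rewrite nZ// norm2V.
have := @almost_linear_scale phi e d (2 ^- q) _ H _ Vm nm; rewrite norm2V => /(_ (half_pow_le1 q)).
rewrite (_ : (fun x => 2 ^- q * _) = (fun x => 2 ^- (m + q) * h x)); last first.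
  by apply/funext => x; rewrite mulrA -invfM -exprD addnC.
rewrite nZ// norm2V => K.
have -> : 2 ^+ (m + q) * phi (fun x => 2 ^- (m + q) * h x) -
   2 ^+ m * phi (fun x => 2 ^- m * h x) =
   2 ^+ (m + q) * (phi (fun x => 2 ^- (m + q) * h x) - 2 ^- q * phi (fun x => 2 ^- m * h x)).
  rewrite mulrBr exprD; congr (_ - _).
  have -> : 2 ^+ m * 2 ^+ q * (2 ^- q * phi (fun x => 2 ^- m * h x)) =
    2 ^+ m * phi (fun x => 2 ^- m * h x) * (2 ^+ q * 2 ^- q) by ring.
  by rewrite pow2V mulr1.
rewrite normrM gtr0_norm//; apply: le_trans (ler_wpM2l (ltW (pow2_gt0 _)) K) _.
have -> : 2 ^+ (m + q) * (e * (2 ^- q * (2 ^- m * n h))) =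
   (2 ^+ m * 2 ^- m) * (2 ^+ q * 2 ^- q) * (e * n h) by rewrite exprD; ring.
by rewrite !pow2V !mul1r.
Qed.

Lemma linear_part_cvg phi h :
  infinitesimally_linear phi -> V h ->
  dyadic phi h @ \oo --> linear_part phi h.
Proof.
move=> H Vh; apply: cauchy_criterion => e e0.
have e1 : 0 < e / (n h + 1) by rewrite divr_gt0// ltr_wpDl.
have [d d0 Hd] := H _ e1.
have [m md] := half_pow_small (n h) d0.
exists m => p mp; apply: le_trans (almost_linear_dyadic Hd Vh md mp) _.
by apply: frac_succ_le => //; exact: ltW.
Qed.

(** The quotient of index $0$ is [phi h] itself, so the Cauchy bound started there compares [phi]
    with its linear part on the whole ball. *)
Lemma linear_part_approx phi e d h :
  infinitesimally_linear phi ->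
  almost_linear phi e d -> V h -> n h <= d -> `|phi h - linear_part phi h| <= e * n h.
Proof.
move=> H Hd Vh hd; rewrite distrC.
apply: (@cvg_dist_le R _ _ _ _ 0%N (linear_part_cvg H Vh)) => m _.
have -> : phi h = dyadic phi h 0.
  by rewrite /dyadic expr0 mul1r; congr phi; apply/funext => x; rewrite invr1 mul1r.
by apply: (almost_linear_dyadic Hd) => //; rewrite expr0 invr1 mul1r.
Qed.

Lemma linear_part_le phi h (K d : R) : 0 < d ->
  infinitesimally_linear phi ->
  (forall a, V (fun x => a * h x) -> n (fun x => a * h x) <= d ->
     `|phi (fun x => a * h x)| <= `|a| * K) ->
  V h -> `|linear_part phi h| <= K.
Proof.
move=> d0 H HC Vh; rewrite -(subr0 (linear_part _ _)).
have [m md] := half_pow_small (n h) d0.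
apply: (@cvg_dist_le R _ _ _ _ m (linear_part_cvg H Vh)) => p mp.
rewrite subr0 /dyadic normrM gtr0_norm//.
have Vp := V_scale (2 ^- p) Vh.
have := HC _ Vp; rewrite nZ// norm2V => /(_ (le_trans (half_pow_le (n_ge0 h) mp) md)).
move/(ler_wpM2l (ltW (pow2_gt0 p))) => /le_trans; apply.
by rewrite mulrA pow2V mul1r.
Qed.

Lemma linear_partD phi a b h k : infinitesimally_linear phi ->
  V h -> V k -> `|a| <= 1 -> `|b| <= 1 ->
  linear_part phi (fun x => a * h x + b * k x) = a * linear_part phi h + b * linear_part phi k.
Proof.
move=> H Vh Vk a1 b1; apply/eqP; rewrite -subr_eq0 -normr_le0.
apply/ler_addgt0Pl => e e0; rewrite addr0.
have e1 : 0 < e / (n h + n k + 1) by rewrite divr_gt0// ltr_wpDl// addr_ge0.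
have [d d0 Hd] := H _ e1.
have [m md] := half_pow_small (n h + n k) d0.
have cv := @cvg_comb3 R _ _ _ _ _ _ a b (linear_part_cvg H (VL a b Vh Vk))
  (linear_part_cvg H Vh) (linear_part_cvg H Vk).
rewrite opprD addrA.
rewrite -(subr0 (_ - _)); apply: (@cvg_dist_le R _ _ _ _ m cv) => p mp.
rewrite subr0 /dyadic.
have hp : n (fun x => 2 ^- p * h x) <= d.
  rewrite nZ// norm2V (le_trans (half_pow_le (n_ge0 h) mp))// (le_trans _ md)//.
  by rewrite ler_pM2l ?invr_gt0// lerDl.
have kp : n (fun x => 2 ^- p * k x) <= d.
  rewrite nZ// norm2V (le_trans (half_pow_le (n_ge0 k) mp))// (le_trans _ md)//.
  by rewrite ler_pM2l ?invr_gt0// lerDr.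
have := Hd a b _ _ a1 b1 (V_scale (2 ^- p) Vh) (V_scale (2 ^- p) Vk) hp kp.
rewrite (_ : (fun x => a * (2 ^- p * h x) + b * (2 ^- p * k x)) =
   (fun x => 2 ^- p * (a * h x + b * k x))); last by apply/funext => x; ring.
rewrite !nZ// norm2V; set X := phi _; set Y := phi _; set Z := phi _ => K.
have -> : 2 ^+ p * X - a * (2 ^+ p * Y) - b * (2 ^+ p * Z) =
  2 ^+ p * (X - a * Y - b * Z) by ring.
rewrite normrM gtr0_norm//; apply: le_trans (ler_wpM2l (ltW (pow2_gt0 _)) K) _.
have -> : 2 ^+ p * (e / (n h + n k + 1) * (`|a| * (2 ^- p * n h) + `|b| * (2 ^- p * n k)))
  = (2 ^+ p * 2 ^- p) * (e / (n h + n k + 1) * (`|a| * n h + `|b| * n k)) by ring.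
rewrite pow2V mul1r; apply: frac_succ_le; rewrite ?addr_ge0//; first exact: ltW.
by apply: lerD; rewrite ler_piMl.
Qed.

(** The bounds on the coefficients are removed by homogeneity: they are divided by $s=|a|+|b|+1$,
    and the result is scaled back. *)
Lemma linear_part_linear phi a b h k :
  infinitesimally_linear phi -> V h -> V k ->
  linear_part phi (fun x => a * h x + b * k x) = a * linear_part phi h + b * linear_part phi k.
Proof.
move=> H Vh Vk; pose s := `|a| + `|b| + 1.
have s0 : 0 < s by rewrite ltr_wpDl// addr_ge0.
have ns : s != 0 by rewrite gt_eqF.
have sZ u : V u -> linear_part phi (fun x => s * u x) = s * linear_part phi u.
  move=> Vu; have Vsu := V_scale s Vu.
  have := @linear_partD phi s^-1 0 _ _ H Vsu Vsu; rewrite normr0 => /(_ _ ler01).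
  rewrite gtr0_norm ?invr_gt0// invf_le1// lerDr addr_ge0// => /(_ isT).
  rewrite mul0r addr0 (_ : (fun x => _) = u); last first.
    by apply/funext => x; rewrite mul0r addr0 mulrA mulVf// mul1r.
  by move=> ->; rewrite mulrA divff// mul1r.
have := @linear_partD phi (a / s) (b / s) _ _ H (V_scale s Vh) (V_scale s Vk).
rewrite (_ : (fun x => _) = (fun x => a * h x + b * k x)); last first.
  by apply/funext => x; field.
rewrite !sZ// => ->; first by field.
- rewrite normrM normfV (gtr0_norm s0) ler_pdivrMr// mul1r /s -addrA lerDl.
  by rewrite addr_ge0.
- rewrite normrM normfV (gtr0_norm s0) ler_pdivrMr// mul1r /s addrAC lerDr.
  by rewrite addr_ge0.
Qed.

End LinearPart.

(** * First and second derivatives recovered from first and second differences *)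

Section TwiceDifferentiable.
Variables (R : realType) (V : set (R -> R)) (n : (R -> R) -> R).
Hypothesis VL : forall a b h k, V h -> V k -> V (fun x => a * h x + b * k x).
Hypothesis n_ge0 : forall h, 0 <= n h.
Hypothesis nZ : forall a h, V h -> n (fun x => a * h x) = `|a| * n h.
Hypothesis n_comb : forall a b h k, V h -> V k ->
  n (fun x => a * h x + b * k x) <= `|a| * n h + `|b| * n k.
Implicit Types (h k v : R -> R) (a b e d : R).

Variables (G : (R -> R) -> R) (C rho : R).
Hypotheses (C_ge0 : 0 <= C) (rho_gt0 : 0 < rho).
Hypothesis G0 : G (fun _ => 0) = 0.
Hypothesis G_lip : forall v h, V v -> V h -> n v <= rho -> n h <= rho ->
  `|G (fun x => v x + h x) - G v| <= C * n h.
Hypothesis G_quad : forall v a b h k, V v -> V h -> V k ->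
  `|a| <= 1 -> `|b| <= 1 -> n v <= rho -> n h <= rho -> n k <= rho ->
  `|(G (fun x => v x + (a * h x + b * k x)) - G v) - a * (G (fun x => v x + h x) - G v)
     - b * (G (fun x => v x + k x) - G v)| <= C * (`|a| * n h + `|b| * n k) * (n h + n k).

(** The second difference at $0$; the fourth term is absent because $G(0)=0$. *)
Definition mixed h k := G (fun x => h x + k x) - G h - G k.

Hypothesis mixed_le : forall h k, V h -> V k -> n h <= rho -> n k <= rho ->
  `|mixed h k| <= C * n h * n k.
Hypothesis mixed_lin : forall e, 0 < e -> exists2 d : R, 0 < d &
  forall a b h k l, V h -> V k -> V l -> `|a| <= 1 -> `|b| <= 1 ->
    n h <= d -> n k <= d -> n l <= d ->
    `|mixed (fun x => a * h x + b * k x) l - a * mixed h l - b * mixed k l|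
      <= e * (`|a| * n h + `|b| * n k) * n l.

Definition gradient v k := linear_part (fun h => G (fun x => v x + h x) - G v) k.

Definition hessian h k := linear_part (fun h => gradient h k - gradient (fun _ => 0) k) h.

Let V_scale a h : V h -> V (fun x => a * h x).
Proof. exact: (@V_scale R V VL). Qed.

Let V0 h : V h -> V (fun _ => 0).
Proof.
by move=> /(V_scale 0); rewrite (_ : (fun x => _) = (fun _ => 0))//; apply/funext => x; rewrite mul0r.
Qed.

Let n0 h : V h -> n (fun _ => 0) = 0.
Proof.
move=> Vh; rewrite (_ : (fun _ => 0) = (fun x => 0 * h x)) ?nZ// ?normr0 ?mul0r//.
by apply/funext => x; rewrite mul0r.
Qed.

Let n0_le h : V h -> n (fun _ => 0) <= rho.
Proof. by move=> /n0 ->; exact: ltW. Qed.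

Lemma increment_almost_linear v e : V v -> n v <= rho -> 0 <= e -> e <= rho ->
  almost_linear V n (fun h => G (fun x => v x + h x) - G v) (2 * C * e) e.
Proof.
move=> Vv nv e0 er a b h k a1 b1 Vh Vk hd kd.
apply: le_trans (G_quad Vv Vh Vk a1 b1 nv (le_trans hd er) (le_trans kd er)) _.
have -> : 2 * C * e * (`|a| * n h + `|b| * n k) = C * (`|a| * n h + `|b| * n k) * (e + e) by ring.
by rewrite ler_wpM2l ?lerD// mulr_ge0// addr_ge0// mulr_ge0.
Qed.

Lemma increment_infinitesimally_linear v : V v -> n v <= rho ->
  infinitesimally_linear V n (fun h => G (fun x => v x + h x) - G v).
Proof.
move=> Vv nv e e0; pose d := Num.min rho (e / (2 * C + 1)).
have d0 : 0 < d by rewrite lt_min rho_gt0 divr_gt0// ltr_wpDl// mulr_ge0.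
have dr : d <= rho by rewrite ge_min lexx.
have de : d <= e / (2 * C + 1) by rewrite ge_min lexx orbT.
exists d => // a b h k a1 b1 Vh Vk hd kd.
apply: le_trans (increment_almost_linear Vv nv (ltW d0) dr a1 b1 Vh Vk hd kd) _.
rewrite ler_wpM2r//; first by rewrite addr_ge0// mulr_ge0.
rewrite mulrC; apply: le_trans (ler_wpM2r _ de) _; first by rewrite mulr_ge0.
by apply: frac_succ_le; rewrite ?mulr_ge0// ltW.
Qed.

Lemma gradient_linear v a b h k : V v -> n v <= rho -> V h -> V k ->
  gradient v (fun x => a * h x + b * k x) = a * gradient v h + b * gradient v k.
Proof.
move=> Vv nv Vh Vk; rewrite /gradient.
exact: (linear_part_linear VL n_ge0 nZ a b (increment_infinitesimally_linear Vv nv)).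
Qed.

Lemma gradient_le v k : V v -> n v <= rho -> V k -> `|gradient v k| <= C * n k.
Proof.
move=> Vv nv Vk.
apply: (linear_part_le VL n_ge0 nZ rho_gt0 (increment_infinitesimally_linear Vv nv)) => // a Va na.
apply: le_trans (G_lip Vv Va nv na) _.
by rewrite nZ// mulrCA.
Qed.

Lemma gradient_approx v h : V v -> n v <= rho -> V h -> n h <= rho ->
  `|G (fun x => v x + h x) - G v - gradient v h| <= 2 * C * n h ^+ 2.
Proof.
move=> Vv nv Vh nh.
have H := increment_almost_linear Vv nv (n_ge0 h) nh.
have := linear_part_approx VL n_ge0 nZ (increment_infinitesimally_linear Vv nv) H Vh (lexx _).
by rewrite expr2 mulrA.
Qed.

(** As $G(0)=0$, the quotients of [mixed h] are the differences between the quotients of the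
    increments of [G] at [h] and at $0$. Estimates of second differences thereby become estimates of
    differences of gradients. *)
Lemma gradient_diff_cvg h k : V h -> n h <= rho -> V k ->
  dyadic (mixed h) k @ \oo --> gradient h k - gradient (fun _ => 0) k.
Proof.
move=> Vh nh Vk; have Vz := V0 Vh; have nz := n0_le Vh.
have c1 := linear_part_cvg VL n_ge0 nZ (increment_infinitesimally_linear Vh nh) Vk.
have c2 := linear_part_cvg VL n_ge0 nZ (increment_infinitesimally_linear Vz nz) Vk.
rewrite (_ : dyadic _ _ = (fun m => dyadic (fun k => G (fun x => h x + k x) - G h) k m
   - dyadic (fun h0 => G (fun x => 0 + h0 x) - G (fun _ => 0)) k m)).
  by apply: cvgB.
apply/funext => m; rewrite /dyadic /mixed G0 subr0 -mulrBr; congr (_ * (_ - G _)).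
by apply/funext => x; rewrite add0r.
Qed.

Lemma gradient_diff_le h k : V h -> n h <= rho -> V k ->
  `|gradient h k - gradient (fun _ => 0) k| <= C * n h * n k.
Proof.
move=> Vh nh Vk; have [m md] := half_pow_small (n k) rho_gt0.
rewrite -[X in `|X|]subr0.
apply: (@cvg_dist_le R _ _ _ _ m (gradient_diff_cvg Vh nh Vk)) => p mp.
have p0 : 0 < 2 ^+ p :> R by exact: exprn_gt0.
have np : `|2 ^- p| = 2 ^- p :> R by rewrite ger0_norm// invr_ge0 ltW.
have Vp := V_scale (2 ^- p) Vk.
have kp : n (fun x => 2 ^- p * k x) <= rho.
  by rewrite nZ// np (le_trans (half_pow_le (n_ge0 k) mp)).
rewrite subr0 /dyadic normrM gtr0_norm//.
apply: le_trans (ler_wpM2l (ltW p0) (mixed_le Vh Vp nh kp)) _.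
rewrite nZ// np mulrCA [2 ^+ p * _]mulrA divff ?gt_eqF// mul1r.
by rewrite lexx.
Qed.

Let pow2_gt0 (m : nat) : 0 < 2 ^+ m :> R. Proof. exact: exprn_gt0. Qed.
Let pow2V m : 2 ^+ m * 2 ^- m = 1 :> R. Proof. by rewrite divff// gt_eqF. Qed.
Let norm2V m : `|2 ^- m| = 2 ^- m :> R.
Proof. by rewrite ger0_norm// invr_ge0 ltW. Qed.
Let half_pow_le1 m : 2 ^- m <= 1 :> R.
Proof. by have := @half_pow_le R 0 m 1 ler01 (leq0n m); rewrite !mulr1 expr0 invr1. Qed.
Let half_pow_n m p d h : V h -> 2 ^- m * n h <= d -> (m <= p)%N -> n (fun x => 2 ^- p * h x) <= d.
Proof. by move=> Vh md mp; rewrite nZ// norm2V (le_trans (half_pow_le (n_ge0 h) mp)). Qed.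

Lemma mixedC h k : mixed h k = mixed k h.
Proof.
rewrite /mixed addrAC; congr (G _ - _ - _).
by apply/funext => x; rewrite addrC.
Qed.

(** The dyadic limit shrinks [k] into the ball of [mixed_lin], so the almost linearity in [h] holds
    for every [k], with a factor [n k]. The last conclusion compares every quotient with [mixed h k]
    and ties the gradient to an actual second difference. *)
Lemma gradient_diff_almost_linear e : 0 < e -> exists2 d : R, 0 < d &
  [/\ d <= rho,
   forall k, V k -> almost_linear V n (fun h => gradient h k - gradient (fun _ => 0) k) (e * n k) d
   & forall h k, V h -> V k -> n h <= d -> n k <= d ->
     `|gradient h k - gradient (fun _ => 0) k - mixed h k| <= e * n h * n k].
Proof.
move=> e0; have [d1 d10 H] := mixed_lin e0; pose d := Num.min (rho / 2) d1.
have d0 : 0 < d by rewrite lt_min d10 divr_gt0.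
have dr2 : d <= rho / 2 by rewrite ge_min lexx.
have dr : d <= rho by lra.
have dd1 : d <= d1 by rewrite ge_min lexx orbT.
exists d => //; split => //.
- move=> k Vk a b h1 h2 a1 b1 Vh1 Vh2 hd1 hd2.
  have Vab := VL a b Vh1 Vh2.
  have nab : n (fun x => a * h1 x + b * h2 x) <= rho.
    apply: le_trans (n_comb a b Vh1 Vh2) _.
    have := ler_wpM2r (n_ge0 h1) a1; have := ler_wpM2r (n_ge0 h2) b1; lra.
  have c1 := gradient_diff_cvg Vh1 (le_trans hd1 dr) Vk.
  have c2 := gradient_diff_cvg Vh2 (le_trans hd2 dr) Vk.
  have c3 := gradient_diff_cvg Vab nab Vk.
  have cv := @cvg_comb3 R _ _ _ _ _ _ a b c3 c1 c2.
  have [m md] := half_pow_small (n k) d10.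
  rewrite -[X in `|X|]subr0; apply: (@cvg_dist_le R _ _ _ _ m cv) => p mp.
  have Vp := V_scale (2 ^- p) Vk; have kp := half_pow_n Vk md mp.
  rewrite subr0 /= /dyadic.
  have := H a b h1 h2 _ Vh1 Vh2 Vp a1 b1 (le_trans hd1 dd1) (le_trans hd2 dd1) kp.
  rewrite nZ// norm2V; set X := mixed _ _; set Y := mixed _ _; set Z := mixed _ _ => K.
  rewrite [X in `|X|](_ : _ = 2 ^+ p * (X - a * Y - b * Z)); last first.
    by rewrite /=; ring.
  rewrite normrM gtr0_norm//; apply: le_trans (ler_wpM2l (ltW (pow2_gt0 p)) K) _.
  rewrite (_ : _ * _ = (2 ^+ p * 2 ^- p) * (e * n k * (`|a| * n h1 + `|b| * n h2))); last by ring.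
  by rewrite pow2V mul1r.
- move=> h k Vh Vk hd kd.
  apply: (@cvg_dist_le R _ _ _ _ 0%N (gradient_diff_cvg Vh (le_trans hd dr) Vk)) => p _.
  rewrite /dyadic.
  (* [mixed_lin] concerns the first argument, so [k] is moved there by symmetry; the coefficient $0$
     on the second copy of [k] leaves a pure scaling. *)
  have := H (2 ^- p) 0 k k h Vk Vk Vh; rewrite norm2V normr0 => /(_ (half_pow_le1 p) ler01).
  move=> /(_ (le_trans kd dd1) (le_trans kd dd1) (le_trans hd dd1)).
  rewrite !mul0r addr0 subr0 !(mixedC _ h).
  rewrite (_ : (fun x => _) = (fun x => 2 ^- p * k x)); last first.
    by apply/funext => x; rewrite mul0r addr0.
  move=> K.
  have -> : 2 ^+ p * mixed h (fun x => 2 ^- p * k x) - mixed h k =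
     2 ^+ p * (mixed h (fun x => 2 ^- p * k x) - 2 ^- p * mixed h k).
    by rewrite [RHS]mulrBr; congr (_ - _); rewrite mulrA pow2V mul1r.
  rewrite normrM gtr0_norm//; apply: le_trans (ler_wpM2l (ltW (pow2_gt0 p)) K) _.
  rewrite (_ : _ * _ = (2 ^+ p * 2 ^- p) * (e * n h * n k)); last by ring.
  by rewrite pow2V mul1r.
Qed.

Lemma gradient_diff_infinitesimally_linear k : V k ->
  infinitesimally_linear V n (fun h => gradient h k - gradient (fun _ => 0) k).
Proof.
move=> Vk e e0; have e1 : 0 < e / (n k + 1) by rewrite divr_gt0// ltr_wpDl.
have [d d0 [dr /(_ k Vk) H _]] := gradient_diff_almost_linear e1.
exists d => // a b h1 h2 a1 b1 Vh1 Vh2 hd1 hd2.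
apply: le_trans (H a b h1 h2 a1 b1 Vh1 Vh2 hd1 hd2) _.
rewrite ler_wpM2r//; first by rewrite addr_ge0// mulr_ge0.
by apply: frac_succ_le => //; exact: ltW.
Qed.

Lemma hessian_linear_l k a b h1 h2 : V k -> V h1 -> V h2 ->
  hessian (fun x => a * h1 x + b * h2 x) k = a * hessian h1 k + b * hessian h2 k.
Proof.
move=> Vk Vh1 Vh2; rewrite /hessian.
exact: (linear_part_linear VL n_ge0 nZ a b (gradient_diff_infinitesimally_linear Vk)).
Qed.

(** The gradient is linear in [k] at each point $2^{-p}h$ of the approximating sequence, and the
    limit preserves this. *)
Lemma hessian_linear_r h a b k1 k2 : V h -> V k1 -> V k2 ->
  hessian h (fun x => a * k1 x + b * k2 x) = a * hessian h k1 + b * hessian h k2.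
Proof.
move=> Vh Vk1 Vk2; apply/eqP; rewrite -subr_eq0 -normr_le0 -[X in `|X|]subr0.
have c k (Vk : V k) := linear_part_cvg VL n_ge0 nZ (gradient_diff_infinitesimally_linear Vk) Vh.
have cv := @cvg_comb3 R _ _ _ _ _ _ a b (c _ (VL a b Vk1 Vk2)) (c _ Vk1) (c _ Vk2).
rewrite opprD addrA.
have [m md] := half_pow_small (n h) rho_gt0.
apply: (@cvg_dist_le R _ _ _ _ m cv) => p mp.
have hp := half_pow_n Vh md mp; have Vp := V_scale (2 ^- p) Vh.
rewrite /dyadic /= !gradient_linear//; [|exact: V0 Vh|exact: n0_le Vh].
by rewrite [X in `|X|](_ : _ = 0) ?normr0//; ring.
Qed.

Lemma hessian_le h k : V h -> V k -> `|hessian h k| <= C * n h * n k.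
Proof.
move=> Vh Vk.
apply: (linear_part_le VL n_ge0 nZ rho_gt0 (gradient_diff_infinitesimally_linear Vk)) => // a Va na.
apply: le_trans (gradient_diff_le Va na Vk) _.
by rewrite nZ// (_ : _ * _ * _ = `|a| * (C * n h * n k))//; ring.
Qed.

Lemma hessian_approx e : 0 < e -> exists2 d : R, 0 < d &
  forall h k, V h -> V k -> n h <= d ->
    `|gradient h k - gradient (fun _ => 0) k - hessian h k| <= e * n h * n k.
Proof.
move=> e0; have [d d0 [_ H _]] := gradient_diff_almost_linear e0.
exists d => // h k Vh Vk hd; rewrite mulrAC.
exact: (linear_part_approx VL n_ge0 nZ (gradient_diff_infinitesimally_linear Vk) (H k Vk)).
Qed.

(** Links the second derivative, an abstract limit, to a combination of values of [G], which the
    maximum principle can estimate. *)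
Lemma hessian_mixed e : 0 < e -> exists2 d : R, 0 < d &
  forall h k, V h -> V k -> n h <= d -> n k <= d ->
    `|hessian h k - mixed h k| <= e * n h * n k.
Proof.
move=> e0; have e2 : 0 < e / 2 by rewrite divr_gt0.
have [d1 d10 H1] := hessian_approx e2.
have [d2 d20 [_ _ H2]] := gradient_diff_almost_linear e2.
exists (Num.min d1 d2); first by rewrite lt_min d10.
move=> h k Vh Vk; rewrite !le_min => /andP[h1 h2] /andP[k1 k2].
rewrite -(subrKA (gradient h k - gradient (fun _ => 0) k)).
apply: le_trans (ler_normD _ _) _; rewrite distrC.
have := H1 h k Vh Vk h1; have := H2 h k Vh Vk h2 k2; lra.
Qed.

End TwiceDifferentiable.

(** * Integrals over the unit interval, and $V$ as an inner product space *)

Section UnitIntervalIntegrals.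
Variable R : realType.
Local Notation mu := (@lebesgue_measure R).
Local Notation I := (`[0%R, 1%R])%classic.
Implicit Types (f g k u v : R -> R) (a b c : R).

Definition integrable01 f := mu.-integrable I (EFin \o f).
Definition int01 f : R := \int[mu]_(x in I) f x.

Lemma integrable01_lin a b f g : integrable01 f -> integrable01 g ->
  integrable01 (fun x => a * f x + b * g x).
Proof.
move=> mf mg; rewrite /integrable01.
have -> : EFin \o (fun x => a * f x + b * g x) =
  ((fun x => a%:E * (EFin \o f) x) \+ (fun x => b%:E * (EFin \o g) x))%E.
  by apply/funext => x /=; rewrite -!EFinM -EFinD.
by apply: integrableD => //; exact: integrableZl.
Qed.

Lemma integrable01_scale a f : integrable01 f -> integrable01 (fun x => a * f x).
Proof.
move=> mf; have := integrable01_lin a 0 mf mf.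
by rewrite (_ : (fun x => _) = (fun x => a * f x))//; apply/funext => x; rewrite mul0r addr0.
Qed.

Lemma integrable01_norm f : integrable01 f -> integrable01 (fun x => `|f x|).
Proof. exact: integrable_abse. Qed.

Lemma int01_lin a b f g : integrable01 f -> integrable01 g ->
  int01 (fun x => a * f x + b * g x) = a * int01 f + b * int01 g.
Proof.
move=> mf mg; rewrite /int01 RintegralD//; last 2 first.
- exact: integrable01_scale.
- exact: integrable01_scale.
by rewrite !RintegralZl.
Qed.

Lemma int01_scale a f : integrable01 f -> int01 (fun x => a * f x) = a * int01 f.
Proof. by move=> mf; rewrite /int01 RintegralZl. Qed.

Lemma integrable01_cont f : {within I, continuous f} -> integrable01 f.
Proof. by apply: continuous_compact_integrable; exact: segment_compact. Qed.

Lemma int01_cst c : int01 (fun _ => c) = c.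
Proof.
rewrite /int01 Rintegral_cst//.
have := @lebesgue_measure_itv R `[0, 1]%R; rewrite /= lte_fin ltr01 sube0 => ->.
by rewrite mulr1.
Qed.

Lemma le_int01 f g : integrable01 f -> integrable01 g ->
  (forall x, 0 <= x <= 1 -> f x <= g x) -> int01 f <= int01 g.
Proof. by move=> mf mg fg; apply: le_Rintegral => // x; rewrite /= in_itv; exact: fg. Qed.

Lemma int01_ge0 f : (forall x, 0 <= x <= 1 -> 0 <= f x) -> 0 <= int01 f.
Proof. by move=> fg; apply: Rintegral_ge0 => // x; rewrite /= in_itv; exact: fg. Qed.

Lemma eq_int01 f g : (forall x, 0 <= x <= 1 -> f x = g x) -> int01 f = int01 g.
Proof. by move=> fg; apply: eq_Rintegral => x; rewrite inE /= in_itv; exact: fg. Qed.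

Lemma int01_norm_le f c : integrable01 f -> (forall x, 0 <= x <= 1 -> `|f x| <= c) ->
  `|int01 f| <= c.
Proof.
move=> mf fc; apply: le_trans (le_normr_Rintegral _ mf) _ => //.
rewrite -[leRHS]int01_cst; apply: le_int01 => //; first exact: integrable01_norm.
by apply: integrable01_cont; apply: continuous_subspaceT => x; exact: cvg_cst.
Qed.

Lemma integrable01_mul f g : integrable01 f -> integrable01 g ->
  integrable01 (fun x => f x ^+ 2) -> integrable01 (fun x => g x ^+ 2) ->
  integrable01 (fun x => f x * g x).
Proof.
move=> mf mg mf2 mg2; have m2 := integrable01_lin 1 1 mf2 mg2.
apply: (le_integrable _ _ _ m2) => //.
- apply/measurable_EFinP; apply: measurable_funM.
  + by apply/measurable_EFinP; exact: measurable_int mf.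
  + by apply/measurable_EFinP; exact: measurable_int mg.
- move=> x _ /=; rewrite lee_fin !mul1r [leRHS]ger0_norm ?addr_ge0 ?sqr_ge0//.
  by rewrite ler_norml; apply/andP; split; nra.
Qed.

Lemma ae_and (P Q S : R -> Prop) : (forall x, P x -> Q x -> S x) ->
  (\forall x \ae mu, P x) -> (\forall x \ae mu, Q x) -> \forall x \ae mu, S x.
Proof.
move=> H hP hQ; apply: (negligibleS _ (negligibleU hP hQ)) => x /=.
by move=> nS; apply: contra_notP nS => /not_orP[/contrapT ? /contrapT ?]; exact: H.
Qed.

Lemma ae_imp (P Q : R -> Prop) : (forall x, P x -> Q x) ->
  (\forall x \ae mu, P x) -> \forall x \ae mu, Q x.
Proof. by move=> H hP; apply: (@ae_and P P Q) => // x /H. Qed.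

Lemma ae_eq_int01 f g : integrable01 f -> integrable01 g ->
  (\forall x \ae mu, 0 < x < 1 -> f x = g x) -> int01 f = int01 g.
Proof.
move=> mf mg fg; rewrite /int01 /Rintegral; congr fine.
apply: ae_eq_integral => //; [exact: measurable_int mf|exact: measurable_int mg|].
have h0 : \forall x \ae mu, x != 0.
  exists [set 0]; split => //; first exact: lebesgue_measure_set1.
  by move=> x /= /negP; rewrite negbK => /eqP.
have h1 : \forall x \ae mu, x != 1.
  exists [set 1]; split => //; first exact: lebesgue_measure_set1.
  by move=> x /= /negP; rewrite negbK => /eqP.
near=> x; rewrite /= in_itv/= => /andP[x0 x1].
congr (_%:E); have := near fg x; apply => //.
rewrite !lt_neqAle x0 x1 !andbT eq_sym.
by apply/andP; split; [exact: (near h0 x)|exact: (near h1 x)].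
Unshelve. all: by end_near. Qed.

(** Lebesgue differentiation: almost everywhere [f] is the derivative of its primitive, here zero.
    Extending [f] by zero first makes it integrable on the whole line. *)
Lemma ae_eq0_of_primitive f : integrable01 f ->
  (forall x, 0 <= x <= 1 -> \int[mu]_(s in `[0%R, x]) f s = 0) ->
  \forall x \ae mu, 0 < x < 1 -> f x = 0.
Proof.
move=> mf f0; pose g := f \_ I.
have mgT : mu.-integrable setT (EFin \o g).
  by have /integrable_mkcond := mf; rewrite restrict_EFin; apply.
have mgy y : mu.-integrable [set` Interval (BLeft 0) (BRight y)] (EFin \o g).
  by apply: integrableS mgT.
have H := @FTC1 R g (BLeft 0) mgy (integrable_locally (measurable_itv _) mf).
pose F (x : R) : R := \int[mu]_(t in `[0%R, x]%classic) g t.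
move: H => /=; rewrite -/F; apply: ae_imp => x.
move=> H /andP[x0 x1]; have [] := H _; first by rewrite lte_fin.
  move=> _; rewrite /g patchE mem_set ?/= ?in_itv/= ?(ltW x0) ?(ltW x1)// => <-.
  rewrite derive1E (near_eq_derive (g := cst 0)) ?derive_cst//.
  near=> y; have y0 : 0 < y by near: y; exact: lt_nbhsr.
  have y1 : y < 1 by near: y; exact: lt_nbhsl.
  rewrite /= -(f0 y) ?(ltW y0) ?(ltW y1)//.
  apply: eq_Rintegral => z; rewrite inE /= in_itv/= => /andP[z0 zy].
  by rewrite /g patchE mem_set//= in_itv/= z0/= (le_trans zy)// ltW.
Unshelve. all: by end_near. Qed.

Lemma H10rep_lin a b u v g k : H10rep u g -> H10rep v k ->
  H10rep (fun x => a * u x + b * v x) (fun x => a * g x + b * k x).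
Proof.
move=> [ug [ug2 [uE u1]]] [vk [vk2 [vE v1]]]; split; [|split; [|split]].
- exact: integrable01_lin.
- have gk := integrable01_mul ug vk ug2 vk2.
  have := integrable01_lin 1 1 (integrable01_lin (a ^+ 2) (b ^+ 2) ug2 vk2)
     (integrable01_scale (2 * a * b) gk).
  rewrite (_ : (fun x => 1 * _ + _) = (fun x => (a * g x + b * k x) ^+ 2))//.
  by apply/funext => x; ring.
- move=> x x01; rewrite uE// vE//.
  have sub : `[0, x]%classic `<=` I.
    move=> y /=; rewrite !in_itv/= => /andP[-> yx]/=.
    by move: x01 => /andP[_]; exact: le_trans.
  have ug' : mu.-integrable `[0, x] (EFin \o g) by apply: integrableS ug.
  have vk' : mu.-integrable `[0, x] (EFin \o k) by apply: integrableS vk.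
  rewrite RintegralD//; last 2 first.
  + exact: (@integrableZl _ _ _ mu _ (measurable_itv _) a _ ug').
  + exact: (@integrableZl _ _ _ mu _ (measurable_itv _) b _ vk').
  by rewrite !RintegralZl.
- by rewrite u1 v1 !mulr0 addr0.
Qed.

Lemma H10rep_ae u g k : H10rep u g -> H10rep u k ->
  \forall x \ae mu, 0 < x < 1 -> g x = k x.
Proof.
move=> ug uk; have [m1 [_ [E _]]] := H10rep_lin 1 (-1) ug uk.
have H : \forall x \ae mu, 0 < x < 1 -> 1 * g x + -1 * k x = 0.
  by apply: ae_eq0_of_primitive => // x x01; rewrite -E// mul1r mulN1r subrr.
apply: ae_imp H => x H x01; apply/eqP; rewrite -subr_eq0; apply/eqP.
by rewrite -H// mul1r mulN1r.
Qed.

Lemma VderP u : Vset u -> H10rep u (Vder u).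
Proof. by move=> [g ug]; apply: ClassicalEpsilon.epsilon_spec; exists g. Qed.

Definition Vip u v : R := int01 (fun x => Vder u x * Vder v x).

Lemma Vset_lin a b u v : Vset u -> Vset v -> Vset (fun x => a * u x + b * v x).
Proof. by move=> [g ug] [k vk]; eexists; exact: H10rep_lin ug vk. Qed.

(** [Vder] is an arbitrary choice of derivative. Two choices agree almost everywhere, so the inner
    product may be computed with any explicit one. *)
Lemma Vip_rep u v g k : H10rep u g -> H10rep v k ->
  Vip u v = int01 (fun x => g x * k x).
Proof.
move=> ug vk; have ud := VderP (ex_intro _ g ug); have vd := VderP (ex_intro _ k vk).
have h1 := H10rep_ae ug ud; have h2 := H10rep_ae vk vd.
move: ug vk ud vd => [ug [ug2 _]] [vk [vk2 _]] [ud [ud2 _]] [vd [vd2 _]].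
apply: ae_eq_int01; [exact: integrable01_mul|exact: integrable01_mul|].
by apply: ae_and h1 h2 => x h1 h2 x01; rewrite h1// h2.
Qed.

Lemma Vnorm_ge0 u : 0 <= Vnorm u.
Proof. exact: sqrtr_ge0. Qed.

Lemma Vnorm_sqr u : Vnorm u ^+ 2 = Vip u u.
Proof. by rewrite /Vnorm sqr_sqrtr//; apply: int01_ge0 => x _; exact: sqr_ge0. Qed.

Lemma VipC u v : Vip u v = Vip v u.
Proof. by apply: eq_int01 => x _; rewrite mulrC. Qed.

Lemma Vip_linl a b u v w : Vset u -> Vset v -> Vset w ->
  Vip (fun x => a * u x + b * v x) w = a * Vip u w + b * Vip v w.
Proof.
move=> /VderP ug /VderP vk /VderP wl.
rewrite (Vip_rep (H10rep_lin a b ug vk) wl) (Vip_rep ug wl) (Vip_rep vk wl).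
move: ug vk wl => [ug [ug2 _]] [vk [vk2 _]] [wl [wl2 _]].
rewrite -int01_lin; [|exact: integrable01_mul|exact: integrable01_mul].
by apply: eq_int01 => x _; ring.
Qed.

Lemma Vip_linr a b u v w : Vset u -> Vset v -> Vset w ->
  Vip w (fun x => a * u x + b * v x) = a * Vip w u + b * Vip w v.
Proof. by move=> *; rewrite VipC Vip_linl// !(VipC w). Qed.

Lemma Vip_self_ge0 u : 0 <= Vip u u.
Proof. by rewrite -Vnorm_sqr sqr_ge0. Qed.

Lemma Vip_CS u v : Vset u -> Vset v -> `|Vip u v| <= Vnorm u * Vnorm v.
Proof.
move=> Vu Vv; rewrite -(@ler_pXn2r _ 2) ?nnegrE ?mulr_ge0 ?Vnorm_ge0//.
rewrite exprMn !Vnorm_sqr real_normK ?num_real//.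
have H s t : 0 <= s ^+ 2 * Vip u u + 2 * s * t * Vip u v + t ^+ 2 * Vip v v.
  have := Vip_self_ge0 (fun x => s * u x + t * v x).
  rewrite Vip_linl// ?Vip_linr//; last exact: Vset_lin.
  by rewrite (VipC v u); lra.
have h0 := Vip_self_ge0 u; have h1 := Vip_self_ge0 v.
move: (Vip u u) (Vip v v) (Vip u v) H h0 h1 => A B C H A0 B0.
have [A1|A1] := eqVneq A 0; last first.
  have Ap : 0 < A by rewrite lt_neqAle eq_sym A1.
  by have := H (- C) A; nra.
have [->|C0] := eqVneq C 0; first by rewrite expr0n mulr_ge0.
(* With $A=0$ the form is affine in $s$, and this point gives it the value $-1$. *)
have := H (- (B + 1) / (2 * C)) 1; rewrite A1.
have -> : 2 * (- (B + 1) / (2 * C)) * 1 * C = - (B + 1) by field.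
by lra.
Qed.

Lemma VnormZ a u : Vset u -> Vnorm (fun x => a * u x) = `|a| * Vnorm u.
Proof.
move=> Vu; apply/eqP; rewrite -(@eqrXn2 _ 2) ?mulr_ge0 ?Vnorm_ge0//.
rewrite exprMn !Vnorm_sqr real_normK ?num_real//.
rewrite (_ : (fun x => _) = (fun x => a * u x + 0 * u x)); last first.
  by apply/funext => x; rewrite mul0r addr0.
rewrite Vip_linl// ?Vip_linr//; last exact: Vset_lin.
by rewrite !mul0r !addr0 mulrA.
Qed.

Lemma Vnorm_comb a b u v : Vset u -> Vset v ->
  Vnorm (fun x => a * u x + b * v x) <= `|a| * Vnorm u + `|b| * Vnorm v.
Proof.
move=> Vu Vv.
rewrite -(@ler_pXn2r _ 2) ?nnegrE ?addr_ge0 ?mulr_ge0 ?Vnorm_ge0//.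
rewrite Vnorm_sqr Vip_linl// ?Vip_linr//; last exact: Vset_lin.
rewrite (VipC v u) -!Vnorm_sqr sqrrD !exprMn !real_normK ?num_real//.
have := Vip_CS Vu Vv => CS.
have : a * b * Vip u v <= `|a * b| * (Vnorm u * Vnorm v).
  apply: le_trans (ler_norm _) _; rewrite normrM.
  by rewrite ler_wpM2l.
by rewrite normrM; lra.
Qed.

(** $|u(x)|\le\int|u'|\le\|u'\|$, the passage from the norm of $V$ to the supremum norm of the
    maximum principle. The second inequality is the nonnegativity of the variance of $|u'|$. *)
Lemma Vsup_le u x : Vset u -> 0 <= x <= 1 -> `|u x| <= Vnorm u.
Proof.
move=> /VderP[ug [ug2 [uE _]]] x01; rewrite uE//.
have sub : `[0, x]%classic `<=` I.
  move=> y /=; rewrite !in_itv/= => /andP[-> yx]/=.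
  by move: x01 => /andP[_]; exact: le_trans.
have ug' : mu.-integrable `[0, x] (EFin \o Vder u) by apply: integrableS ug.
apply: le_trans (le_normr_Rintegral _ ug') _ => //.
have ng := integrable01_norm ug; set m := int01 (fun x => `|Vder u x|).
apply: (@le_trans _ _ m).
  rewrite /m /int01 /Rintegral fine_le//.
  - by apply: integrable_fin_num => //; apply: integrableS ng.
  - exact: integrable_fin_num.
  - by apply: ge0_subset_integral => //; exact: measurable_int ng.
have m0 : 0 <= m by apply: int01_ge0.
rewrite -(@ler_pXn2r _ 2) ?nnegrE ?Vnorm_ge0// Vnorm_sqr.
have c1 : integrable01 (fun _ => 1).
  by apply: integrable01_cont; apply: continuous_subspaceT => z; exact: cvg_cst.
have : 0 <= int01 (fun x => (`|Vder u x| - m) ^+ 2) by apply: int01_ge0 => z _; exact: sqr_ge0.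
rewrite (@eq_int01 _ (fun x => 1 * (1 * Vder u x ^+ 2 + (- 2 * m) * `|Vder u x|) + m ^+ 2 * 1)).
  rewrite int01_lin// ?int01_lin// ?int01_cst; last exact: integrable01_lin.
  rewrite -/m; set A := int01 _; have -> : Vip u u = A by [].
  by lra.
by move=> z _; rewrite -[Vder u z ^+ 2]real_normK ?num_real//; ring.
Qed.

End UnitIntervalIntegrals.

(** * Sine modes, and integration by parts against the first one *)

Section SineModes.
Variable R : realType.
Local Notation mu := (@lebesgue_measure R).
Local Notation I := (`[0%R, 1%R])%classic.
Implicit Types (w x t : R).

Lemma is_derive_mulx w x : is_derive x 1 (fun y : R => w * y) w.
Proof. by apply: is_derive_eq; rewrite /GRing.scale/= mulr1. Qed.

Lemma is_derive_sinw w x : is_derive x 1 (fun y : R => sin (w * y)) (w * cos (w * x)).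
Proof.
have ? := is_derive_mulx w x; rewrite mulrC.
exact: (@is_derive1_comp R (@sin R) (fun y => w * y)).
Qed.

Lemma is_derive_cosw w x : is_derive x 1 (fun y : R => cos (w * y)) (- w * sin (w * x)).
Proof.
have ? := is_derive_mulx w x; rewrite mulNr mulrC -mulNr.
exact: (@is_derive1_comp R (@cos R) (fun y => w * y)).
Qed.

Lemma is_derive_expw w x : is_derive x 1 (fun y : R => expR (w * y)) (w * expR (w * x)).
Proof.
have ? := is_derive_mulx w x; rewrite mulrC.
exact: (@is_derive1_comp R (@expR R) (fun y => w * y)).
Qed.

Lemma is_derive_continuous (f f' : R -> R) : (forall x : R, is_derive x 1 f (f' x)) -> continuous f.
Proof.
move=> df x; apply/differentiable_continuous/derivable1_diffP.
by have [] := df x.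
Qed.

Lemma continuous_sinw w : continuous (fun x : R => sin (w * x)).
Proof. exact: (is_derive_continuous (is_derive_sinw w)). Qed.

Lemma continuous_cosw w : continuous (fun x : R => cos (w * x)).
Proof. exact: (is_derive_continuous (is_derive_cosw w)). Qed.

Lemma ftc0 (F f : R -> R) x : (forall y : R, is_derive y 1 F (f y)) -> continuous f ->
  0 <= x -> \int[mu]_(s in `[0%R, x]) f s = F x - F 0.
Proof.
move=> dF cf; rewrite le_eqVlt => /predU1P[<-|x0].
  by rewrite subrr set_itv1 Rintegral_set1.
have cF := is_derive_continuous dF.
rewrite /Rintegral (@continuous_FTC2 R f F 0 x x0)//.
- exact: continuous_subspaceT.
- split; [by move=> y _; have [] := dF y| |].
  + exact/cvg_at_right_filter/cF.
  + exact/cvg_at_left_filter/cF.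
- by move=> y _; rewrite derive1E; have [_ ->] := dF y.
Qed.

Lemma integrable01_continuous (f : R -> R) : continuous f -> integrable01 f.
Proof. by move=> cf; apply: integrable01_cont; exact: continuous_subspaceT. Qed.

Lemma sin_intpi (m : int) : sin (m%:~R * pi) = 0 :> R.
Proof.
have sn (n : nat) : sin (n%:R * pi) = 0 :> R.
  elim: n => [|n IH]; first by rewrite mul0r sin0.
  by rewrite -natr1 mulrDl mul1r sinDpi IH oppr0.
case: m => n; first exact: sn.
by rewrite NegzE mulrNz mulNr sinN sn oppr0.
Qed.

Lemma sin_natpi (n : nat) : sin (n%:R * pi) = 0 :> R.
Proof. exact: (sin_intpi n). Qed.

(** Even and odd $m\ne0$ alike: the primitive, a multiple of $\sin(m\pi x)$, vanishes at both
    ends. *)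
Lemma int01_cos (m : int) : int01 (fun x : R => cos (m%:~R * pi * x)) = (m == 0)%:R.
Proof.
have [->|m0] := eqVneq m 0.
  rewrite -[RHS]int01_cst; apply: eq_int01 => x _.
  by rewrite !mul0r cos0.
have w0 : m%:~R * pi != 0 :> R by rewrite mulf_neq0 ?intr_eq0// gt_eqF ?pi_gt0.
set w := _ * pi in w0 *; rewrite /int01.
have dF (y : R) : is_derive y 1 (fun x => w^-1 * sin (w * x)) (cos (w * y)).
  have ? := is_derive_sinw w y; apply: is_derive_eq.
  by rewrite /GRing.scale/= mulrA mulVf// mul1r.
rewrite (ftc0 dF (@continuous_cosw w) ler01).
by rewrite mulr1 mulr0 sin0 mulr0 subr0 sin_intpi mulr0.
Qed.

Definition smode (j : nat) x : R := sin (j%:R * pi * x).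

Lemma H10rep_smode (j : nat) : H10rep (smode j) (fun x => j%:R * pi * cos (j%:R * pi * x)).
Proof.
have c : continuous (fun x : R => j%:R * pi * cos (j%:R * pi * x)).
  by move=> x; apply: cvgM; [exact: cvg_cst|exact: continuous_cosw].
split; [|split; [|split]].
- exact: integrable01_continuous.
- by apply: integrable01_continuous => x; apply: cvgM; exact: c.
- move=> x /andP[x0 _]; rewrite (ftc0 (is_derive_sinw _) c x0).
  by rewrite mulr0 sin0 subr0.
- by rewrite /smode mulr1 sin_natpi.
Qed.

Lemma Vset_smode (j : nat) : Vset (smode j).
Proof. by eexists; exact: H10rep_smode. Qed.

(** Over $n+1$ equal steps the bounds telescope to $K(A(1)-A(0))/(n+1)$. This plays the role of a
    zero derivative for a function that need not be differentiable. *)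
Lemma eq_of_small_increments (P A : R -> R) (K : R) :
  (forall x y, 0 <= x -> x <= y -> y <= 1 -> `|P y - P x| <= K * (y - x) * (A y - A x)) ->
  P 1 = P 0.
Proof.
move=> H.
have S (n : nat) : `|P 1 - P 0| <= K * n.+1%:R^-1 * (A 1 - A 0).
  have n0 : 0 < n.+1%:R :> R by rewrite ltr0n.
  have St (m : nat) : (m <= n.+1)%N ->
     `|P (m%:R / n.+1%:R) - P 0| <= K * n.+1%:R^-1 * (A (m%:R / n.+1%:R) - A 0).
    elim: m => [|m IH] mn; first by rewrite mul0r !subrr normr0 mulr0.
    have E : m.+1%:R / n.+1%:R - m%:R / n.+1%:R = n.+1%:R^-1 :> R.
      by rewrite -mulrBl -natrB// subSnn mul1r.
    have := H (m%:R / n.+1%:R) (m.+1%:R / n.+1%:R); rewrite E.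
    rewrite divr_ge0// -subr_ge0 E invr_ge0 ltW// ler_pdivrMr// mul1r ler_nat mn.
    move=> /(_ isT isT isT) h1; have {IH} h2 := IH (ltnW mn).
    rewrite -(subrKA (P (m%:R / n.+1%:R))); apply: le_trans (ler_normD _ _) _.
    by apply: le_trans (lerD h1 h2) _; rewrite -mulrDr addrA subrK.
  by have := St n.+1 (leqnn _); rewrite divff// gt_eqF.
apply/eqP; rewrite -subr_eq0 -normr_le0.
apply/ler_addgt0Pl => e e0; rewrite addr0.
pose B := `|K * (A 1 - A 0)|.
pose n := Num.truncn (B / e).
have Bn : B < e * n.+1%:R.
  by rewrite mulrC -ltr_pdivrMr// truncnS_gt.
apply: le_trans (S n) _; rewrite mulrAC ler_pdivrMr ?ltr0n//.
by apply: le_trans (ler_norm _) _; exact: ltW.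
Qed.

Lemma cos_lipschitz (a b : R) : `|cos b - cos a| <= `|b - a|.
Proof.
rewrite -[leRHS]mul1r.
apply: (@lipschitz_of_is_derive R (@cos R) (fun x => - sin x)) => y _.
rewrite normrN ler_norml; have := @sin2cos2 R y => h.
rewrite -ler_norml -(@ler_pXn2r _ 2) ?nnegrE// real_normK ?num_real// expr1n h.
by rewrite lerBlDl lerDr sqr_ge0.
Qed.

Lemma integrable01_mul_cont (g f : R -> R) : integrable01 g -> continuous f ->
  integrable01 (fun s => g s * f s).
Proof.
move=> mg cf.
have /EVT_max : {within `[0, 1], continuous (fun s => `|f s|)}.
  by apply: continuous_subspaceT => s; apply: cvg_norm; exact: cf.
move=> /(_ ler01)[c _ fc]; set M := `|f c|.
have m2 := integrable01_scale M mg.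
apply: (le_integrable _ _ _ m2) => //.
- apply/measurable_EFinP; apply: measurable_funM.
  + by apply/measurable_EFinP; exact: measurable_int mg.
  + by apply: measurable_funTS; exact: continuous_measurable_fun.
- move=> s /= s01; rewrite lee_fin !normrM [leRHS]mulrC ler_wpM2l//.
  by rewrite (ger0_norm (normr_ge0 _)) fc.
Qed.

Lemma Rintegral_lin (D : set R) (a b : R) (f g : R -> R) : measurable D ->
  mu.-integrable D (EFin \o f) -> mu.-integrable D (EFin \o g) ->
  \int[mu]_(x in D) (a * f x + b * g x) = a * \int[mu]_(x in D) f x + b * \int[mu]_(x in D) g x.
Proof.
move=> mD mf mg; rewrite RintegralD//; last 2 first.
- exact: (@integrableZl _ _ _ mu _ mD a _ mf).
- exact: (@integrableZl _ _ _ mu _ mD b _ mg).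
by rewrite !RintegralZl.
Qed.

Lemma Vset_continuous (h : R -> R) : Vset h -> {within I, continuous h}.
Proof.
move=> [g [mg [_ [hE _]]]].
apply: (@subspace_eq_continuous _ _ _ (fun x => \int[mu]_(t in `[0%R, x]) g t)).
  by move=> x; rewrite inE /= in_itv/= => /hE /esym.
exact: parameterized_integral_continuous.
Qed.

Let prim (f : R -> R) (x : R) : R := \int[mu]_(s in `[0%R, x]) f s.

Let sub_oc (x y : R) : 0 <= x -> y <= 1 -> `]x, y]%classic `<=` I.
Proof.
move=> x0 y1 s; rewrite /= !in_itv/= => /andP[xs sy].
by rewrite (le_trans x0 (ltW xs)) (le_trans sy y1).
Qed.

Let prim_diff (f : R -> R) (x y : R) : integrable01 f -> 0 <= x -> x <= y -> y <= 1 ->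
  prim f y - prim f x = \int[mu]_(s in `]x, y]) f s.
Proof.
move=> mf x0 xy y1; rewrite /prim Rintegral_itvB//.
apply: integrableS mf => // s; rewrite /= !in_itv/= => /andP[-> sy] /=.
exact: le_trans sy y1.
Qed.

Let int_oc_cst (x y c : R) : x <= y -> \int[mu]_(s in `]x, y]) c = c * (y - x).
Proof.
move=> xy; rewrite Rintegral_cst//.
have := @lebesgue_measure_itv R `]x, y]%R; rewrite /= lte_fin => ->.
by move: xy; rewrite le_eqVlt => /predU1P[->|->]; rewrite ?ltxx ?subrr.
Qed.

(** [h] is only the primitive of an integrable function, so the product rule cannot be applied
    pointwise. Instead the defect [P] of the identity on $[0,x]$ has increments bounded by
    $2\pi(y-x)$ times the increment of $\int|g|$, hence [P 1 = P 0]; the zeros of [h] at the ends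
    remove the boundary term. *)
Lemma int_by_parts_cos (h g : R -> R) : H10rep h g ->
  int01 (fun x => g x * cos (pi * x)) = int01 (fun x => pi * (h x * sin (pi * x))).
Proof.
move=> hg; have Vh : Vset h by exists g.
have [mg [_ [hE h1]]] := hg.
have hE' x : 0 <= x <= 1 -> h x = prim g x by exact: hE.
have h0 : h 0 = 0 by rewrite hE ?lexx ?ler01// set_itv1 Rintegral_set1.
have mgc := integrable01_mul_cont mg (@continuous_cosw pi).
have mhs0 := integrable01_mul_cont (integrable01_cont (Vset_continuous Vh)) (@continuous_sinw pi).
have mhs := integrable01_scale pi mhs0.
have ms : integrable01 (fun s : R => pi * sin (pi * s)).
  by apply/integrable01_scale/integrable01_continuous/continuous_sinw.
have mng := integrable01_norm mg.
have m1 : integrable01 (fun _ : R => 1) by apply: integrable01_continuous => z; exact: cvg_cst.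
pose A := prim (fun s => `|g s|).
pose P x := prim (fun s => g s * cos (pi * s)) x - h x * cos (pi * x)
            - prim (fun s => pi * (h s * sin (pi * s))) x.
have P10 : P 1 = P 0.
  apply: (@eq_of_small_increments P A (2 * pi)) => x y x0 xy y1.
  have x01 : 0 <= x <= 1 by rewrite x0 (le_trans xy).
  have y01 : 0 <= y <= 1 by rewrite y1 (le_trans x0).
  set D := `]x, y]%classic; have DI : D `<=` I by exact: sub_oc.
  have mD : measurable D by exact: measurable_itv.
  have onD f : integrable01 f -> mu.-integrable D (EFin \o f) by apply: integrableS.
  have AE := prim_diff mng x0 xy y1; rewrite -/A -/D in AE.
  have hs s : D s -> `|h x - h s| <= A y - A x.
    rewrite /D /= in_itv/= => /andP[xs sy].
    have s1 := le_trans sy y1; have xs' := ltW xs.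
    have s01 : 0 <= s <= 1 by rewrite (le_trans x0 xs').
    rewrite distrC !hE'// prim_diff// AE.
    have DsI := sub_oc x0 s1.
    have gs : mu.-integrable `]x, s] (EFin \o g) by apply: integrableS mg.
    apply: le_trans (le_normr_Rintegral _ gs) _ => //.
    rewrite /Rintegral fine_le//.
    - by apply: integrable_fin_num => //; apply: integrableS mng.
    - by apply: integrable_fin_num => //; exact: onD.
    - apply: ge0_subset_integral => //.
      + by apply: measurable_int (onD _ mng).
      + move=> z; rewrite /D /= !in_itv/= => /andP[-> zs]/=; exact: le_trans zs sy.
  have cosE : cos (pi * x) - cos (pi * y) = \int[mu]_(s in D) (pi * sin (pi * s)).
    rewrite -prim_diff// /prim.
    have dF (z : R) : is_derive z 1 (fun z => - cos (pi * z)) (pi * sin (pi * z)).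
      have ? := is_derive_cosw pi z; apply: is_derive_eq.
      by rewrite mulNr opprK.
    have cF : continuous (fun z : R => pi * sin (pi * z)).
      by move=> z; apply: cvgM; [exact: cvg_cst|exact: continuous_sinw].
    rewrite (ftc0 dF cF) ?(ftc0 dF cF)//; last exact: le_trans x0 xy.
    by ring.
  (* The integrand of the increment of [P]. It regroups as $g(s)(\cos\pi s-\cos\pi y)+\pi\sin(\pi
     s)(h(x)-h(s))$, where each product has a factor that is small on a short interval. *)
  pose F s := 1 * (1 * (g s * cos (pi * s)) + (- cos (pi * y)) * g s)
              + 1 * (h x * (pi * sin (pi * s)) + (- 1) * (pi * (h s * sin (pi * s)))).
  have F1 := integrable01_lin 1 (- cos (pi * y)) mgc mg.
  have F2 := integrable01_lin (h x) (- 1) ms mhs.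
  have mF := integrable01_lin 1 1 F1 F2.
  have PE : P y - P x = \int[mu]_(s in D) F s.
    rewrite /F Rintegral_lin// ?Rintegral_lin//; try exact: onD.
    rewrite -cosE -!prim_diff// -!hE'// /P.
    by ring.
  rewrite PE; apply: le_trans (le_normr_Rintegral _ (onD _ mF)) _ => //.
  have B1 := integrable01_lin (pi * (y - x)) (pi * (A y - A x)) mng m1.
  apply: le_trans (_ : \int[mu]_(s in D) (pi * (y - x) * `|g s| + pi * (A y - A x) * 1) <= _).
    apply: le_Rintegral => //; [exact/onD/integrable01_norm|exact: onD|].
    move=> s Ds; have := hs s Ds; move: Ds; rewrite /D /= in_itv/= => /andP[xs sy] hxs.
    rewrite -/(F s); have -> : F s = g s * (cos (pi * s) - cos (pi * y)) + pi * sin (pi * s) * (h x - h s).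
      by rewrite /F; ring.
    apply: le_trans (ler_normD _ _) _; rewrite !normrM (ger0_norm (pi_ge0 R)) mulr1.
    apply: lerD.
      rewrite mulrC ler_wpM2r//; apply: le_trans (cos_lipschitz _ _) _.
      rewrite -mulrBr normrM (ger0_norm (pi_ge0 R)) ler_wpM2l ?pi_ge0// ler_norml.
      by apply/andP; split; lra.
    apply: ler_pM => //; first by rewrite mulr_ge0 ?pi_ge0.
    by rewrite ler_piMr ?pi_ge0// ler_norml sin_geN1 sin_le1.
  rewrite Rintegral_lin// ?int_oc_cst//; try exact: onD.
  rewrite -AE mul1r.
  by rewrite (_ : _ + _ = 2 * pi * (y - x) * (A y - A x))//; ring.
have prim0 f : prim f 0 = 0 by rewrite /prim set_itv1 Rintegral_set1.
have := P10; rewrite /P !prim0 h0 h1 !mul0r !subr0 => /eqP; rewrite subr_eq0 => /eqP.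
exact.
Qed.

(** The first mode is a weak eigenfunction of $-d^2/dx^2$ with eigenvalue $\pi^2$, so it represents
    [Hobs] in $V$ up to this factor. *)
Lemma Vip_smode1 (h : R -> R) : Vset h -> Vip (smode 1) h = pi ^+ 2 * Hobs h.
Proof.
move=> [g hg]; rewrite (Vip_rep (H10rep_smode 1) hg).
have [mg _] := hg; have mgc := integrable01_mul_cont mg (@continuous_cosw pi).
have Vh : Vset h by exists g.
have mhs := integrable01_mul_cont (integrable01_cont (Vset_continuous Vh)) (@continuous_sinw pi).
rewrite (@eq_int01 _ _ (fun x => pi * (g x * cos (pi * x)))); last first.
  by move=> x _; rewrite !mul1r; ring.
by rewrite int01_scale// (int_by_parts_cos hg) int01_scale// expr2 mulrA.
Qed.

End SineModes.

(** * Explicit heat solutions, and weighted orthogonality of the modes *)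

Section HeatModes.
Variable R : realType.
Implicit Types (d v : R -> R -> R) (x t : R).

Lemma heat_solution0 : @heat_solution R (fun _ _ => 0) (fun _ _ => 0).
Proof.
split; [|split] => //; first by apply/subspace_continuousP => p _; exact: cvg_cst.
move=> x t _ _; exists 0, 0, (fun _ => 0); split; try exact: is_derive_cst.
  by move=> y _; exact: is_derive_cst.
by rewrite addr0.
Qed.

Lemma heat_solution_sum (n : nat) (c : 'I_n -> R) (d : 'I_n -> R -> R -> R) :
  (forall i, heat_solution (d i) (fun _ _ => 0)) ->
  heat_solution (fun x t => \sum_(i < n) c i * d i x t) (fun _ _ => 0).
Proof.
elim: n c d => [|n IH] c d hd.
  rewrite (_ : (fun x t => _) = (fun _ _ => 0)); first exact: heat_solution0.
  by apply/funext => x; apply/funext => t; rewrite big_ord0.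
have h1 := IH (fun i => c (lift ord0 i)) (fun i => d (lift ord0 i)) (fun i => hd _).
have := heat_solution_lin (c ord0) 1 (hd ord0) h1.
rewrite (_ : (fun x t => _ + 1 * _) =
  (fun x t => \sum_(i < n.+1) c i * d i x t)); last first.
  by apply/funext => x; apply/funext => t; rewrite big_ord_recl mul1r.
rewrite (_ : (fun x t => _ + _) = (fun _ _ => 0))//.
by apply/funext => x; apply/funext => t; rewrite !mulr0 addr0.
Qed.

Definition decay (j : nat) t : R := expR (- (j%:R * pi) ^+ 2 * t).

Lemma decay0 j : decay j 0 = 1.
Proof. by rewrite /decay mulr0 expR0. Qed.

Lemma heat_mode (j : nat) : heat_solution (fun x t => decay j t * smode j x) (fun _ _ => 0).
Proof.
pose w : R := j%:R * pi; split; [|split].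
- apply/subspace_continuousP => p _; apply: cvg_within_filter; apply: cvgM.
    apply: (@continuous_comp _ _ _ (fun p : R * R => p.2) (decay j)); first exact: cvg_snd.
    exact: (is_derive_continuous (is_derive_expw _)).
  apply: (@continuous_comp _ _ _ (fun p : R * R => p.1) (smode j)); first exact: cvg_fst.
  exact: continuous_sinw.
- move=> x t _ _.
  exists (- w ^+ 2 * decay j t * smode j x), (- w ^+ 2 * decay j t * smode j x).
  exists (fun y => decay j t * (w * cos (w * y))); split.
  + have ? := is_derive_expw (- w ^+ 2) t.
    rewrite /decay -/w (_ : (fun s => _) = (fun s => smode j x * expR (- w ^+ 2 * s))); last first.
      by apply/funext => s; rewrite mulrC.
    by apply: is_derive_eq; rewrite /GRing.scale/= mulrC.
  + by move=> y _; have ? := is_derive_sinw w y; exact: is_derive_eq.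
  + have ? := is_derive_cosw w x; apply: is_derive_eq.
    by rewrite /GRing.scale/= /smode -/w; ring.
  + by rewrite addr0.
- by move=> t _; rewrite /smode mulr0 mulr1 sin0 sin_natpi !mulr0.
Qed.

(* The key subsolution: [t v^2] vanishes at time [0] and its source is at most [v^2]. *)
Lemma heat_solution_tsq v : heat_solution v (fun _ _ => 0) ->
  heat_solution (fun x t => t * v x t ^+ 2)
    (fun x t => v x t ^+ 2 - 2 * t * (derive1 (v ^~ t) x) ^+ 2).
Proof.
move=> [cv [dv v0]]; split; [|split].
- apply/subspace_continuousP => p sp; move/subspace_continuousP : cv => /(_ p sp) cv.
  apply: cvgM; last by apply: cvgM.
  by apply: cvg_within_filter; exact: cvg_snd.
- move=> x t x01 t0; have [dt [dxx [dx [d1 d2 d3 d4]]]] := dv x t x01 t0.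
  exists (v x t ^+ 2 + t * (2 * v x t * dt)), (2 * t * (dx x ^+ 2 + v x t * dxx)).
  exists (fun y => 2 * t * (v y t * dx y)); split.
  + have ? := is_derive_id t (1 : R); apply: is_derive_eq.
    by rewrite /GRing.scale/=; ring.
  + move=> y y01; have ? := d2 y y01; apply: is_derive_eq.
    by rewrite /GRing.scale/=; ring.
  + have ? := d2 x x01; apply: is_derive_eq.
    by rewrite /GRing.scale/=; ring.
  + have -> : derive1 (v ^~ t) x = dx x by rewrite derive1E; have [_ ->] := d2 x x01.
    by rewrite d4; ring.
- by move=> t t0; have [-> ->] := v0 t t0; rewrite expr0n mulr0.
Qed.

Lemma integrable01_sum (n : nat) (F : 'I_n -> R -> R) : (forall i, integrable01 (F i)) ->
  integrable01 (fun x => \sum_(i < n) F i x) /\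
  int01 (fun x => \sum_(i < n) F i x) = \sum_(i < n) int01 (F i).
Proof.
elim: n F => [|n IH] F mF.
  split.
    by apply: integrable01_continuous; under eq_fun do rewrite big_ord0; move=> x; exact: cvg_cst.
  by rewrite big_ord0; under eq_fun do rewrite big_ord0; exact: int01_cst.
have [h1 h2] := IH (fun i => F (lift ord0 i)) (fun i => mF _).
rewrite (_ : (fun x => _) = (fun x => 1 * F ord0 x + 1 * \sum_(i < n) F (lift ord0 i) x)); last first.
  by apply/funext => x; rewrite big_ord_recl !mul1r.
split; first exact: integrable01_lin.
by rewrite int01_lin// h2 big_ord_recl !mul1r.
Qed.

Lemma cosBD (u y : R) : cos (u - y) + cos (u + y) = 2 * (cos u * cos y).
Proof. by rewrite cosB cosD; ring. Qed.

Lemma cosBB (u y : R) : cos (u - y) - cos (u + y) = 2 * (sin u * sin y).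
Proof. by rewrite cosB cosD; ring. Qed.

Lemma sin_sin_sin2 (a b y : R) : sin a * sin b * sin y ^+ 2 =
  4^-1 * (cos (a - b) - cos (a + b))
  - 8^-1 * ((cos (a - b - 2 * y) + cos (a - b + 2 * y))
          - (cos (a + b - 2 * y) + cos (a + b + 2 * y))).
Proof.
rewrite !cosBD cosBB.
have -> : cos (2 * y) = 1 - 2 * sin y ^+ 2.
  have -> : 2 * y = y + y by ring.
  by rewrite cosD -!expr2 cos2sin2; ring.
rewrite -mulrBr -mulrBl cosBB.
by field.
Qed.

(* Frequencies are spaced by 3 so that multiplying by [sin (pi x)], which shifts a
   frequency by 1, keeps the modes orthogonal. *)
Definition freq (i : nat) : nat := (3 * i.+1)%N.

(** The product is a combination of cosines of frequencies $a\pm b$ and $a\pm b\pm2$. For positive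
    multiples $a,b$ of $3$ only $a-b$ can vanish, and the other cosines have integral zero. *)
Lemma int01_modes (i k : nat) :
  int01 (fun x => smode (freq i) x * smode (freq k) x * sin (pi * x) ^+ 2) = 4^-1 * (i == k)%:R.
Proof.
pose C (m : int) x : R := cos (m%:~R * pi * x).
have mC m : integrable01 (C m) by apply: integrable01_continuous; exact: continuous_cosw.
pose a : int := freq i; pose b : int := freq k.
rewrite (@eq_int01 _ _ (fun x => 1 * (4^-1 * C (a - b) x + (- 4^-1) * C (a + b) x)
   + 1 * (1 * (- 8^-1 * C (a - b - 2) x + (- 8^-1) * C (a - b + 2) x)
        + 1 * (8^-1 * C (a + b - 2) x + 8^-1 * C (a + b + 2) x)))); last first.
  move=> x _; rewrite sin_sin_sin2 /C.
  rewrite !(rmorphB, rmorphD) /= -!pmulrn /smode.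
  rewrite (_ : (freq i)%:R * pi * x - (freq k)%:R * pi * x - 2 * (pi * x) =
    ((freq i)%:R - (freq k)%:R - 2) * pi * x); last by ring.
  rewrite (_ : (freq i)%:R * pi * x - (freq k)%:R * pi * x + 2 * (pi * x) =
    ((freq i)%:R - (freq k)%:R + 2) * pi * x); last by ring.
  rewrite (_ : (freq i)%:R * pi * x + (freq k)%:R * pi * x - 2 * (pi * x) =
    ((freq i)%:R + (freq k)%:R - 2) * pi * x); last by ring.
  rewrite (_ : (freq i)%:R * pi * x + (freq k)%:R * pi * x + 2 * (pi * x) =
    ((freq i)%:R + (freq k)%:R + 2) * pi * x); last by ring.
  rewrite (_ : (freq i)%:R * pi * x - (freq k)%:R * pi * x =
    ((freq i)%:R - (freq k)%:R) * pi * x); last by ring.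
  rewrite (_ : (freq i)%:R * pi * x + (freq k)%:R * pi * x =
    ((freq i)%:R + (freq k)%:R) * pi * x); last by ring.
  by ring.
have mL c1 c2 m1 m2 := integrable01_lin c1 c2 (mC m1) (mC m2).
rewrite int01_lin; [|exact: mL|by apply: integrable01_lin; exact: mL].
rewrite int01_lin// int01_lin; [|exact: mL|exact: mL].
rewrite !int01_lin// /C !int01_cos.
have -> : (a + b == 0) = false by apply/eqP; rewrite /a /b /freq; lia.
have -> : (a + b - 2 == 0) = false by apply/eqP; rewrite /a /b /freq; lia.
have -> : (a + b + 2 == 0) = false by apply/eqP; rewrite /a /b /freq; lia.
have -> : (a - b - 2 == 0) = false by apply/eqP; rewrite /a /b /freq; lia.
have -> : (a - b + 2 == 0) = false by apply/eqP; rewrite /a /b /freq; lia.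
have -> : (a - b == 0) = (i == k) by rewrite /a /b /freq; apply/eqP/eqP => ?; lia.
by rewrite /=; ring.
Qed.

(** The weight is $\sin^2$ and not the $\sin$ of the observation: it is smaller on $[0,1]$, which
    suits a lower bound, and it makes the integrands sums of cosines of integer frequencies, under
    which the modes are orthogonal. *)
Lemma int01_comb_modes (n : nat) (c : 'I_n -> R) :
  int01 (fun x => (\sum_(i < n) c i * smode (freq i) x) ^+ 2 * sin (pi * x) ^+ 2)
  = 4^-1 * \sum_(i < n) c i ^+ 2.
Proof.
pose F (i k : 'I_n) x := c i * c k * (smode (freq i) x * smode (freq k) x * sin (pi * x) ^+ 2).
have mF i k : integrable01 (F i k).
  apply: integrable01_continuous => x; apply: cvgM; first exact: cvg_cst.
  by apply: cvgM; apply: cvgM; exact: continuous_sinw.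
rewrite (@eq_int01 _ _ (fun x => \sum_(i < n) \sum_(k < n) F i k x)); last first.
  move=> x _; rewrite (expr2 (\sum_(i < n) _)) -mulrA mulr_suml; apply: eq_bigr => i _.
  by rewrite mulr_suml mulr_sumr; apply: eq_bigr => k _; rewrite /F; ring.
have [_ ->] := @integrable01_sum n (fun i x => \sum_(k < n) F i k x)
  (fun i => (@integrable01_sum n (F i) (mF i)).1).
rewrite mulr_sumr; apply: eq_bigr => i _.
have [_ ->] := @integrable01_sum n (F i) (mF i).
rewrite (bigD1 i)//= big1 ?addr0.
  rewrite /F int01_scale ?int01_modes ?eqxx; first by rewrite mulr1; ring.
  by apply: integrable01_continuous => x; apply: cvgM; apply: cvgM; exact: continuous_sinw.
move=> k ki; rewrite /F int01_scale ?int01_modes.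
  by rewrite (_ : (i == k :> nat) = false) ?mulr0// eq_sym; exact: negbTE.
by apply: integrable01_continuous => x; apply: cvgM; apply: cvgM; exact: continuous_sinw.
Qed.

End HeatModes.

(** * Linearity and bounds of the observation *)

Section Observation.
Variable R : realType.
Implicit Types (d e g f : R -> R -> R) (t a b : R).

Lemma heat_solution_sub d e f g : heat_solution d f -> heat_solution e g ->
  heat_solution (fun x t => d x t - e x t) (fun x t => f x t - g x t).
Proof.
move=> hd he; have := heat_solution_lin 1 (-1) hd he.
rewrite (_ : (fun x t => _ * d x t + _) = (fun x t => d x t - e x t)); last first.
  by apply/funext => x; apply/funext => t; rewrite mul1r mulN1r.
rewrite (_ : (fun x t => _ * f x t + _) = (fun x t => f x t - g x t))//.
by apply/funext => x; apply/funext => t; rewrite mul1r mulN1r.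
Qed.

Lemma heat_solution_comb3 a b d1 d2 d3 f1 f2 f3 :
  heat_solution d1 f1 -> heat_solution d2 f2 -> heat_solution d3 f3 ->
  heat_solution (fun x t => d1 x t - a * d2 x t - b * d3 x t)
                (fun x t => f1 x t - a * f2 x t - b * f3 x t).
Proof.
move=> h1 h2 h3; have := heat_solution_sub h1 (heat_solution_lin a b h2 h3).
rewrite (_ : (fun x t => d1 x t - _) = (fun x t => d1 x t - a * d2 x t - b * d3 x t)); last first.
  by apply/funext => x; apply/funext => t; rewrite opprD addrA.
rewrite (_ : (fun x t => f1 x t - _) = (fun x t => f1 x t - a * f2 x t - b * f3 x t))//.
by apply/funext => x; apply/funext => t; rewrite opprD addrA.
Qed.

Definition obs t d : R := Hobs (fun x => d x t).

Let obs_integrable t d f : 0 <= t -> heat_solution d f ->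
  integrable01 (fun x => d x t * sin (pi * x)).
Proof.
move=> t0 hd; apply: integrable01_mul_cont; last exact: continuous_sinw.
exact/integrable01_cont/(heat_solution_cont_x hd t0).
Qed.

Lemma obs_lin t a b d e f g : 0 <= t -> heat_solution d f -> heat_solution e g ->
  obs t (fun x t => a * d x t + b * e x t) = a * obs t d + b * obs t e.
Proof.
move=> t0 hd he; rewrite /obs /Hobs -/(int01 _) -/(int01 _) -/(int01 _).
rewrite -int01_lin; [|exact: obs_integrable hd|exact: obs_integrable he].
by apply: eq_int01 => x _; ring.
Qed.

Lemma obs_sub t d e f g : 0 <= t -> heat_solution d f -> heat_solution e g ->
  obs t (fun x t => d x t - e x t) = obs t d - obs t e.
Proof.
move=> t0 hd he; have := obs_lin 1 (-1) t0 hd he; rewrite mul1r mulN1r => <-.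
by congr obs; apply/funext => x; apply/funext => s; rewrite mul1r mulN1r.
Qed.

Lemma obs_comb3 t a b d1 d2 d3 f1 f2 f3 : 0 <= t ->
  heat_solution d1 f1 -> heat_solution d2 f2 -> heat_solution d3 f3 ->
  obs t (fun x t => d1 x t - a * d2 x t - b * d3 x t) = obs t d1 - a * obs t d2 - b * obs t d3.
Proof.
move=> t0 h1 h2 h3.
have := obs_sub t0 h1 (heat_solution_lin a b h2 h3).
rewrite (obs_lin _ _ t0 h2 h3) opprD addrA => <-.
by congr obs; apply/funext => x; apply/funext => s; rewrite opprD addrA.
Qed.

Lemma obs_norm_le t d f (B : R) : 0 <= t -> heat_solution d f ->
  (forall x : R, 0 <= x <= 1 -> `|d x t| <= B) -> `|obs t d| <= B.
Proof.
move=> t0 hd dB; rewrite /obs /Hobs -/(int01 _).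
apply: int01_norm_le; first exact: obs_integrable hd.
move=> x x01; rewrite normrM; apply: le_trans (dB x x01).
by rewrite ler_piMr// ler_norml sin_geN1 sin_le1.
Qed.

End Observation.

(** The factor $e^{(M+1)T}$ of the maximum principle for $M=1$, a Lipschitz constant of $r$ near
    $0$. *)
Definition growth_factor (R : realType) (T : R) : R := expR ((1 + 1) * T).

(** * Supremum estimates for first and second differences of solutions *)

Section SolutionEstimates.
Variable R : realType.
Variable r : R -> R.
Hypothesis r0 : r 0 = 0.
Variable c : R.
Variable S : (R -> R) -> R -> R -> R.
Hypothesis hS : forall u, Vset u -> is_solution r u (S u).
Variable T : R.
Hypothesis T0 : 0 <= T.
Local Notation E := (growth_factor T).
Implicit Types (u v h k : R -> R) (D a b w x t : R).

Definition sup_le u D := forall x : R, 0 <= x <= 1 -> `|u x| <= D.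

Let E1 : 1 <= E.
Proof. by rewrite -expR0 /growth_factor ler_expR mulr_ge0. Qed.

Let E0 : 0 < E. Proof. exact: expR_gt0. Qed.

Lemma max_principle_norm (d f : R -> R -> R) (D K rho : R) : heat_solution d f ->
  0 <= D -> 0 <= K -> sup_le (d ^~ 0) D ->
  (forall x t : R, 0 < x < 1 -> 0 < t <= T -> `|d x t| <= rho -> `|f x t| <= `|d x t| + K) ->
  (D + K) * E < rho ->
  forall x t : R, 0 <= x <= 1 -> 0 <= t <= T -> `|d x t| <= (D + K) * E.
Proof.
move=> hd D0 K0 dD fK DKr x t x01 t0T; rewrite ler_norml; apply/andP; split.
  rewrite lerNl -mulN1r.
  have hN := heat_solution_lin (-1) 0 hd hd.
  have -> : -1 * d x t = -1 * d x t + 0 * d x t by rewrite mul0r addr0.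
  apply: (max_principle hN D0 K0 ler01 _ _ DKr) => // {x t x01 t0T}.
    by move=> x x01; rewrite mul0r addr0 mulN1r; have := dD x x01; rewrite ler_norml; lra.
  move=> x t x01 t0T; rewrite !mul0r !addr0 !mulN1r mul1r => /andP[dn dr].
  have := fK x t x01 t0T; rewrite -normrN gtr0_norm// => /(_ dr).
  by rewrite ler_norml; lra.
apply: (max_principle hd D0 K0 ler01 _ _ DKr) => // {x t x01 t0T}.
  by move=> x x01; have := dD x x01; rewrite ler_norml; lra.
move=> x t x01 t0T; rewrite mul1r => /andP[dn dr].
have := fK x t x01 t0T; rewrite gtr0_norm// => /(_ dr).
by rewrite ler_norml; lra.
Qed.

Lemma max_principle_global (d f : R -> R -> R) (D K : R) : heat_solution d f ->
  0 <= D -> 0 <= K -> sup_le (d ^~ 0) D ->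
  (forall x t : R, 0 < x < 1 -> 0 < t <= T -> `|f x t| <= `|d x t| + K) ->
  forall x t : R, 0 <= x <= 1 -> 0 <= t <= T -> `|d x t| <= (D + K) * E.
Proof.
(* Any range above the claimed bound will do, since the source estimate is global here. *)
move=> hd D0 K0 dD fK; apply: (@max_principle_norm d f D K ((D + K) * E + 1)) => //.
  by move=> x t x01 t0T _; exact: fK.
by rewrite ltrDl.
Qed.

Lemma sol_heat u : Vset u -> heat_solution (S u) (fun x t => r (S u x t)).
Proof. by move=> Vu; exact: is_solution_heat (hS Vu). Qed.

Lemma sol_init u x : Vset u -> 0 <= x <= 1 -> S u x 0 = u x.
Proof. by move=> /hS[_ [_ [_]]]; exact. Qed.

Let itvW x : 0 < x < 1 -> 0 <= x <= 1.
Proof. by move=> /andP[x0 x1]; rewrite !ltW. Qed.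
Let itvW' t : 0 < t <= T -> 0 <= t <= T.
Proof. by move=> /andP[x0 x1]; rewrite ltW. Qed.

Section Ball.
Variables (del w : R).
Hypothesis del0 : 0 < del.
Hypotheses (w0 : 0 < w) (w1 : w <= 1).
Hypothesis r_lip : forall p q, `|p| <= del -> `|q| <= del -> `|r p - r q| <= w * `|p - q|.
Hypothesis r_mix : forall p q, `|p| <= del -> `|q| <= del ->
  `|r (p + q) - r p - r q - c * p * q| <= w * `|p| * `|q|.

Let r_le p : `|p| <= del -> `|r p| <= w * `|p|.
Proof. by move=> pd; have := @r_lip p 0 pd; rewrite normr0 r0 !subr0; apply; exact: ltW. Qed.

Let w_le1 x : 0 <= x -> w * x <= x.
Proof. by move=> x0; rewrite ler_piMl. Qed.

Lemma sol_bound u D x t : Vset u -> 0 <= D -> sup_le u D -> D * E < del ->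
  0 <= x <= 1 -> 0 <= t <= T -> `|S u x t| <= D * E.
Proof.
move=> Vu D0 uD DE x01 t0T; rewrite -[X in X * E]addr0.
apply: (max_principle_norm (rho := del) (sol_heat Vu)) => //.
- by move=> z z01; rewrite sol_init//; exact: uD.
- by move=> z s z01 s0T /r_le; rewrite addr0 => /le_trans; apply; exact: w_le1.
- by rewrite addr0.
Qed.

Lemma sol_lip u v D D1 x t : Vset u -> Vset v -> 0 <= D -> 0 <= D1 ->
  sup_le u D1 -> sup_le v D1 -> D1 * E < del -> sup_le (fun x => u x - v x) D ->
  0 <= x <= 1 -> 0 <= t <= T -> `|S u x t - S v x t| <= D * E.
Proof.
move=> Vu Vv D0 D10 uD vD DE uvD x01 t0T; rewrite -[X in X * E]addr0.
apply: (max_principle_global (heat_solution_sub (sol_heat Vu) (sol_heat Vv))) => //.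
- by move=> z z01; rewrite !sol_init//; exact: uvD.
- move=> z s z01 s0T; rewrite addr0; apply: le_trans (r_lip _ _) _; last exact: w_le1.
  + by apply: le_trans (ltW DE); apply: sol_bound => //; [exact: itvW|exact: itvW'].
  + by apply: le_trans (ltW DE); apply: sol_bound => //; [exact: itvW|exact: itvW'].
Qed.

(** The difference starts at $0$ and is driven by [r (S u)] alone, which is at most [w] times the
    solution. *)
Lemma sol_linear_approx u (v : R -> R -> R) D x t : Vset u -> 0 <= D -> sup_le u D -> D * E < del ->
  heat_solution v (fun _ _ => 0) -> (forall x : R, 0 <= x <= 1 -> v x 0 = u x) ->
  0 <= x <= 1 -> 0 <= t <= T -> `|S u x t - v x t| <= w * E ^+ 2 * D.
Proof.
move=> Vu D0 uD DE hv v0 x01 t0T.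
have K0 : 0 <= w * (D * E) by rewrite !mulr_ge0// ltW.
rewrite (_ : w * E ^+ 2 * D = (0 + w * (D * E)) * E); last by ring.
apply: (max_principle_global (heat_solution_sub (sol_heat Vu) hv)) => //.
- by move=> z z01; rewrite sol_init// v0// subrr normr0.
- move=> z s z01 s0T; rewrite subr0.
  have b : `|S u z s| <= D * E by apply: sol_bound => //; [exact: itvW|exact: itvW'].
  apply: le_trans (r_le (le_trans b (ltW DE))) _.
  by apply: le_trans (_ : w * (D * E) <= _); [rewrite ler_pM2l|rewrite lerDr].
Qed.

(** The second difference $Y$ starts at $0$, and its source $r(y)-r(p)-r(q)$ is $c\,pq$ up to
    $w|Y|+w|p||q|$ (with a-priori bounds for $p,q$). The maximum principle first gives
    $Y=O(D_hD_k)$; inserted back, this makes the distance from the source to $c\,pq$ small by the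
    factor $w$. *)
Lemma sol_mixed_bound h k Dh Dk x t : Vset h -> Vset k -> 0 <= Dh -> 0 <= Dk ->
  sup_le h Dh -> sup_le k Dk -> (Dh + Dk) * E < del ->
  0 <= x <= 1 -> 0 <= t <= T ->
  `|S (fun x => h x + k x) x t - S h x t - S k x t| <= (`|c| + 1) * E ^+ 3 * Dh * Dk /\
  `|r (S (fun x => h x + k x) x t) - r (S h x t) - r (S k x t) - c * S h x t * S k x t|
    <= w * ((`|c| + 1) * E ^+ 3 + E ^+ 2) * Dh * Dk.
Proof.
move=> Vh Vk Dh0 Dk0 hD kD DE x01 t0T.
have Vhk : Vset (fun x => h x + k x).
  have := Vset_lin 1 1 Vh Vk; rewrite (_ : (fun x => _) = (fun x => h x + k x))//.
  by apply/funext => z; rewrite !mul1r.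
have DhE : Dh * E < del by apply: le_lt_trans DE; rewrite ler_pM2r// lerDl.
have DkE : Dk * E < del by apply: le_lt_trans DE; rewrite ler_pM2r// lerDr.
have hkD : sup_le (fun x => h x + k x) (Dh + Dk).
  by move=> z z01; apply: le_trans (ler_normD _ _) _; apply: lerD; [exact: hD|exact: kD].
have bh z s : 0 <= z <= 1 -> 0 <= s <= T -> `|S h z s| <= Dh * E by exact: sol_bound.
have bk z s : 0 <= z <= 1 -> 0 <= s <= T -> `|S k z s| <= Dk * E by exact: sol_bound.
have bhk z s : 0 <= z <= 1 -> 0 <= s <= T -> `|S (fun x => h x + k x) z s| <= (Dh + Dk) * E.
  by apply: sol_bound => //; exact: addr_ge0.
have key z s : 0 <= z <= 1 -> 0 <= s <= T ->
  `|r (S (fun x => h x + k x) z s) - r (S h z s) - r (S k z s) - c * S h z s * S k z s|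
  <= w * `|S (fun x => h x + k x) z s - S h z s - S k z s| + w * (Dh * E * (Dk * E)).
  move=> z01 s0T; have := bh z s z01 s0T; have := bk z s z01 s0T; have := bhk z s z01 s0T.
  move: (S (fun x => _) z s) (S h z s) (S k z s) => y p q yb qb pb.
  have pq : `|p + q| <= del.
    by apply: le_trans (ler_normD _ _) _; rewrite (le_trans (lerD pb qb))// -mulrDl ltW.
  have h1 := r_lip (le_trans yb (ltW DE)) pq.
  have h2 := r_mix (le_trans pb (ltW DhE)) (le_trans qb (ltW DkE)).
  have -> : r y - r p - r q - c * p * q = (r y - r (p + q)) + (r (p + q) - r p - r q - c * p * q).
    by ring.
  apply: le_trans (ler_normD _ _) _; apply: lerD; first by rewrite -addrA -opprD.
  apply: le_trans h2 _; rewrite -mulrA ler_pM2l//.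
  exact: ler_pM.
have Yb z s : 0 <= z <= 1 -> 0 <= s <= T ->
  `|S (fun x => h x + k x) z s - S h z s - S k z s| <= (`|c| + 1) * E ^+ 3 * Dh * Dk.
  move=> z01 s0T.
  have K0 : 0 <= (`|c| + 1) * (Dh * E * (Dk * E)) by rewrite !mulr_ge0// ?addr_ge0// ltW.
  rewrite (_ : _ * E ^+ 3 * _ * _ = (0 + (`|c| + 1) * (Dh * E * (Dk * E))) * E); last by ring.
  have hY := heat_solution_sub (heat_solution_sub (sol_heat Vhk) (sol_heat Vh)) (sol_heat Vk).
  apply: (max_principle_global hY) => //.
    by move=> y y01; rewrite !sol_init// normr_le0; apply/eqP; ring.
  move=> y tau /itvW y01 /itvW' tau0T; have := key y tau y01 tau0T.
  have := bh y tau y01 tau0T; have := bk y tau y01 tau0T.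
  move: (S (fun x => _) y tau) (S h y tau) (S k y tau) => Y p q qb pb.
  set X := Y - p - q => kk.
  have h1 : `|c * p * q| <= `|c| * (Dh * E * (Dk * E)).
    by rewrite -mulrA normrM ler_wpM2l// normrM ler_pM.
  have h2 := w_le1 (normr_ge0 X).
  have h3 : w * (Dh * E * (Dk * E)) <= Dh * E * (Dk * E).
    by apply: w_le1; rewrite !mulr_ge0// ltW.
  rewrite -[r Y - _ - _](subrK (c * p * q)); apply: le_trans (ler_normD _ _) _.
  by rewrite mulrDl mul1r; lra.
split; first exact: Yb.
apply: le_trans (key _ _ x01 t0T) _.
rewrite (_ : w * (_ + _) * _ * _ =
   w * ((`|c| + 1) * E ^+ 3 * Dh * Dk) + w * (Dh * E * (Dk * E))); last by ring.
by rewrite lerD2r ler_pM2l// Yb.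
Qed.

Lemma sol_almost_linear a b h k Dh Dk x t : Vset h -> Vset k -> 0 <= Dh -> 0 <= Dk ->
  sup_le h Dh -> sup_le k Dk -> `|a| <= 1 -> `|b| <= 1 -> (Dh + Dk) * E < del ->
  0 <= x <= 1 -> 0 <= t <= T ->
  `|S (fun x => a * h x + b * k x) x t - a * S h x t - b * S k x t|
    <= 2 * w * E ^+ 2 * (`|a| * Dh + `|b| * Dk).
Proof.
move=> Vh Vk Dh0 Dk0 hD kD a1 b1 DE x01 t0T.
have Vab := Vset_lin a b Vh Vk.
have DhE : Dh * E < del by apply: le_lt_trans DE; rewrite ler_pM2r// lerDl.
have DkE : Dk * E < del by apply: le_lt_trans DE; rewrite ler_pM2r// lerDr.
set Dab := `|a| * Dh + `|b| * Dk.
have Dab0 : 0 <= Dab by rewrite addr_ge0// mulr_ge0.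
have DabE : Dab * E < del.
  by apply: le_lt_trans DE; rewrite ler_pM2r// lerD// ler_piMl.
have abD : sup_le (fun x => a * h x + b * k x) Dab.
  move=> z z01; apply: le_trans (ler_normD _ _) _; rewrite !normrM.
  by apply: lerD; rewrite ler_wpM2l//; [exact: hD|exact: kD].
have K0 : 0 <= 2 * w * E * Dab by rewrite !mulr_ge0// ltW.
rewrite (_ : 2 * w * E ^+ 2 * Dab = (0 + 2 * w * E * Dab) * E); last by ring.
apply: (max_principle_global
  (heat_solution_comb3 a b (sol_heat Vab) (sol_heat Vh) (sol_heat Vk))) => //.
  by move=> y y01; rewrite !sol_init// normr_le0; apply/eqP; ring.
move=> y tau /itvW y01 /itvW' tau0T.
have bh : `|S h y tau| <= Dh * E by exact: sol_bound.
have bk : `|S k y tau| <= Dk * E by exact: sol_bound.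
have bab : `|S (fun x => a * h x + b * k x) y tau| <= Dab * E by exact: sol_bound.
move: bh bk bab; set Y := S (fun x => a * h x + b * k x) y tau; set p := S h y tau.
set q := S k y tau => bh bk bab.
have h1 := r_le (le_trans bab (ltW DabE)).
have h2 := r_le (le_trans bh (ltW DhE)).
have h3 := r_le (le_trans bk (ltW DkE)).
apply: le_trans (_ : 2 * w * E * Dab <= _); last by rewrite lerDr.
have -> : r Y - a * r p - b * r q = r Y + (- a * r p + - b * r q) by ring.
apply: le_trans (ler_normD _ _) _; have := ler_normD (- a * r p) (- b * r q).
rewrite !normrM !normrN.
have h1' : `|r Y| <= w * (Dab * E) by apply: le_trans h1 _; rewrite ler_pM2l.
have h2' : `|a| * `|r p| <= `|a| * (w * (Dh * E)).
  by rewrite ler_wpM2l//; apply: le_trans h2 _; rewrite ler_pM2l.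
have h3' : `|b| * `|r q| <= `|b| * (w * (Dk * E)).
  by rewrite ler_wpM2l//; apply: le_trans h3 _; rewrite ler_pM2l.
have -> : 2 * w * E * Dab = w * (Dab * E) + (`|a| * (w * (Dh * E)) + `|b| * (w * (Dk * E))).
  by rewrite /Dab; ring.
by lra.
Qed.

(** Combining the sources leaves $c\,Z\,L$, where $Z$ is the defect estimated in [sol_almost_linear]
    and $L$ the solution starting from [l], plus three remainders from [sol_mixed_bound]. Each of
    these carries the factor [w]. *)
Lemma sol_mixed_almost_linear a b h k l Dh Dk Dl x t : Vset h -> Vset k -> Vset l ->
  0 <= Dh -> 0 <= Dk -> 0 <= Dl -> sup_le h Dh -> sup_le k Dk -> sup_le l Dl ->
  `|a| <= 1 -> `|b| <= 1 -> (Dh + Dk + Dl) * E < del -> 0 <= x <= 1 -> 0 <= t <= T ->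
  `|(S (fun x => (a * h x + b * k x) + l x) x t - S (fun x => a * h x + b * k x) x t - S l x t)
    - a * (S (fun x => h x + l x) x t - S h x t - S l x t)
    - b * (S (fun x => k x + l x) x t - S k x t - S l x t)|
    <= w * ((2 * ((`|c| + 1) * E ^+ 3 + E ^+ 2) + 2 * `|c| * E ^+ 3) * E) *
        (`|a| * Dh + `|b| * Dk) * Dl.
Proof.
move=> Vh Vk Vl Dh0 Dk0 Dl0 hD kD lD a1 b1 DE x01 t0T.
have Vab := Vset_lin a b Vh Vk.
have VD f g : Vset f -> Vset g -> Vset (fun x => f x + g x).
  move=> Vf Vg; have := Vset_lin 1 1 Vf Vg.
  by rewrite (_ : (fun x => _) = (fun x => f x + g x))//; apply/funext => z; rewrite !mul1r.
set Dab := `|a| * Dh + `|b| * Dk.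
have Dab0 : 0 <= Dab by rewrite addr_ge0// mulr_ge0.
have Dabhk : Dab <= Dh + Dk by rewrite lerD// ler_piMl.
have abD : sup_le (fun x => a * h x + b * k x) Dab.
  move=> z z01; apply: le_trans (ler_normD _ _) _; rewrite !normrM.
  by apply: lerD; rewrite ler_wpM2l//; [exact: hD|exact: kD].
have DE' D : D <= Dh + Dk + Dl -> D * E < del.
  by move=> DD; apply: le_lt_trans DE; rewrite ler_pM2r.
set M := (`|c| + 1) * E ^+ 3 + E ^+ 2.
have M0 : 0 <= M by rewrite addr_ge0 ?mulr_ge0 ?addr_ge0 ?exprn_ge0// ltW.
have K0 : 0 <= w * (2 * M + 2 * `|c| * E ^+ 3) * Dab * Dl.
  by rewrite !mulr_ge0 ?addr_ge0 ?mulr_ge0 ?exprn_ge0// ltW.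
rewrite (_ : w * _ * _ * _ = (0 + w * (2 * M + 2 * `|c| * E ^+ 3) * Dab * Dl) * E); last by ring.
have hY f (Vf : Vset f) :=
  heat_solution_sub (heat_solution_sub (sol_heat (VD f l Vf Vl)) (sol_heat Vf)) (sol_heat Vl).
apply: (max_principle_global (heat_solution_comb3 a b (hY _ Vab) (hY _ Vh) (hY _ Vk))) => //.
  move=> y y01; have ? := VD _ _ Vab Vl; have ? := VD _ _ Vh Vl; have ? := VD _ _ Vk Vl.
  by rewrite !sol_init// normr_le0; apply/eqP; ring.
move=> y tau /itvW y01 /itvW' tau0T.
have e1 : (Dab + Dl) * E < del by apply: DE'; lra.
have e2 : (Dh + Dl) * E < del by apply: DE'; lra.
have e3 : (Dk + Dl) * E < del by apply: DE'; lra.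
have e4 : (Dh + Dk) * E < del by apply: DE'; lra.
have [_ m1] := sol_mixed_bound Vab Vl Dab0 Dl0 abD lD e1 y01 tau0T.
have [_ m2] := sol_mixed_bound Vh Vl Dh0 Dl0 hD lD e2 y01 tau0T.
have [_ m3] := sol_mixed_bound Vk Vl Dk0 Dl0 kD lD e3 y01 tau0T.
have m4 := sol_almost_linear Vh Vk Dh0 Dk0 hD kD a1 b1 e4 y01 tau0T.
have m5 : `|S l y tau| <= Dl * E by apply: sol_bound => //; apply: DE'; lra.
apply: le_trans (_ : w * (2 * M + 2 * `|c| * E ^+ 3) * Dab * Dl <= _); last by rewrite lerDr.
move: m1 m2 m3 m4 m5; rewrite -/M -/Dab.
set X1 := r _ - _ - _ - _; set X2 := r _ - _ - _ - _; set X3 := r _ - _ - _ - _.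
set Z := S _ y tau - _ - _; set L := S l y tau => m1 m2 m3 m4 m5.
rewrite [X in `|X| <= _](_ : _ = X1 - a * X2 - b * X3 + c * Z * L); last first.
  by rewrite /X1 /X2 /X3 /Z /L; ring.
have n1 : `|a * X2| <= `|a| * (w * M * Dh * Dl) by rewrite normrM ler_wpM2l.
have n2 : `|b * X3| <= `|b| * (w * M * Dk * Dl) by rewrite normrM ler_wpM2l.
have n3 : `|c * Z * L| <= `|c| * ((2 * w * E ^+ 2 * Dab) * (Dl * E)).
  by rewrite -mulrA normrM ler_wpM2l// normrM ler_pM.
have -> : w * (2 * M + 2 * `|c| * E ^+ 3) * Dab * Dl =
  w * M * Dab * Dl + `|a| * (w * M * Dh * Dl) + `|b| * (w * M * Dk * Dl)
  + `|c| * ((2 * w * E ^+ 2 * Dab) * (Dl * E)) by rewrite /Dab; ring.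
apply: le_trans (ler_normD _ _) _; apply: lerD => //.
apply: le_trans (ler_normB _ _) _; apply: lerD => //.
by apply: le_trans (ler_normB _ _) _; apply: lerD.
Qed.

(* Comparison with the subsolution [c t v^2] of the equation satisfied by the second
   difference of the solution. *)
Lemma sol_mixed_lower h (v : R -> R -> R) D x t : Vset h -> 0 <= D -> sup_le h D ->
  (D + D) * E < del -> heat_solution v (fun _ _ => 0) ->
  (forall x : R, 0 <= x <= 1 -> v x 0 = h x) -> 0 <= x <= 1 -> 0 <= t <= T ->
  c ^+ 2 * (t * v x t ^+ 2)
    - w * ((`|c| * ((`|c| + 1) * E ^+ 3 + E ^+ 2) + c ^+ 2 * (3 * E ^+ 4)) * E) * D ^+ 2
  <= c * (S (fun x => h x + h x) x t - S h x t - S h x t).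
Proof.
move=> Vh D0 hD DE hv v0 x01 t0T.
have Vhh : Vset (fun x => h x + h x).
  have := Vset_lin 1 1 Vh Vh; rewrite (_ : (fun x => _) = (fun x => h x + h x))//.
  by apply/funext => z; rewrite !mul1r.
have DE1 : D * E < del by apply: le_lt_trans DE; rewrite ler_pM2r// lerDl.
set M := (`|c| + 1) * E ^+ 3 + E ^+ 2.
set K := w * (`|c| * M + c ^+ 2 * (3 * E ^+ 4)) * D ^+ 2.
have M0 : 0 <= M by rewrite addr_ge0 ?mulr_ge0 ?addr_ge0 ?exprn_ge0// ltW.
have K0 : 0 <= K.
  rewrite /K; apply: mulr_ge0; last exact: sqr_ge0.
  apply: mulr_ge0; [exact: ltW|apply: addr_ge0; first exact: mulr_ge0].
  by apply: mulr_ge0; [exact: sqr_ge0|apply: mulr_ge0 => //; exact/exprn_ge0/ltW].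
have hY := heat_solution_sub (heat_solution_sub (sol_heat Vhh) (sol_heat Vh)) (sol_heat Vh).
have hd := heat_solution_lin (c ^+ 2) (- c) (heat_solution_tsq hv) hY.
rewrite lerBlDr -lerBlDl -mulNr.
rewrite (_ : w * _ * D ^+ 2 = (0 + K) * E); last by rewrite /K; ring.
apply: (max_principle (rho := (0 + K) * E + 1) hd _ K0 ler01) => //.
- move=> y y01; rewrite mul0r mulr0 add0r !sol_init//.
  by rewrite addrK subrr mulr0.
- move=> y tau /itvW y01 /[dup] /andP[tau0 _] /itvW' tau0T /andP[d0 _].
  have [_ m1] := sol_mixed_bound Vh Vh D0 D0 hD hD DE y01 tau0T.
  have m2 := sol_linear_approx Vh D0 hD DE1 hv v0 y01 tau0T.
  have m3 : `|S h y tau| <= D * E by exact: sol_bound.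
  apply: le_trans (_ : K <= _); last by rewrite mul1r lerDr ltW.
  move: m1 m2 m3; rewrite -/M; set X := r _ - _ - _ - _; set p := S h y tau; set q := v y tau.
  set dx := derive1 _ y => m1 m2 m3.
  (* The source is $c^2(q^2-2\tau q_x^2)-c(cp^2+X)$. Its term in $q_x$ has a sign but no bound,
     which is why the one-sided maximum principle is used; the other terms carry [w]. *)
  rewrite (_ : c ^+ 2 * _ + _ = - (2 * c ^+ 2 * tau * dx ^+ 2) - c * X - c ^+ 2 * ((p - q) * (p + q))); last first.
    by rewrite /X -/p; ring.
  have n0 : 0 <= 2 * c ^+ 2 * tau * dx ^+ 2.
    apply: mulr_ge0; [apply: mulr_ge0; last exact: ltW|exact: sqr_ge0].
    by apply: mulr_ge0 => //; exact: sqr_ge0.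
  have n1 : - (c * X) <= `|c| * (w * M * D * D).
    by apply: le_trans (ler_norm _) _; rewrite normrN normrM ler_wpM2l.
  have n2 : - (c ^+ 2 * ((p - q) * (p + q))) <= c ^+ 2 * ((w * E ^+ 2 * D) * (3 * E ^+ 2 * D)).
    apply: le_trans (ler_norm _) _; rewrite normrN normrM (ger0_norm (sqr_ge0 c)).
    rewrite ler_wpM2l ?sqr_ge0// normrM ler_pM//.
    have -> : p + q = (p + p) - (p - q) by ring.
    apply: le_trans (ler_normB _ _) _; have := ler_normD p p.
    have e1 : D * E <= E ^+ 2 * D by rewrite mulrC ler_wpM2r// expr2 ler_peMr// ltW.
    have e2 : w * E ^+ 2 * D <= E ^+ 2 * D.
      by rewrite -mulrA; apply: w_le1; rewrite mulr_ge0// exprn_ge0// ltW.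
    by lra.
  have -> : K = `|c| * (w * M * D * D) + c ^+ 2 * ((w * E ^+ 2 * D) * (3 * E ^+ 2 * D)).
    by rewrite /K; ring.
  by lra.
- by rewrite ltrDl.
Qed.

End Ball.
(** Around a nonzero solution the linear coefficient $l=r'(S v)$ need not vanish, but $|l|\le1$, so
    $l$ times the defect is absorbed by the maximum principle. The rest of the source consists of
    Taylor remainders, quadratic in the increments. *)
Lemma sol_quad (M del : R) v a b h k Dv Dh Dk x t : 0 < del -> 0 <= M ->
  (forall p q, `|p| <= del -> `|q| <= del -> `|r p - r q| <= 1 * `|p - q|) ->
  (forall p q, `|p| <= del -> `|p + q| <= del ->
    `|derive1 r p| <= 1 /\ `|r (p + q) - r p - derive1 r p * q| <= M * q ^+ 2) ->
  Vset v -> Vset h -> Vset k -> 0 <= Dv -> 0 <= Dh -> 0 <= Dk ->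
  sup_le v Dv -> sup_le h Dh -> sup_le k Dk -> `|a| <= 1 -> `|b| <= 1 ->
  (Dv + Dh + Dk) * E < del -> 0 <= x <= 1 -> 0 <= t <= T ->
  `|(S (fun x => v x + (a * h x + b * k x)) x t - S v x t)
     - a * (S (fun x => v x + h x) x t - S v x t)
     - b * (S (fun x => v x + k x) x t - S v x t)|
  <= 2 * M * E ^+ 3 * (`|a| * Dh + `|b| * Dk) * (Dh + Dk).
Proof.
move=> del0 M0 r_lip tay Vv Vh Vk Dv0 Dh0 Dk0 vD hD kD a1 b1 DE x01 t0T.
have VD f g : Vset f -> Vset g -> Vset (fun x => f x + g x).
  move=> Vf Vg; have := Vset_lin 1 1 Vf Vg.
  by rewrite (_ : (fun x => _) = (fun x => f x + g x))//; apply/funext => z; rewrite !mul1r.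
have Vab := Vset_lin a b Vh Vk.
set Dab := `|a| * Dh + `|b| * Dk.
have Dab0 : 0 <= Dab by rewrite addr_ge0// mulr_ge0.
have Dabhk : Dab <= Dh + Dk by rewrite lerD// ler_piMl.
have abD : sup_le (fun x => a * h x + b * k x) Dab.
  move=> z z01; apply: le_trans (ler_normD _ _) _; rewrite !normrM.
  by apply: lerD; rewrite ler_wpM2l//; [exact: hD|exact: kD].
have vfD f D : sup_le f D -> D <= Dh + Dk -> sup_le (fun x => v x + f x) (Dv + Dh + Dk).
  move=> fD DD z z01; apply: le_trans (ler_normD _ _) _.
  by have := vD z z01; have := fD z z01; lra.
have vD' : sup_le v (Dv + Dh + Dk) by move=> z /vD; lra.
have D'0 : 0 <= Dv + Dh + Dk by rewrite !addr_ge0.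
have lip f D y tau : Vset f -> 0 <= D -> sup_le f D -> D <= Dh + Dk -> 0 <= y <= 1 -> 0 <= tau <= T ->
   `|S (fun x => v x + f x) y tau| <= del /\ `|S (fun x => v x + f x) y tau - S v y tau| <= D * E.
  move=> Vf D0 fD DD y01 tau0T; split.
    apply: le_trans (ltW DE); apply: (sol_bound del0 (lexx 1) r_lip) => //; first exact: VD.
    exact: vfD fD DD.
  apply: (sol_lip del0 (lexx 1) r_lip _ _ _ D'0) => //; [exact: VD|exact: vfD fD DD|].
  by move=> z /fD; rewrite addrAC subrr add0r.
have K0 : 0 <= 2 * M * E ^+ 2 * Dab * (Dh + Dk).
  apply: mulr_ge0; [apply: mulr_ge0 => //|exact: addr_ge0].
  by apply: mulr_ge0; [exact: mulr_ge0|exact/exprn_ge0/ltW].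
rewrite (_ : _ * Dab * _ = (0 + 2 * M * E ^+ 2 * Dab * (Dh + Dk)) * E); last by ring.
have hY f (Vf : Vset f) := heat_solution_sub (sol_heat (VD v f Vv Vf)) (sol_heat Vv).
apply: (max_principle_global (heat_solution_comb3 a b (hY _ Vab) (hY _ Vh) (hY _ Vk))) => //.
  move=> y y01; have ? := VD _ _ Vv Vab; have ? := VD _ _ Vv Vh; have ? := VD _ _ Vv Vk.
  by rewrite !sol_init// normr_le0; apply/eqP; ring.
move=> y tau /itvW y01 /itvW' tau0T.
have pb : `|S v y tau| <= del.
  by apply: le_trans (ltW DE); apply: (sol_bound del0 (lexx 1) r_lip).
have [s1 s2] := lip _ _ y tau Vab Dab0 abD Dabhk y01 tau0T.
have le1 : Dh <= Dh + Dk by rewrite lerDl.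
have le2 : Dk <= Dh + Dk by rewrite lerDr.
have [q1 q2] := lip _ _ y tau Vh Dh0 hD le1 y01 tau0T.
have [p1 p2] := lip _ _ y tau Vk Dk0 kD le2 y01 tau0T.
move: pb s1 s2 q1 q2 p1 p2; set p := S v y tau.
set Y1 := S _ y tau; set Y2 := S _ y tau; set Y3 := S _ y tau => pb s1 s2 q1 q2 p1 p2.
have t1 := tay p (Y1 - p) pb; rewrite subrKC in t1; have {t1} [rp t1] := t1 s1.
have t2 := tay p (Y2 - p) pb; rewrite subrKC in t2; have {t2} [_ t2] := t2 q1.
have t3 := tay p (Y3 - p) pb; rewrite subrKC in t3; have {t3} [_ t3] := t3 p1.
move: rp t1 t2 t3; set l := derive1 r p => rp t1 t2 t3.
rewrite [X in `|X| <= _](_ : _ = l * (Y1 - p - a * (Y2 - p) - b * (Y3 - p))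
  + ((r Y1 - r p - l * (Y1 - p)) - a * (r Y2 - r p - l * (Y2 - p)) - b * (r Y3 - r p - l * (Y3 - p)))); last by ring.
apply: le_trans (ler_normD _ _) _; apply: lerD.
  by rewrite normrM ler_piMl.
have sq (z B : R) : `|z| <= B -> M * z ^+ 2 <= M * B ^+ 2.
  by move=> zB; rewrite ler_wpM2l// -(real_normK (num_real z)) ler_pXn2r// nnegrE// (le_trans _ zB).
have u1 := le_trans t1 (sq _ _ s2).
have u2 := le_trans t2 (sq _ _ q2).
have u3 := le_trans t3 (sq _ _ p2).
apply: le_trans (ler_normB _ _) _; rewrite normrM.
apply: le_trans (_ : (M * (Dab * E) ^+ 2 + `|a| * (M * (Dh * E) ^+ 2)) + `|b| * (M * (Dk * E) ^+ 2) <= _).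
  apply: lerD; last by rewrite ler_wpM2l.
  by apply: le_trans (ler_normB _ _) _; rewrite normrM; apply: lerD => //; rewrite ler_wpM2l.
have -> : M * (Dab * E) ^+ 2 + `|a| * (M * (Dh * E) ^+ 2) + `|b| * (M * (Dk * E) ^+ 2) =
  M * E ^+ 2 * (Dab * Dab + `|a| * Dh * Dh + `|b| * Dk * Dk) by ring.
have -> : 2 * M * E ^+ 2 * Dab * (Dh + Dk) = M * E ^+ 2 * (2 * (Dab * (Dh + Dk))) by ring.
apply: ler_wpM2l; first by apply: mulr_ge0 => //; exact/exprn_ge0/ltW.
have := ler_wpM2l Dab0 Dabhk.
have : 0 <= `|a| * Dh * Dk by rewrite !mulr_ge0.
have : 0 <= `|b| * Dk * Dh by rewrite !mulr_ge0.
by rewrite /Dab; lra.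
Qed.

End SolutionEstimates.

(** * Uniform density of sine polynomials, by Bernstein approximation *)

Section SineDensity.
Variable R : realType.
Implicit Types (h p phi : R -> R) (x y s e : R).

Inductive sine_poly : (R -> R) -> Prop :=
| sine_poly_mode c j : sine_poly (fun x => c * smode j x)
| sine_poly_add p q : sine_poly p -> sine_poly q -> sine_poly (fun x => p x + q x).

Lemma sine_poly_scale c p : sine_poly p -> sine_poly (fun x => c * p x).
Proof.
elim=> [a j|p' q hp hcp hq hcq].
  rewrite (_ : (fun x => _) = (fun x => c * a * smode j x)); first exact: sine_poly_mode.
  by apply/funext => x; rewrite mulrA.
rewrite (_ : (fun x => _) = (fun x => c * p' x + c * q x)); first exact: sine_poly_add.
by apply/funext => x; rewrite mulrDr.
Qed.

Lemma sine_poly_cos p : sine_poly p -> sine_poly (fun x => cos (pi * x) * p x).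
Proof.
elim=> [a j|p' q hp hcp hq hcq]; last first.
  rewrite (_ : (fun x => _) = (fun x => cos (pi * x) * p' x + cos (pi * x) * q x)); first exact: sine_poly_add.
  by apply/funext => x; rewrite mulrDr.
(* The mode $0$ vanishes; it is set apart because the product formula lowers the frequency by
   one. *)
case: j => [|j].
  rewrite (_ : (fun x => _) = (fun x => 0 * smode 0 x)); first exact: sine_poly_mode.
  by apply/funext => x; rewrite /smode !mul0r sin0 !mulr0.
rewrite (_ : (fun x => _) = (fun x => (a / 2) * smode j.+2 x + (a / 2) * smode j x)).
  by apply: sine_poly_add; exact: sine_poly_mode.
apply/funext => x; rewrite /smode.
have -> : j.+2%:R * pi * x = j.+1%:R * pi * x + pi * x.
  by rewrite -(natr1 j.+1); ring.
have -> : j%:R * pi * x = j.+1%:R * pi * x - pi * x.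
  by rewrite -(natr1 j); ring.
by rewrite sinD sinB; field.
Qed.

(** The expectation of [f] under the binomial law with parameters $n,s$, computed by conditioning on
    one trial: a Bernstein polynomial with nodes $0,\dots,n$. *)
Fixpoint bern (n : nat) (f : nat -> R) s : R :=
  if n is m.+1 then (1 - s) * bern m f s + s * bern m (fun k => f k.+1) s else f 0%N.

Lemma bern_affine n (a b : R) f s : bern n (fun k => a + b * f k) s = a + b * bern n f s.
Proof. by elim: n f => [|n IH] f //=; rewrite !IH; ring. Qed.

(** Second moment of a shifted binomial law, squared mean plus variance. The shift [a] is what the
    induction changes. *)
Lemma bern_sqr n (a : R) s :
  bern n (fun k => (k%:R + a) ^+ 2) s = (n%:R * s + a) ^+ 2 + n%:R * s * (1 - s).
Proof.
elim: n a => [|n IH] a /=; first by rewrite !mul0r addr0.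
have -> : (fun k => (k.+1%:R + a) ^+ 2) = (fun k : nat => (k%:R + (a + 1)) ^+ 2).
  by apply/funext => k; rewrite -natr1; congr (_ ^+ 2); ring.
by rewrite !IH -natr1; ring.
Qed.

Lemma bern_le n f g s : 0 <= s <= 1 -> (forall k, (k <= n)%N -> f k <= g k) ->
  bern n f s <= bern n g s.
Proof.
move=> /andP[s0 s1]; elim: n f g => [|n IH] f g fg /=; first exact: fg.
apply: lerD; apply: ler_wpM2l; rewrite ?subr_ge0//; apply: IH => k kn.
  by apply: fg; exact: leqW.
by apply: fg.
Qed.

(** A homeomorphism of $[0,1]$ that is affine in $\cos\pi x$: a polynomial in it, multiplied by
    $\sin\pi x$, is a sine polynomial. *)
Definition half_versine x : R := (1 - cos (pi * x)) / 2.
Local Notation s_ := half_versine.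

Lemma sine_poly_bern n f : sine_poly (fun x => sin (pi * x) * bern n f (s_ x)).
Proof.
elim: n f => [|n IH] f /=.
  rewrite (_ : (fun x => _) = (fun x => f 0%N * smode 1 x)); first exact: sine_poly_mode.
  by apply/funext => x; rewrite /smode mul1r mulrC.
set g := fun k => f k.+1.
rewrite (_ : (fun x => _) = (fun x =>
   (2^-1 * (sin (pi * x) * bern n f (s_ x)) + 2^-1 * (cos (pi * x) * (sin (pi * x) * bern n f (s_ x)))) +
   (2^-1 * (sin (pi * x) * bern n g (s_ x)) + - 2^-1 * (cos (pi * x) * (sin (pi * x) * bern n g (s_ x)))))).
  apply: sine_poly_add; apply: sine_poly_add; apply: sine_poly_scale => //;
    exact: sine_poly_cos.
by apply/funext => x; move: (bern _ _ _) (bern _ g _) => B1 B2; rewrite /half_versine; field.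
Qed.

Let s_01 x : 0 <= s_ x <= 1.
Proof.
have := @cos_geN1 R (pi * x); have := @cos_le1 R (pi * x); rewrite /half_versine => ? ?.
by apply/andP; split; lra.
Qed.

Let s_surj s : 0 <= s <= 1 -> exists2 x, 0 <= x <= 1 & s_ x = s.
Proof.
move=> /andP[s0 s1]; have m : 1 - 2 * s \in `[-1, 1].
  by rewrite in_itv/=; apply/andP; split; lra.
have m' : -1 <= 1 - 2 * s <= 1 by move: m; rewrite in_itv.
exists (acos (1 - 2 * s) / pi).
  by rewrite divr_ge0 ?pi_ge0 ?acos_ge0//= ler_pdivrMr ?pi_gt0// mul1r acos_lepi.
by rewrite /half_versine [pi * _]mulrC divfK ?gt_eqF ?pi_gt0// acosK//; field.
Qed.

Let s_inj x y : 0 <= x <= 1 -> 0 <= y <= 1 -> s_ x = s_ y -> x = y.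
Proof.
move=> /andP[x0 x1] /andP[y0 y1] E.
have pp := @pi_gt0 R.
have : cos (pi * x) = cos (pi * y) by move: E; rewrite /half_versine => E; lra.
move/(congr1 (@acos R)); rewrite !cosK; first by move/mulfI; apply; rewrite gt_eqF.
- by rewrite in_itv/= mulr_ge0 ?(ltW pp)//= ler_piMr// ltW.
- by rewrite in_itv/= mulr_ge0 ?(ltW pp)//= ler_piMr// ltW.
Qed.

Let square : set (R * R) := `[0, 1]%classic `*` `[0, 1]%classic.

Let csquare : compact square.
Proof. by apply: compact_setX; exact: segment_compact. Qed.

Let cs_ : continuous s_.
Proof.
move=> x; apply: cvgM; last exact: cvg_cst.
by apply: cvgB; [exact: cvg_cst|exact: continuous_cosw].
Qed.

Lemma compact_within_ge (K : set (R * R)) (g : R * R -> R) (A : R) : compact K ->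
  {within K, continuous g} -> compact (K `&` [set p | A <= g p]).
Proof.
move=> cK cg; apply: (subclosed_compact _ cK); last exact: subIsetl.
move=> p pZ; have Kp : K p.
  apply: (compact_closed (@norm_hausdorff R (R * R)%type) cK).
  by apply: closure_subset pZ; exact: subIsetl.
split => //; rewrite /= leNgt; apply/negP => gA.
move/subspace_continuousP : cg => /(_ p Kp).
move/cvgr_lt => /(_ _ gA) /pZ[q [[Kq /= Aq]]] /(_ Kq).
by rewrite ltNge Aq.
Qed.

(** A modulus of continuity in quadratic form. Where $|\phi(x)-\phi(y)|\ge e$ the squared distance
    has a positive minimum $m$ by compactness, and $C=B/m$ with $B$ the maximal oscillation.
    Averaged with binomial weights, the quadratic term becomes a variance. *)
Let sqr_modulus phi e : {within `[0, 1], continuous phi} -> 0 < e ->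
  exists2 C : R, 0 <= C & forall x y, 0 <= x <= 1 -> 0 <= y <= 1 ->
    `|phi x - phi y| <= e + C * (s_ x - s_ y) ^+ 2.
Proof.
move=> cphi e0.
have c1 : {within square, continuous (fun p : R * R => `|phi p.1 - phi p.2|)}.
  apply/subspace_continuousP => -[x y] [/= x01 y01].
  move/subspace_continuousP : cphi => cphi.
  apply: cvg_norm; apply: cvgB.
    apply: (@cvg_comp _ _ _ (fun p : R * R => p.1) phi _ (within `[0, 1] (nbhs x))); last exact: cphi.
    move=> B /=; rewrite /within /= => /nbhs_ballP[r /= r0 H].
    by apply/nbhs_ballP; exists r => // -[z w] [/= xz _] [/= z01 _]; exact: H.
  apply: (@cvg_comp _ _ _ (fun p : R * R => p.2) phi _ (within `[0, 1] (nbhs y))); last exact: cphi.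
  move=> B /=; rewrite /within /= => /nbhs_ballP[r /= r0 H].
  by apply/nbhs_ballP; exists r => // -[z w] [/= _ yw] [/= _ w01]; exact: H.
have c2 : continuous (fun p : R * R => (s_ p.1 - s_ p.2) ^+ 2).
  have c3 : continuous (fun p : R * R => s_ p.1 - s_ p.2).
    move=> p; apply: cvgB.
      by apply: (@continuous_comp _ _ _ (fun p : R * R => p.1) s_); [exact: cvg_fst|exact: cs_].
    by apply: (@continuous_comp _ _ _ (fun p : R * R => p.2) s_); [exact: cvg_snd|exact: cs_].
  by move=> p; apply: cvgM; exact: c3.
pose Z := square `&` [set p | e <= `|phi p.1 - phi p.2|].
have cZ : compact Z by exact: compact_within_ge.
have [Z0|/set0P nZ] := eqVneq Z set0.
  exists 0 => // x y x01 y01; rewrite mul0r addr0 leNgt; apply/negP => lt.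
  have : Z (x, y) by split; [split; rewrite /= in_itv|exact: ltW].
  by rewrite Z0.
have [[x1 y1]] := compact_EVT_min nZ cZ (continuous_subspaceT c2).
rewrite inE => -[[/= x101 y101] /= ephi] mn.
set m := (s_ x1 - s_ y1) ^+ 2.
have m0 : 0 < m.
  rewrite lt_neqAle sqr_ge0 andbT eq_sym sqrf_eq0 subr_eq0; apply/eqP => E.
  move: x101 y101; rewrite !in_itv/= => x101 y101; move: ephi.
  by rewrite (s_inj x101 y101 E) subrr normr0 leNgt e0.
have sq0 : square !=set0 by exists (0, 0); split; rewrite /= in_itv/= lexx ler01.
have [[x2 y2] _ mx] := compact_EVT_max sq0 csquare c1.
set B := `|phi x2 - phi y2|; have B0 : 0 <= B by exact: normr_ge0.
exists (B / m); first by rewrite divr_ge0// ltW.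
move=> x y x01 y01; have xyS : square (x, y) by split; rewrite /= in_itv.
have [lt|ge] := ltP `|phi x - phi y| e.
  by apply: le_trans (ltW lt) _; rewrite lerDl mulr_ge0 ?sqr_ge0 ?divr_ge0// ltW.
have : m <= (s_ x - s_ y) ^+ 2 by apply: (mn (x, y)); rewrite inE; split.
have : `|phi x - phi y| <= B by apply: (mx (x, y)); rewrite inE.
move=> hB hm; apply: le_trans hB _; apply: (@le_trans _ _ (B / m * m)).
  by rewrite divfK// gt_eqF.
apply: (@le_trans _ _ (B / m * (s_ x - s_ y) ^+ 2)); last by rewrite lerDr ltW.
by rewrite ler_wpM2l// divr_ge0// ltW.
Qed.

(** Bernstein's argument in the variable $s$: the nodes are the preimages of $k/n$, and averaging
    the quadratic modulus leaves at most $e/2+C/n\le e$. *)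
Lemma sin_bern_approx phi e : {within `[0, 1], continuous phi} -> 0 < e ->
  exists2 p, sine_poly p & forall x, 0 <= x <= 1 -> `|sin (pi * x) * phi x - p x| <= e.
Proof.
move=> cphi e0; have e2 : 0 < e / 2 by rewrite divr_gt0.
have [C C0 H] := sqr_modulus cphi e2.
pose n := (Num.truncn (2 * C / e)).+1.
have n0 : 0 < n%:R :> R by rewrite ltr0n.
have nC : 2 * C / e < n%:R by exact: truncnS_gt.
have ex (k : nat) : exists x, (k <= n)%N -> 0 <= x <= 1 /\ s_ x = k%:R / n%:R.
  have [kn|kn] := leqP k n; last by exists 0.
  have [|x x01 E] := s_surj (s := k%:R / n%:R); last by exists x.
  by rewrite divr_ge0//= ler_pdivrMr// mul1r ler_nat.
have [xk hxk] := choice ex.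
exists (fun x => sin (pi * x) * bern n (fun k => phi (xk k)) (s_ x)); first exact: sine_poly_bern.
move=> x x01; rewrite -mulrBr normrM.
apply: (@le_trans _ _ `|phi x - bern n (fun k => phi (xk k)) (s_ x)|).
  by rewrite ler_piMl// ler_norml sin_geN1 sin_le1.
have var : bern n (fun k => (s_ x - k%:R / n%:R) ^+ 2) (s_ x) <= n%:R^-1.
  rewrite (_ : (fun k => _) = (fun k : nat => 0 + n%:R^-2 * (k%:R + - (n%:R * s_ x)) ^+ 2)); last first.
    by apply/funext => k; rewrite add0r; field; rewrite gt_eqF.
  rewrite bern_affine add0r bern_sqr subrr expr0n add0r.
  have := s_01 x; move: (s_ x) => s /andP[s0 s1].
  rewrite (_ : _ * _ = n%:R^-1 * (s * (1 - s))); last by field; rewrite gt_eqF.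
  rewrite ler_piMr ?invr_ge0 ?ltW//.
  by nra.
have bnd : e / 2 + C * bern n (fun k => (s_ x - k%:R / n%:R) ^+ 2) (s_ x) <= e.
  have : C * bern n (fun k => (s_ x - k%:R / n%:R) ^+ 2) (s_ x) <= C * n%:R^-1 by rewrite ler_wpM2l.
  have : C * n%:R^-1 <= e / 2.
    rewrite ler_pdivrMr// mulrAC ler_pdivlMr// [C * 2]mulrC [e * _]mulrC -ler_pdivrMr//.
    exact: ltW.
  by lra.
have K k : (k <= n)%N -> `|phi x - phi (xk k)| <= e / 2 + C * (s_ x - k%:R / n%:R) ^+ 2.
  by move=> kn; have [x1 <-] := hxk k kn; exact: H.
set b := bern n _ _.
have ub : b <= phi x + e.
  apply: le_trans (_ : bern n (fun k => (phi x + e / 2) + C * (s_ x - k%:R / n%:R) ^+ 2) (s_ x) <= _).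
    by apply: bern_le => // k kn; have := K k kn; rewrite ler_norml; lra.
  by rewrite bern_affine; lra.
have lb : phi x - e <= b.
  apply: le_trans (_ : bern n (fun k => (phi x - e / 2) + (- C) * (s_ x - k%:R / n%:R) ^+ 2) (s_ x) <= _).
    by rewrite bern_affine; lra.
  by apply: bern_le => // k kn; have := K k kn; rewrite ler_norml; lra.
by rewrite ler_norml; lra.
Qed.

(** Dividing [h] by $\sin\pi x$ is singular at the ends, so $h\sin/(\sin^2+\eta)$ is approximated
    instead. The loss $h\,\eta/(\sin^2+\eta)$ is at most $e/3+C\eta$, because the zeros of [h] at
    the ends and the quadratic modulus give $|h|\le e/3+C\sin^2$. *)
Lemma sine_poly_dense h e : {within `[0, 1], continuous h} -> h 0 = 0 -> h 1 = 0 -> 0 < e ->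
  exists2 p, sine_poly p & forall x, 0 <= x <= 1 -> `|h x - p x| <= e.
Proof.
move=> ch h0 h1 e0; have e3 : 0 < e / 3 by rewrite divr_gt0.
have [C C0 H] := sqr_modulus ch e3.
have hC x : 0 <= x <= 1 -> `|h x| <= e / 3 + C * sin (pi * x) ^+ 2.
  move=> x01; have z01 : 0 <= (0 : R) <= 1 by rewrite lexx ler01.
  have o01 : 0 <= (1 : R) <= 1 by rewrite lexx ler01.
  have := H x 0 x01 z01; have := H x 1 x01 o01; rewrite h0 h1 !subr0.
  rewrite (_ : s_ 0 = 0); last by rewrite /half_versine mulr0 cos0 subrr mul0r.
  rewrite (_ : s_ 1 = 1); last by rewrite /half_versine mulr1 cospi; field.
  have -> : sin (pi * x) ^+ 2 = 4 * (s_ x * (1 - s_ x)).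
    by rewrite sin2cos2 /half_versine; field.
  have := s_01 x; move: (s_ x) => s /andP[s0 s1] a1 a2.
  have [sl|sg] := lerP s (1 - s).
    apply: le_trans a2 _; rewrite lerD2l ler_wpM2l//; nra.
  by apply: le_trans a1 _; rewrite lerD2l ler_wpM2l//; nra.
pose eta := e / 3 / (C + 1).
have eta0 : 0 < eta by rewrite divr_gt0// ltr_wpDl.
have etaC : C * eta <= e / 3.
  by rewrite mulrC; apply: frac_succ_le => //; exact: ltW.
have den x : 0 < sin (pi * x) ^+ 2 + eta by rewrite ltr_wpDl ?sqr_ge0.
pose phi x := h x * (sin (pi * x) / (sin (pi * x) ^+ 2 + eta)).
have cphi : {within `[0, 1], continuous phi}.
  apply/subspace_continuousP => x x01; move/subspace_continuousP : ch => /(_ x x01) ch.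
  apply: cvgM => //; apply: cvg_within_filter.
  apply: cvgM; first exact: continuous_sinw.
  apply: cvgV; first by rewrite gt_eqF.
  apply: cvgD; last exact: cvg_cst.
  by apply: cvgM; exact: continuous_sinw.
have [p sp pa] := sin_bern_approx cphi e3.
exists p => // x x01; rewrite -(subrKA (sin (pi * x) * phi x)).
apply: le_trans (ler_normD _ _) _.
have := pa x x01; have := hC x x01; have := den x; have := sqr_ge0 (sin (pi * x)).
rewrite (_ : h x - sin (pi * x) * phi x = h x * (eta / (sin (pi * x) ^+ 2 + eta))); last first.
  by rewrite /phi; field; rewrite gt_eqF.
move: (sin (pi * x) ^+ 2) (p x) => q px q0 qe hx.
set X := `|sin _ * _ - _| => pX.
have qe1 : 0 <= eta / (q + eta) by rewrite divr_ge0// ltW.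
have qe2 : eta / (q + eta) <= 1 by rewrite ler_pdivrMr// mul1r lerDr.
have qe3 : q * (eta / (q + eta)) <= eta.
  rewrite mulrCA; apply: ler_piMr; first exact: ltW.
  by rewrite ler_pdivrMr// mul1r lerDl ltW.
rewrite normrM (ger0_norm qe1).
have : `|h x| * (eta / (q + eta)) <= e / 3 + C * eta.
  apply: le_trans (ler_wpM2r qe1 hx) _; rewrite mulrDl; apply: lerD.
    by rewrite ler_piMr// ltW.
  by rewrite -mulrA ler_wpM2l.
by lra.
Qed.

End SineDensity.

(** * Frechet calculus at the origin: sums, squares and the prior term *)

Section FrechetCalculus.
Variable R : realType.
Implicit Types (J G : (R -> R) -> R) (u v h k : R -> R)
  (DJ B : (R -> R) -> (R -> R) -> R).
Local Notation zero := (fun _ : R => 0 : R).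

Lemma Vset_add u v : Vset u -> Vset v -> Vset (fun x => u x + v x).
Proof.
move=> Vu Vv; have := Vset_lin 1 1 Vu Vv.
by rewrite (_ : (fun x => _) = (fun x => u x + v x))//; apply/funext => z; rewrite !mul1r.
Qed.

Lemma Vset_scale a u : Vset u -> Vset (fun x => a * u x).
Proof.
move=> Vu; have := Vset_lin a 0 Vu Vu.
by rewrite (_ : (fun x => _) = (fun x => a * u x))//; apply/funext => z; rewrite mul0r addr0.
Qed.

Lemma Vset0 : Vset zero.
Proof.
have := Vset_scale 0 (@Vset_smode R 0).
by rewrite (_ : (fun x => _) = zero)//; apply/funext => x; rewrite mul0r.
Qed.

Lemma Vnorm0 : Vnorm zero = 0.
Proof. by have := VnormZ 0 Vset0; rewrite normr0 !mul0r. Qed.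

Lemma Vnorm_add u v : Vset u -> Vset v -> Vnorm (fun x => u x + v x) <= Vnorm u + Vnorm v.
Proof.
move=> Vu Vv; have := Vnorm_comb 1 1 Vu Vv; rewrite normr1 !mul1r.
by rewrite (_ : (fun x => _) = (fun x => u x + v x))//; apply/funext => z; rewrite !mul1r.
Qed.

(** Second-order differentiability at the origin with [v - 0] and [0 + h] already simplified, a form
    that is convenient for sums. *)
Definition twice_frechet0 J DJ B : Prop :=
  (exists2 rho : R, 0 < rho & forall v, Vset v -> Vnorm v < rho -> Vfrechet J v (DJ v)) /\
  Vbdd_bilinear B /\
  forall e : R, 0 < e -> exists2 d : R, 0 < d &
    forall h, Vset h -> Vnorm h < d -> forall k, Vset k ->
      `|DJ h k - DJ zero k - B h k| <= e * Vnorm h * Vnorm k.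

Lemma twice_frechet0P J DJ B : twice_frechet0 J DJ B -> Vtwice_frechet J zero DJ B.
Proof.
move=> [[rho rho0 H1] [H2 H3]]; split; [|split=> // e /H3 [d d0 H]].
  exists rho => // v Vv nv; apply: H1 => //.
  by move: nv; rewrite (_ : (fun x => _) = v)//; apply/funext => x; rewrite subr0.
exists d => // h Vh nh k Vk; rewrite (_ : (fun x => 0 + h x) = h); first exact: H.
by apply/funext => x; rewrite add0r.
Qed.

Lemma Vbdd_linear_add (L1 L2 : (R -> R) -> R) : Vbdd_linear L1 -> Vbdd_linear L2 ->
  Vbdd_linear (fun k => L1 k + L2 k).
Proof.
move=> [l1 [C1 b1]] [l2 [C2 b2]]; split.
  by move=> a b h k Vh Vk; rewrite l1// l2//; ring.
exists (C1 + C2) => h Vh; apply: le_trans (ler_normD _ _) _.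
by rewrite mulrDl; apply: lerD; [exact: b1|exact: b2].
Qed.

Lemma Vfrechet_add J1 J2 v L1 L2 : Vfrechet J1 v L1 -> Vfrechet J2 v L2 ->
  Vfrechet (fun u => J1 u + J2 u) v (fun k => L1 k + L2 k).
Proof.
move=> [l1 f1] [l2 f2]; split; first exact: Vbdd_linear_add.
move=> e e0; have e2 : 0 < e / 2 by rewrite divr_gt0.
have [d1 d10 H1] := f1 _ e2; have [d2 d20 H2] := f2 _ e2.
exists (Num.min d1 d2); first by rewrite lt_min d10.
move=> h Vh; rewrite lt_min => /andP[n1 n2].
have := H1 h Vh n1; have := H2 h Vh n2.
set A1 := J1 _; set A2 := J2 _ => a1 a2.
have -> : A1 + A2 - (J1 v + J2 v) - (L1 h + L2 h) = (A1 - J1 v - L1 h) + (A2 - J2 v - L2 h) by ring.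
by apply: le_trans (ler_normD _ _) _; lra.
Qed.

Lemma Vbdd_bilinear_add B1 B2 : Vbdd_bilinear B1 -> Vbdd_bilinear B2 ->
  Vbdd_bilinear (fun h k => B1 h k + B2 h k).
Proof.
move=> [l1 [r1 [C1 b1]]] [l2 [r2 [C2 b2]]]; split; [|split].
- by move=> h Vh; apply: Vbdd_linear_add; [exact: l1|exact: l2].
- by move=> k Vk; apply: Vbdd_linear_add; [exact: r1|exact: r2].
exists (C1 + C2) => h k Vh Vk; apply: le_trans (ler_normD _ _) _.
by rewrite !mulrDl; apply: lerD; [exact: b1|exact: b2].
Qed.

Lemma twice_frechet0_add J1 J2 DJ1 DJ2 B1 B2 :
  twice_frechet0 J1 DJ1 B1 -> twice_frechet0 J2 DJ2 B2 ->
  twice_frechet0 (fun u => J1 u + J2 u) (fun v k => DJ1 v k + DJ2 v k) (fun h k => B1 h k + B2 h k).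
Proof.
move=> [[p1 p10 a1] [b1 c1]] [[p2 p20 a2] [b2 c2]]; split; [|split].
- exists (Num.min p1 p2); first by rewrite lt_min p10.
  move=> v Vv; rewrite lt_min => /andP[n1 n2].
  by apply: Vfrechet_add; [exact: a1|exact: a2].
- exact: Vbdd_bilinear_add.
move=> e e0; have e2 : 0 < e / 2 by rewrite divr_gt0.
have [d1 d10 H1] := c1 _ e2; have [d2 d20 H2] := c2 _ e2.
exists (Num.min d1 d2); first by rewrite lt_min d10.
move=> h Vh; rewrite lt_min => /andP[n1 n2] k Vk.
have := H1 h Vh n1 k Vk; have := H2 h Vh n2 k Vk => h1 h2.
rewrite (_ : _ - _ = (DJ1 h k - DJ1 zero k - B1 h k) + (DJ2 h k - DJ2 zero k - B2 h k)); last by ring.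
by apply: le_trans (ler_normD _ _) _; lra.
Qed.

Lemma Vbdd_linear0 : Vbdd_linear (fun _ : R -> R => 0).
Proof. by split=> [a b *|]; [rewrite !mulr0 addr0|exists 0 => *; rewrite normr0 mul0r]. Qed.

Lemma twice_frechet0_0 : twice_frechet0 (fun _ => 0) (fun _ _ => 0) (fun _ _ => 0).
Proof.
split; [|split].
- exists 1 => // v _ _; split; first exact: Vbdd_linear0.
  move=> e e0; exists 1 => // h _ _.
  by rewrite !subrr normr0 mulr_ge0 ?Vnorm_ge0// ltW.
- split; [|split]; [by move=> *; exact: Vbdd_linear0|by move=> *; exact: Vbdd_linear0|].
  by exists 0 => *; rewrite normr0 !mul0r.
- move=> e e0; exists 1 => // h _ _ k _.
  by rewrite !subrr normr0 !mulr_ge0 ?Vnorm_ge0// ltW.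
Qed.

Lemma twice_frechet0_sum N (J : 'I_N -> (R -> R) -> R)
    (DJ B : 'I_N -> (R -> R) -> (R -> R) -> R) :
  (forall i, twice_frechet0 (J i) (DJ i) (B i)) ->
  twice_frechet0 (fun u => \sum_(i < N) J i u) (fun v k => \sum_(i < N) DJ i v k)
    (fun h k => \sum_(i < N) B i h k).
Proof.
elim: N J DJ B => [|N IH] J DJ B H.
  rewrite (_ : (fun u => _) = (fun _ => 0)); last by apply/funext => u; rewrite big_ord0.
  have E (F : 'I_0 -> (R -> R) -> (R -> R) -> R) :
      (fun v k => \sum_(i < 0) F i v k) = (fun _ _ => 0).
    by apply/funext => u; apply/funext => k; rewrite big_ord0.
  rewrite !E; exact: twice_frechet0_0.
have := twice_frechet0_add (H ord0) (IH _ _ _ (fun i => H (lift ord0 i))).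
rewrite (_ : (fun u => _ + _) = (fun u => \sum_(i < N.+1) J i u)); last first.
  by apply/funext => u; rewrite big_ord_recl.
have E (F : 'I_N.+1 -> (R -> R) -> (R -> R) -> R) :
    (fun v k => F ord0 v k + \sum_(i < N) F (lift ord0 i) v k) =
    (fun v k => \sum_(i < N.+1) F i v k).
  by apply/funext => u; apply/funext => k; rewrite big_ord_recl.
by rewrite !E.
Qed.

Lemma Vip_addl u v w : Vset u -> Vset v -> Vset w ->
  Vip (fun x => u x + v x) w = Vip u w + Vip v w.
Proof.
move=> Vu Vv Vw; have := Vip_linl 1 1 Vu Vv Vw; rewrite !mul1r => <-.
by congr Vip; apply/funext => x; rewrite !mul1r.
Qed.

Lemma Vip_bdd a u : Vset u -> Vbdd_linear (fun k => a * Vip u k).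
Proof.
move=> Vu; split=> [b c h k Vh Vk|]; first by rewrite Vip_linr//; ring.
exists (`|a| * Vnorm u) => h Vh; rewrite normrM -mulrA ler_wpM2l//.
exact: Vip_CS.
Qed.

Lemma twice_frechet0_quadratic (a : R) (u0 : R -> R) : 0 <= a -> Vset u0 ->
  twice_frechet0 (fun u => a * Vnorm (fun x => u x - u0 x) ^+ 2)
    (fun v k => 2 * a * Vip (fun x => v x - u0 x) k) (fun h k => 2 * a * Vip h k).
Proof.
move=> a0 Vu0.
have Vsub u : Vset u -> Vset (fun x => u x - u0 x).
  move=> Vu; have := Vset_lin 1 (-1) Vu Vu0.
  by rewrite (_ : (fun x => _) = (fun x => u x - u0 x))//; apply/funext => z; rewrite mul1r mulN1r.
split; [|split].
- exists 1 => // v Vv _; split; first exact: Vip_bdd (Vsub _ Vv).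
  move=> e e0; exists (e / (a + 1)); first by rewrite divr_gt0// ltr_wpDl.
  move=> h Vh nh; rewrite !Vnorm_sqr.
  have Vvu := Vsub v Vv.
  rewrite (_ : (fun x => v x + h x - u0 x) = (fun x => (v x - u0 x) + h x)); last first.
    by apply/funext => x; rewrite addrAC.
  set w := fun x => v x - u0 x in Vvu *.
  have -> : Vip (fun x => w x + h x) (fun x => w x + h x) = Vip w w + 2 * Vip w h + Vip h h.
    have Vwh := Vset_add Vvu Vh.
    rewrite (Vip_addl Vvu Vh Vwh) (VipC w (fun x => _ + _)) (VipC h (fun x => _ + _)).
    rewrite (Vip_addl Vvu Vh Vvu) (Vip_addl Vvu Vh Vh) (VipC h w).
    by ring.
  rewrite (_ : _ - _ - _ = a * Vip h h); last by ring.
  rewrite -Vnorm_sqr ger0_norm; last by apply: mulr_ge0 => //; exact: sqr_ge0.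
  rewrite expr2 mulrA; apply: ler_wpM2r; first exact: Vnorm_ge0.
  apply: le_trans (ler_wpM2l a0 (ltW nh)) _; rewrite mulrC; apply: frac_succ_le => //.
  exact: ltW.
- split; [|split].
  + by move=> h Vh; exact: Vip_bdd.
  + move=> k Vk; have := Vip_bdd (2 * a) Vk.
    by rewrite (_ : (fun h => _) = (fun h => 2 * a * Vip h k))//; apply/funext => h; rewrite VipC.
  + exists (2 * a) => h k Vh Vk; rewrite normrM (ger0_norm (mulr_ge0 _ a0))//.
    by rewrite -[X in _ <= X]mulrA ler_wpM2l ?mulr_ge0// Vip_CS.
- move=> e e0; exists 1 => // h Vh _ k Vk.
  rewrite (_ : (fun x => h x - u0 x) = (fun x => h x + (zero x - u0 x))); last first.
    by apply/funext => x; rewrite sub0r.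
  rewrite Vip_addl//; last exact: Vsub Vset0.
  rewrite (_ : _ - _ = 0); last by ring.
  by rewrite normr0 !mulr_ge0 ?Vnorm_ge0// ltW.
Qed.

(** Bounds with explicit powers, stronger than differentiability: squaring $G-z$ calls for a
    Lipschitz bound and a quadratic remainder of [G] at every base point near $0$. *)
Definition twice_differentiable0 G DG D2G (C rho : R) : Prop :=
  [/\ 0 <= C, 0 < rho,
    forall v, Vset v -> Vnorm v <= rho ->
      [/\ forall a b h k, Vset h -> Vset k ->
            DG v (fun x => a * h x + b * k x) = a * DG v h + b * DG v k,
          forall k, Vset k -> `|DG v k| <= C * Vnorm k,
          forall h, Vset h -> Vnorm h <= rho -> `|G (fun x => v x + h x) - G v| <= C * Vnorm h &
          forall h, Vset h -> Vnorm h <= rho ->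
            `|G (fun x => v x + h x) - G v - DG v h| <= C * Vnorm h ^+ 2],
    forall h k, Vset h -> Vset k -> Vnorm h <= rho -> `|DG h k - DG zero k| <= C * Vnorm h * Vnorm k &
    [/\ forall k a b h1 h2, Vset k -> Vset h1 -> Vset h2 ->
          D2G (fun x => a * h1 x + b * h2 x) k = a * D2G h1 k + b * D2G h2 k,
        forall h a b k1 k2, Vset h -> Vset k1 -> Vset k2 ->
          D2G h (fun x => a * k1 x + b * k2 x) = a * D2G h k1 + b * D2G h k2,
        forall h k, Vset h -> Vset k -> `|D2G h k| <= C * Vnorm h * Vnorm k &
        forall e : R, 0 < e -> exists2 d : R, 0 < d & forall h k, Vset h -> Vset k -> Vnorm h <= d ->
          `|DG h k - DG zero k - D2G h k| <= e * Vnorm h * Vnorm k]].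

Lemma twice_frechet0_square G DG D2G (C rho z : R) : G zero = 0 ->
  twice_differentiable0 G DG D2G C rho ->
  twice_frechet0 (fun u => 2^-1 * (G u - z) ^+ 2) (fun v k => (G v - z) * DG v k)
    (fun h k => DG zero h * DG zero k - z * D2G h k).
Proof.
move=> G0 [C0 rho0 HG HD [l1 l2 l3 l4]].
have n0 : Vnorm zero <= rho by rewrite Vnorm0 ltW.
have [g1 g2 _ _] := HG _ Vset0 n0.
split; [|split].
- exists rho => // v Vv /ltW nv; have [a1 a2 a3 a4] := HG v Vv nv; split.
    split=> [a b h k Vh Vk|]; first by rewrite a1//; ring.
    exists (`|G v - z| * C) => h Vh; rewrite normrM -mulrA ler_wpM2l//.
    exact: a2.
  move=> e e0; pose K := `|G v - z| * C + C ^+ 2.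
  have K0 : 0 <= K by rewrite addr_ge0 ?mulr_ge0 ?sqr_ge0.
  exists (Num.min rho (e / (K + 1))); first by rewrite lt_min rho0 divr_gt0// ltr_wpDl.
  move=> h Vh; rewrite lt_min => /andP[/ltW nh1 nh2].
  have := a3 h Vh nh1; have := a4 h Vh nh1.
  set Y := G _ => b4 b3.
  have -> : 2^-1 * (Y - z) ^+ 2 - 2^-1 * (G v - z) ^+ 2 - (G v - z) * DG v h =
    (G v - z) * (Y - G v - DG v h) + 2^-1 * (Y - G v) ^+ 2 by field.
  have h1 : `|(G v - z) * (Y - G v - DG v h)| <= `|G v - z| * (C * Vnorm h ^+ 2).
    by rewrite normrM ler_wpM2l.
  have h2 : `|2^-1 * (Y - G v) ^+ 2| <= C ^+ 2 * Vnorm h ^+ 2.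
    rewrite normrM normrX -exprMn.
    apply: (@le_trans _ _ (1 * (C * Vnorm h) ^+ 2)); last by rewrite mul1r.
    apply: ler_pM => //; first by rewrite ger0_norm// invf_le1// ler1n.
    by rewrite ler_pXn2r// nnegrE mulr_ge0// Vnorm_ge0.
  apply: le_trans (ler_normD _ _) _; apply: le_trans (lerD h1 h2) _.
  have -> : `|G v - z| * (C * Vnorm h ^+ 2) + C ^+ 2 * Vnorm h ^+ 2 = K * Vnorm h * Vnorm h.
    by rewrite /K; ring.
  rewrite ler_wpM2r ?Vnorm_ge0//.
  apply: le_trans (ler_wpM2l K0 (ltW nh2)) _; rewrite mulrC; apply: frac_succ_le => //.
  exact: ltW.
- split; [|split].
  + move=> h Vh; split=> [a b k1 k2 V1 V2|]; first by rewrite g1// l2//; ring.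
    exists (C * Vnorm h * C + `|z| * (C * Vnorm h)) => k Vk.
    apply: le_trans (ler_normB _ _) _; rewrite mulrDl !normrM; apply: lerD.
      by rewrite -mulrA; apply: ler_pM => //; exact: g2.
    by rewrite -mulrA ler_wpM2l//; exact: l3.
  + move=> k Vk; split=> [a b h1 h2 V1 V2|]; first by rewrite g1// l1//; ring.
    exists (C * Vnorm k * C + `|z| * (C * Vnorm k)) => h Vh.
    apply: le_trans (ler_normB _ _) _; rewrite mulrDl !normrM; apply: lerD.
      rewrite mulrC -mulrA; apply: ler_pM => //; exact: g2.
    by rewrite -mulrA ler_wpM2l// mulrAC; exact: l3.
  + exists (C * C + `|z| * C) => h k Vh Vk.
    apply: le_trans (ler_normB _ _) _; rewrite !mulrDl !normrM; apply: lerD.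
      rewrite (_ : C * C * _ * _ = (C * Vnorm h) * (C * Vnorm k)); last by ring.
      by apply: ler_pM => //; exact: g2.
    by rewrite -!mulrA ler_wpM2l// mulrA; exact: l3.
- move=> e e0; pose K := 2 * C ^+ 2 + C ^+ 2.
  have K0 : 0 <= K by rewrite addr_ge0 ?mulr_ge0 ?sqr_ge0.
  have e1 : 0 < e / 2 / (`|z| + 1) by rewrite !divr_gt0// ltr_wpDl.
  have [d d0 Hd] := l4 _ e1.
  exists (Num.min (Num.min rho d) (e / 2 / (K + 1))).
    by rewrite !lt_min rho0 d0/= !divr_gt0// ltr_wpDl.
  move=> h Vh; rewrite !lt_min -andbA => /and3P[/ltW nh1 /ltW nh2 /ltW nh3] k Vk.
  rewrite G0 sub0r.
  have [b1 b2 _ _] := HG h Vh nh1.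
  have [_ _ c3 c4] := HG _ Vset0 n0.
  have := c4 h Vh nh1; have := c3 h Vh nh1; rewrite G0 subr0.
  rewrite (_ : (fun x => 0 + h x) = h); last by apply/funext => x; rewrite add0r.
  move=> e3 e4.
  (* The first two terms are $O(\|h\|^2\|k\|)$, by the quadratic remainder of [G] and the Lipschitz
     bound of [DG]; only the last one uses the second derivative. *)
  rewrite (_ : _ - _ - _ = (G h - DG zero h) * DG h k + DG zero h * (DG h k - DG zero k)
     - z * (DG h k - DG zero k - D2G h k)); last by ring.
  apply: le_trans (ler_normB _ _) _.
  have t1 : `|(G h - DG zero h) * DG h k| <= C * Vnorm h ^+ 2 * (C * Vnorm k).
    by rewrite normrM; apply: ler_pM => //; exact: b2.
  have t2 : `|DG zero h * (DG h k - DG zero k)| <= C * Vnorm h * (C * Vnorm h * Vnorm k).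
    by rewrite normrM; apply: ler_pM => //; [exact: g2|exact: HD].
  have t3 : `|z * (DG h k - DG zero k - D2G h k)| <= e / 2 * Vnorm h * Vnorm k.
    rewrite normrM; apply: le_trans (ler_wpM2l (normr_ge0 z) (Hd h k Vh Vk nh2)) _.
    rewrite (_ : `|z| * _ = (e / 2 / (`|z| + 1) * `|z|) * Vnorm h * Vnorm k); last by ring.
    rewrite ler_wpM2r ?Vnorm_ge0// ler_wpM2r ?Vnorm_ge0//.
    by apply: frac_succ_le => //; rewrite divr_ge0// ltW.
  have t4 : C * Vnorm h ^+ 2 * (C * Vnorm k) + C * Vnorm h * (C * Vnorm h * Vnorm k)
      <= e / 2 * Vnorm h * Vnorm k.
    rewrite (_ : _ + _ = 2 * C ^+ 2 * Vnorm h * Vnorm h * Vnorm k); last by ring.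
    rewrite ler_wpM2r ?Vnorm_ge0// ler_wpM2r ?Vnorm_ge0//.
    apply: (@le_trans _ _ (K * (e / 2 / (K + 1)))).
      by apply: ler_pM; rewrite ?Vnorm_ge0 ?mulr_ge0 ?sqr_ge0// lerDl sqr_ge0.
    rewrite mulrC; apply: frac_succ_le => //; first by rewrite divr_ge0// ltW.
  have := ler_normD ((G h - DG zero h) * DG h k) (DG zero h * (DG h k - DG zero k)).
  by lra.
Qed.

End FrechetCalculus.

(** * Derivatives at the origin of a single observation *)

Section ObservationFunctional.
Variables (R : realType) (r : R -> R).
Hypotheses (hr : C2 r) (r0 : r 0 = 0) (r'0 : derive1 r 0 = 0).
Variable S : (R -> R) -> R -> R -> R.
Hypothesis hS : forall u, Vset u -> is_solution r u (S u).
Variable t : R.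
Hypothesis t_gt0 : 0 < t.
Local Notation zero := (fun _ : R => 0 : R).
Local Notation E := (growth_factor t).
Local Notation c := (derive1n 2 r 0 : R).
Implicit Types (u v h k : R -> R).

Definition observe u : R := obs t (S u).

Let t_ge0 : 0 <= t. Proof. exact: ltW. Qed.
Let tT : 0 <= t <= t. Proof. by rewrite t_ge0 lexx. Qed.
Let E0 : 0 < E. Proof. exact: expR_gt0. Qed.
Let sup_Vnorm u : Vset u -> sup_le u (Vnorm u).
Proof. by move=> Vu x x01; exact: Vsup_le. Qed.
Let heat u (Vu : Vset u) := sol_heat hS Vu.

Lemma small_ball (w : R) : 0 < w -> exists2 del : R, 0 < del &
  (forall p q : R, `|p| <= del -> `|q| <= del -> `|r p - r q| <= w * `|p - q|) /\
  (forall p q : R, `|p| <= del -> `|q| <= del ->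
    `|r (p + q) - r p - r q - c * p * q| <= w * `|p| * `|q|).
Proof.
move=> w0; have [d1 d10 H1] := C2_small_lipschitz hr r'0 w0.
have [d2 d20 H2] := C2_mixed_difference hr r0 w0.
exists (Num.min d1 d2); first by rewrite lt_min d10.
by split=> p q; rewrite !le_min => /andP[p1 p2] /andP[q1 q2]; [exact: H1|exact: H2].
Qed.

(** The increment is bounded by the supremum of [h] and not only by its norm in $V$, because the
    density argument for the gradient takes place in the supremum norm. *)
Lemma observe_local : exists C rho : R, [/\ 0 <= C, 0 < rho,
  forall v h, Vset v -> Vset h -> Vnorm v <= rho -> Vnorm h <= rho ->
    forall D : R, 0 <= D -> sup_le h D -> `|observe (fun x => v x + h x) - observe v| <= E * D,
  forall v (a b : R) h k, Vset v -> Vset h -> Vset k ->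
    `|a| <= 1 -> `|b| <= 1 -> Vnorm v <= rho -> Vnorm h <= rho -> Vnorm k <= rho ->
    `|(observe (fun x => v x + (a * h x + b * k x)) - observe v)
      - a * (observe (fun x => v x + h x) - observe v)
      - b * (observe (fun x => v x + k x) - observe v)|
      <= C * (`|a| * Vnorm h + `|b| * Vnorm k) * (Vnorm h + Vnorm k) &
  forall h k, Vset h -> Vset k -> Vnorm h <= rho -> Vnorm k <= rho ->
    `|mixed observe h k| <= C * Vnorm h * Vnorm k].
Proof.
have [d1 d10 [lip1 mix1]] := small_ball ltr01.
have [M M0 [d2 d20 tay]] := C2_taylor1 hr r'0.
pose del := Num.min d1 d2.
have del0 : 0 < del by rewrite lt_min d10.
have lip p q : `|p| <= del -> `|q| <= del -> `|r p - r q| <= 1 * `|p - q|.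
  by rewrite !le_min => /andP[? _] /andP[? _]; exact: lip1.
have mix p q : `|p| <= del -> `|q| <= del ->
    `|r (p + q) - r p - r q - c * p * q| <= 1 * `|p| * `|q|.
  by rewrite !le_min => /andP[? _] /andP[? _]; exact: mix1.
have tay' p q : `|p| <= del -> `|p + q| <= del ->
    `|derive1 r p| <= 1 /\ `|r (p + q) - r p - derive1 r p * q| <= M * q ^+ 2.
  by rewrite !le_min => /andP[_ ?] /andP[_ ?]; exact: tay.
(* Three norms of this size, multiplied by [E], add up to three quarters of [del], so all solutions
   involved stay where [r] is controlled. *)
pose rho := del / (4 * E).
have rho0 : 0 < rho by rewrite divr_gt0// mulr_gt0.
have rhoE : (rho + rho + rho) * E < del.
  have -> : (rho + rho + rho) * E = 3 / 4 * del by rewrite /rho; field; rewrite gt_eqF.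
  by lra.
have smallE D : D <= rho + rho + rho -> D * E < del.
  by move=> Dr; apply: le_lt_trans rhoE; rewrite ler_pM2r.
pose C := 2 * M * E ^+ 3 + (`|c| + 1) * E ^+ 3.
have E3 : 0 <= E ^+ 3 by apply: exprn_ge0; exact: ltW.
have Ca : 0 <= 2 * M * E ^+ 3 by apply: mulr_ge0 => //; apply: mulr_ge0 => //; exact: ltW.
have Cb : 0 <= (`|c| + 1) * E ^+ 3 by apply: mulr_ge0 => //; exact: addr_ge0.
exists C, rho; split => //; first exact: addr_ge0.
- move=> v h Vv Vh nv nh D D0 hD; have Vvh := Vset_add Vv Vh.
  rewrite -(obs_sub t_ge0 (heat Vvh) (heat Vv)).
  apply: (obs_norm_le t_ge0 (heat_solution_sub (heat Vvh) (heat Vv))) => x x01.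
  rewrite mulrC.
  apply: (sol_lip r0 hS del0 (lexx 1) lip Vvh Vv D0 (_ : 0 <= rho + rho)) => //.
  + by rewrite addr_ge0// ltW.
  + move=> y y01; apply: le_trans (ler_normD _ _) _.
    by have := sup_Vnorm Vv y01; have := sup_Vnorm Vh y01; lra.
  + by move=> y y01; have := sup_Vnorm Vv y01; lra.
  + by apply: smallE; lra.
  + by move=> y y01; rewrite addrAC subrr add0r; exact: hD.
- move=> v a b h k Vv Vh Vk a1 b1 nv nh nk.
  have Vab := Vset_add Vv (Vset_lin a b Vh Vk).
  have Vvh := Vset_add Vv Vh; have Vvk := Vset_add Vv Vk.
  have s1 := heat_solution_sub (heat Vab) (heat Vv).
  have s2 := heat_solution_sub (heat Vvh) (heat Vv).
  have s3 := heat_solution_sub (heat Vvk) (heat Vv).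
  have := obs_comb3 a b t_ge0 s1 s2 s3.
  rewrite (obs_sub t_ge0 (heat Vab) (heat Vv)) (obs_sub t_ge0 (heat Vvh) (heat Vv)).
  rewrite (obs_sub t_ge0 (heat Vvk) (heat Vv)) => <-.
  apply: (obs_norm_le t_ge0 (heat_solution_comb3 a b s1 s2 s3)) => x x01.
  have q1 : (Vnorm v + Vnorm h + Vnorm k) * E < del by apply: smallE; lra.
  apply: le_trans (sol_quad r0 hS del0 (ltW M0) lip tay' Vv Vh Vk (Vnorm_ge0 v)
    (Vnorm_ge0 h) (Vnorm_ge0 k) (sup_Vnorm Vv) (sup_Vnorm Vh) (sup_Vnorm Vk) a1 b1 q1 x01 tT) _.
  rewrite ler_wpM2r ?addr_ge0 ?Vnorm_ge0// ler_wpM2r ?addr_ge0 ?mulr_ge0 ?Vnorm_ge0//.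
  by rewrite lerDl.
- move=> h k Vh Vk nh nk; have Vhk := Vset_add Vh Vk.
  rewrite /mixed -(obs_sub t_ge0 (heat Vhk) (heat Vh)).
  have s1 := heat_solution_sub (heat Vhk) (heat Vh).
  rewrite -(obs_sub t_ge0 s1 (heat Vk)).
  apply: (obs_norm_le t_ge0 (heat_solution_sub s1 (heat Vk))) => x x01.
  have q1 : (Vnorm h + Vnorm k) * E < del by apply: smallE; lra.
  have [q2 _] := sol_mixed_bound r0 hS del0 ltr01 (lexx 1) lip mix Vh Vk (Vnorm_ge0 h)
     (Vnorm_ge0 k) (sup_Vnorm Vh) (sup_Vnorm Vk) q1 x01 tT.
  apply: le_trans q2 _.
  by rewrite ler_wpM2r ?Vnorm_ge0// ler_wpM2r ?Vnorm_ge0// lerDr.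
Qed.

(** The maximum principle with $D=0$ forces the solution with zero initial datum to vanish up to
    time [t]. *)
Lemma observe0 : observe zero = 0.
Proof.
have [C [rho [_ rho0 H _ _]]] := observe_local.
have n0 : Vnorm zero <= rho by rewrite Vnorm0 ltW.
have [d1 d10 [lip _]] := small_ball ltr01.
apply/eqP; rewrite -normr_le0.
apply: (obs_norm_le t_ge0 (heat (@Vset0 R))) => x x01.
rewrite -[leRHS](mul0r E); apply: (sol_bound r0 hS d10 (lexx 1) lip) => //.
- exact: Vset0.
- by move=> y _; rewrite normr0.
- by rewrite mul0r.
Qed.

Lemma observe_mixed_lin (e : R) : 0 < e -> exists2 d : R, 0 < d &
  forall (a b : R) h k l, Vset h -> Vset k -> Vset l -> `|a| <= 1 -> `|b| <= 1 ->
    Vnorm h <= d -> Vnorm k <= d -> Vnorm l <= d ->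
    `|mixed observe (fun x => a * h x + b * k x) l - a * mixed observe h l - b * mixed observe k l|
      <= e * (`|a| * Vnorm h + `|b| * Vnorm k) * Vnorm l.
Proof.
move=> e0.
set K := (2 * ((`|c| + 1) * E ^+ 3 + E ^+ 2) + 2 * `|c| * E ^+ 3) * E.
have En n : 0 <= E ^+ n by apply: exprn_ge0; exact: ltW.
have K0 : 0 <= K.
  apply: mulr_ge0; last exact: ltW.
  apply: addr_ge0; last by apply: mulr_ge0 => //; exact: mulr_ge0.
  by apply: mulr_ge0 => //; apply: addr_ge0 => //; apply: mulr_ge0 => //; exact: addr_ge0.
(* So small that the constant of the estimate, $wK$, is at most [e]. *)
pose w := Num.min 1 (e / (K + 1)).
have w0 : 0 < w by rewrite lt_min ltr01 divr_gt0// ltr_wpDl.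
have w1 : w <= 1 by rewrite ge_min lexx.
have wK : w * K <= e.
  apply: (@le_trans _ _ (e / (K + 1) * K)); last by apply: frac_succ_le => //; exact: ltW.
  by rewrite ler_wpM2r// ge_min lexx orbT.
have [del del0 [lip mix]] := small_ball w0.
have d0 : 0 < del / (4 * E) by rewrite divr_gt0// mulr_gt0.
exists (del / (4 * E)) => // a b h k l Vh Vk Vl a1 b1 nh nk nl.
have Vab := Vset_lin a b Vh Vk.
have s f (Vf : Vset f) := heat_solution_sub (heat_solution_sub (heat (Vset_add Vf Vl)) (heat Vf)) (heat Vl).
have mE f (Vf : Vset f) : mixed observe f l =
   obs t (fun x t => S (fun x => f x + l x) x t - S f x t - S l x t).
  rewrite (obs_sub t_ge0 (heat_solution_sub (heat (Vset_add Vf Vl)) (heat Vf)) (heat Vl)).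
  by rewrite (obs_sub t_ge0 (heat (Vset_add Vf Vl)) (heat Vf)).
rewrite (mE _ Vab) (mE _ Vh) (mE _ Vk) -(obs_comb3 a b t_ge0 (s _ Vab) (s _ Vh) (s _ Vk)).
apply: (obs_norm_le t_ge0 (heat_solution_comb3 a b (s _ Vab) (s _ Vh) (s _ Vk))) => x x01.
have q1 : (Vnorm h + Vnorm k + Vnorm l) * E < del.
  apply: (@le_lt_trans _ _ ((3 * (del / (4 * E))) * E)); first by rewrite ler_pM2r//; lra.
  have -> : 3 * (del / (4 * E)) * E = 3 / 4 * del by field; rewrite gt_eqF.
  by lra.
apply: le_trans (sol_mixed_almost_linear r0 hS del0 w0 w1 lip mix Vh Vk Vl (Vnorm_ge0 h)
  (Vnorm_ge0 k) (Vnorm_ge0 l) (sup_Vnorm Vh) (sup_Vnorm Vk) (sup_Vnorm Vl) a1 b1 q1 x01 tT) _.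
rewrite -/K; apply: ler_wpM2r; first exact: Vnorm_ge0.
apply: ler_wpM2r => //; apply: addr_ge0; apply: mulr_ge0 => //; exact: Vnorm_ge0.
Qed.

Let VL := @Vset_lin R.
Let n0 := @Vnorm_ge0 R.
Let nZ := @VnormZ R.
Let nc := @Vnorm_comb R.

Lemma observe_twice : exists C rho : R,
  twice_differentiable0 observe (gradient observe) (hessian observe) C rho.
Proof.
have [C0 [rho [C00 rho0 lip quad mix]]] := observe_local.
have mlin := observe_mixed_lin; have G0 := observe0.
pose C := C0 + E; have Cp : 0 <= C by rewrite addr_ge0// ltW.
have lip' v h : Vset v -> Vset h -> Vnorm v <= rho -> Vnorm h <= rho ->
    `|observe (fun x => v x + h x) - observe v| <= C * Vnorm h.
  move=> Vv Vh nv nh; apply: le_trans (lip v h Vv Vh nv nh (Vnorm h) (n0 h) (sup_Vnorm Vh)) _.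
  by rewrite ler_wpM2r// lerDr.
have quad' v (a b : R) h k : Vset v -> Vset h -> Vset k ->
    `|a| <= 1 -> `|b| <= 1 -> Vnorm v <= rho -> Vnorm h <= rho -> Vnorm k <= rho ->
    `|(observe (fun x => v x + (a * h x + b * k x)) - observe v)
      - a * (observe (fun x => v x + h x) - observe v)
      - b * (observe (fun x => v x + k x) - observe v)|
      <= C * (`|a| * Vnorm h + `|b| * Vnorm k) * (Vnorm h + Vnorm k).
  move=> Vv Vh Vk a1 b1 nv nh nk; apply: le_trans (quad v a b h k Vv Vh Vk a1 b1 nv nh nk) _.
  apply: ler_wpM2r; first by apply: addr_ge0; exact: n0.
  apply: ler_wpM2r; first by apply: addr_ge0; apply: mulr_ge0 => //; exact: n0.
  by rewrite lerDl ltW.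
have mix' h k : Vset h -> Vset k -> Vnorm h <= rho -> Vnorm k <= rho ->
    `|mixed observe h k| <= C * Vnorm h * Vnorm k.
  move=> Vh Vk nh nk; apply: le_trans (mix h k Vh Vk nh nk) _.
  by do 2 (apply: ler_wpM2r; first exact: n0); rewrite lerDl ltW.
(* One constant for all estimates: the remainder of the gradient costs a factor $2$. *)
have up x y : 0 <= y -> x <= C * y -> x <= 2 * C * y by move=> y0 xy; nra.
exists (2 * C), rho; split => //; first exact: mulr_ge0.
- move=> v Vv nv; split.
  + move=> a b h k Vh Vk; exact: (gradient_linear VL n0 nZ Cp rho0 quad').
  + by move=> k Vk; apply: up => //; exact: (gradient_le VL n0 nZ Cp rho0 lip' quad').
  + by move=> h Vh nh; apply: up => //; exact: lip'.
  + by move=> h Vh nh; exact: (gradient_approx VL n0 nZ Cp rho0 quad').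
- move=> h k Vh Vk nh; rewrite -mulrA; apply: up; first by apply: mulr_ge0; exact: n0.
  by rewrite mulrA; exact: (gradient_diff_le VL n0 nZ Cp rho0 G0 quad' mix').
- split.
  + move=> k a b h1 h2 Vk V1 V2; exact: (hessian_linear_l VL n0 nZ nc Cp rho0 G0 quad' mlin).
  + move=> h a b k1 k2 Vh V1 V2; exact: (hessian_linear_r VL n0 nZ nc Cp rho0 G0 quad' mlin).
  + move=> h k Vh Vk; rewrite -mulrA; apply: up; first by apply: mulr_ge0; exact: n0.
    by rewrite mulrA; exact: (hessian_le VL n0 nZ nc Cp rho0 G0 quad' mix' mlin).
  + exact: (hessian_approx VL n0 nZ nc Cp rho0 G0 quad' mlin).
Qed.

Lemma observe_hessian_mixed (e : R) : 0 < e -> exists2 d : R, 0 < d &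
  forall h k, Vset h -> Vset k -> Vnorm h <= d -> Vnorm k <= d ->
    `|hessian observe h k - mixed observe h k| <= e * Vnorm h * Vnorm k.
Proof.
have [C [rho [C0 rho0 _ quad _]]] := observe_local.
exact: (hessian_mixed VL n0 nZ nc C0 rho0 observe0 quad observe_mixed_lin).
Qed.

(** [Hobs] annihilates every mode but the first, so the decay of a mode may be replaced by that of
    the first one. This yields one formula for all sine polynomials. *)
Lemma Hobs_smode (j : nat) : decay j t * Hobs (smode j) = decay 1 t * Hobs (smode j).
Proof.
have [->//|j1] := eqVneq j 1%N.
suff -> : Hobs (@smode R j) = 0 by rewrite !mulr0.
pose C (m : int) x : R := cos (m%:~R * pi * x).
have mC m : integrable01 (C m) by apply: integrable01_continuous; exact: continuous_cosw.
rewrite /Hobs -/(int01 _).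
rewrite (@eq_int01 _ _ (fun x => 2^-1 * C (Posz j - 1) x + (- 2^-1) * C (Posz j + 1) x)).
  rewrite int01_lin// /C !int01_cos.
  have -> : (Posz j - 1 == 0) = false by apply/eqP; lia.
  have -> : (Posz j + 1 == 0) = false by apply/eqP; lia.
  by rewrite !mulr0 addr0.
move=> x _; rewrite /C /smode.
rewrite !(rmorphB, rmorphD) /= -!pmulrn.
rewrite (_ : (j%:R - 1) * pi * x = j%:R * pi * x - pi * x); last by ring.
rewrite (_ : (j%:R + 1) * pi * x = j%:R * pi * x + pi * x); last by ring.
by have := cosBB (j%:R * pi * x) (pi * x); lra.
Qed.

Lemma sine_poly_solution (p : R -> R) : sine_poly p -> Vset p /\
  exists2 v, heat_solution v (fun _ _ => 0) &
    (forall x, v x 0 = p x) /\ obs t v = decay 1 t * Hobs p.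
Proof.
elim=> [a j|p1 p2 _ [V1 [v1 h1 [i1 o1]]] _ [V2 [v2 h2 [i2 o2]]]].
  have Vj := @Vset_smode R j; split; first exact: Vset_scale.
  have hm := @heat_mode R j.
  exists (fun x s => a * (decay j s * smode j x) + 0 * (decay j s * smode j x)).
    have := heat_solution_lin a 0 hm hm.
    by rewrite (_ : (fun x t => a * 0 + _) = (fun _ _ => 0))//; apply/funext => x; apply/funext => s; rewrite !mulr0 addr0.
  split; first by move=> x; rewrite decay0 mul1r mul0r addr0.
  rewrite (obs_lin _ _ t_ge0 hm hm) mul0r addr0.
  have mj : integrable01 (fun x : R => smode j x * sin (pi * x)).
    by apply: integrable01_continuous => x; apply: cvgM; exact: continuous_sinw.
  have -> : obs t (fun x s => decay j s * smode j x) = decay j t * Hobs (smode j).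
    rewrite /obs /Hobs -/(int01 _) -/(int01 _) -int01_scale//.
    by apply: eq_int01 => x _; rewrite mulrA.
  have -> : Hobs (fun x => a * smode j x) = a * Hobs (smode j).
    rewrite /Hobs -/(int01 _) -/(int01 _) -int01_scale//.
    by apply: eq_int01 => x _; rewrite mulrA.
  by rewrite Hobs_smode mulrCA.
split; first exact: Vset_add.
exists (fun x s => 1 * v1 x s + 1 * v2 x s).
  have := heat_solution_lin 1 1 h1 h2.
  by rewrite (_ : (fun x t => 1 * 0 + _) = (fun _ _ => 0))//; apply/funext => x; apply/funext => s; rewrite !mulr0 addr0.
split; first by move=> x; rewrite !mul1r i1 i2.
rewrite (obs_lin _ _ t_ge0 h1 h2) !mul1r o1 o2 -mulrDr; congr (_ * _).
rewrite /Hobs -/(int01 _) -/(int01 _) -/(int01 _).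
have m (q : R -> R) : Vset q -> integrable01 (fun x => q x * sin (pi * x)).
  by move=> Vq; apply: integrable01_mul_cont; [exact/integrable01_cont/Vset_continuous|exact: continuous_sinw].
have := int01_lin 1 1 (m _ V1) (m _ V2); rewrite !mul1r => <-.
by apply: eq_int01 => x _; ring.
Qed.

(** The last conclusion is continuity of the gradient in the supremum norm, which extends its
    formula from sine polynomials to $V$. *)
Let increment_lin : exists2 rho : R, 0 < rho &
  infinitesimally_linear (@Vset R) (@Vnorm R) (fun h => observe (fun x => zero x + h x) - observe zero) /\
  forall h D, Vset h -> 0 <= D -> sup_le h D -> `|gradient observe zero h| <= E * D.
Proof.
have [C [rho [C0 rho0 lip quad _]]] := observe_local.
have nz : Vnorm zero <= rho by rewrite Vnorm0 ltW.
have il := increment_infinitesimally_linear n0 C0 rho0 quad (@Vset0 R) nz.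
exists rho => //; split => // h D Vh D0 hD.
apply: (linear_part_le VL n0 nZ rho0 il) => // a Va na.
apply: le_trans (lip _ _ (@Vset0 R) Va nz na (`|a| * D) _ _) _.
- by rewrite mulr_ge0.
- by move=> x x01; rewrite normrM ler_wpM2l// hD.
- by rewrite mulrCA.
Qed.

(** The heat solution is explicit. At the datum $2^{-q}p$ the linear approximation errs by $w$ times
    the size of the datum, and the factor $2^q$ of the quotient turns this into $wK\le e$. *)
Let gradient_sine_poly (p : R -> R) : sine_poly p ->
  gradient observe zero p = decay 1 t * Hobs p.
Proof.
move=> sp; have [Vp [v hv [v0 <-]]] := sine_poly_solution sp.
have [rho rho0 [il _]] := increment_lin.
apply/eqP; rewrite -subr_eq0 -normr_le0; apply/ler_addgt0Pl => e e0; rewrite addr0.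
pose K := E ^+ 2 * Vnorm p.
have K0 : 0 <= K by apply: mulr_ge0; [apply: exprn_ge0; exact: ltW|exact: n0].
pose w := Num.min 1 (e / (K + 1)).
have w0 : 0 < w by rewrite lt_min ltr01 divr_gt0// ltr_wpDl.
have w1 : w <= 1 by rewrite ge_min lexx.
have wK : w * K <= e.
  apply: (@le_trans _ _ (e / (K + 1) * K)); last by apply: frac_succ_le => //; exact: ltW.
  by rewrite ler_wpM2r// ge_min lexx orbT.
have [del del0 [lip _]] := small_ball w0.
have d0 : 0 < del / (2 * E) by rewrite divr_gt0// mulr_gt0.
have [m md] := half_pow_small (Vnorm p) d0.
apply: (@cvg_dist_le R _ _ _ _ m (linear_part_cvg VL n0 nZ il Vp)) => q mq.
have p0 : 0 < 2 ^+ q :> R by exact: exprn_gt0.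
have pV : 2 ^+ q * 2 ^- q = 1 :> R by rewrite divff// gt_eqF.
set a : R := 2 ^- q in pV *; have a0 : 0 < a by rewrite invr_gt0.
rewrite /dyadic -/a observe0 subr0 (_ : (fun x => 0 + _) = (fun x => a * p x)); last first.
  by apply/funext => x; rewrite add0r.
have Vap := Vset_scale a Vp.
have nap : Vnorm (fun x => a * p x) <= del / (2 * E).
  by rewrite nZ// gtr0_norm// (le_trans _ md)// half_pow_le.
have hav : heat_solution (fun x s => a * v x s + 0 * v x s) (fun _ _ => 0).
  have := heat_solution_lin a 0 hv hv.
  by rewrite (_ : (fun x t => a * 0 + _) = (fun _ _ => 0))//; apply/funext => x; apply/funext => s; rewrite !mulr0 addr0.
have E1 : `|observe (fun x => a * p x) - a * obs t v| <= w * E ^+ 2 * Vnorm (fun x => a * p x).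
  have -> : a * obs t v = obs t (fun x s => a * v x s + 0 * v x s).
    by rewrite (obs_lin _ _ t_ge0 hv hv) mul0r addr0.
  rewrite -(obs_sub t_ge0 (heat Vap) hav).
  apply: (obs_norm_le t_ge0 (heat_solution_sub (heat Vap) hav)) => x x01.
  apply: (sol_linear_approx r0 hS del0 w0 w1 lip Vap (n0 _) (sup_Vnorm Vap) _ hav) => //.
    apply: (@le_lt_trans _ _ (del / (2 * E) * E)); first by rewrite ler_pM2r.
    have -> : del / (2 * E) * E = del / 2 by field; rewrite gt_eqF.
    by lra.
  by move=> y y01; rewrite mul0r addr0 v0.
have -> : 2 ^+ q * observe (fun x => a * p x) - obs t v =
   2 ^+ q * (observe (fun x => a * p x) - a * obs t v).
  by rewrite mulrBr (mulrA (2 ^+ q) a) pV mul1r.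
rewrite normrM gtr0_norm//; apply: le_trans (ler_wpM2l (ltW p0) E1) _.
rewrite nZ// gtr0_norm//.
rewrite (_ : _ * _ = (2 ^+ q * a) * (w * K)); last by rewrite /K; ring.
by rewrite pV mul1r.
Qed.

Lemma observe_gradient0 h : Vset h -> gradient observe zero h = decay 1 t * Hobs h.
Proof.
move=> Vh; have [rho rho0 [il bnd]] := increment_lin.
have [g [_ [_ [hE h1]]]] := Vh.
have h0 : h 0 = 0 by rewrite hE ?lexx ?ler01// set_itv1 Rintegral_set1.
have ch := Vset_continuous Vh.
apply/eqP; rewrite -subr_eq0 -normr_le0; apply/ler_addgt0Pl => e e0; rewrite addr0.
(* [E] bounds the gradient and [decay 1 t] the right-hand side, both in the supremum norm. *)
pose K := E + decay 1 t.
have dec0 : 0 < decay 1 t by exact: expR_gt0.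
have K0 : 0 <= K by rewrite addr_ge0// ltW.
have e1 : 0 < e / (K + 1) by rewrite divr_gt0// ltr_wpDl.
have [p sp pa] := sine_poly_dense ch h0 h1 e1.
have [Vp _] := sine_poly_solution sp.
have [C [rho' [_ rho0' HG _ _]]] := observe_twice.
have nz : Vnorm zero <= rho' by rewrite Vnorm0 ltW.
have [lin _ _ _] := HG _ (@Vset0 R) nz.
have Vhp := Vset_lin 1 (-1) Vh Vp.
have hpE x : 1 * h x + -1 * p x = h x - p x by rewrite mul1r mulN1r.
have sle : sup_le (fun x => 1 * h x + -1 * p x) (e / (K + 1)).
  by move=> x x01; rewrite hpE pa.
have b1 := bnd _ _ Vhp (ltW e1) sle; rewrite lin// mul1r mulN1r in b1.
have mq (q : R -> R) : Vset q -> integrable01 (fun x => q x * sin (pi * x)).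
  by move=> Vq; apply: integrable01_mul_cont; [exact/integrable01_cont/Vset_continuous|exact: continuous_sinw].
have b2 : `|Hobs h - Hobs p| <= e / (K + 1).
  have := int01_lin 1 (-1) (mq _ Vh) (mq _ Vp); rewrite mul1r mulN1r => E2.
  rewrite /Hobs -/(int01 _) -/(int01 _) -E2; apply: int01_norm_le.
    by apply: integrable01_lin; exact: mq.
  move=> x x01; rewrite (_ : _ + _ = (h x - p x) * sin (pi * x)); last by ring.
  rewrite normrM; apply: le_trans (pa x x01).
  by rewrite ler_piMr// ler_norml sin_geN1 sin_le1.
rewrite (gradient_sine_poly sp) in b1.
rewrite (_ : _ - _ = (gradient observe zero h - decay 1 t * Hobs p)
   - decay 1 t * (Hobs h - Hobs p)); last by ring.
apply: le_trans (ler_normB _ _) _; rewrite [X in _ + X]normrM (gtr0_norm dec0).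
apply: (@le_trans _ _ (E * (e / (K + 1)) + decay 1 t * (e / (K + 1)))).
  by apply: lerD => //; rewrite ler_pM2l.
rewrite -mulrDl -/K mulrC; apply: frac_succ_le => //; exact: ltW.
Qed.

Lemma obs_le_cst d f (B : R) : heat_solution d f -> 0 <= B ->
  (forall x : R, 0 <= x <= 1 -> d x t <= B) -> obs t d <= B.
Proof.
move=> hd B0 dB; rewrite /obs /Hobs -/(int01 _) -[leRHS]int01_cst.
apply: le_int01.
- apply: integrable01_mul_cont; last exact: continuous_sinw.
  exact/integrable01_cont/(heat_solution_cont_x hd t_ge0).
- by apply: integrable01_continuous => x; exact: cvg_cst.
move=> x x01; have s0 : 0 <= sin (pi * x).
  apply: sin_ge0_pi; move: x01 => /andP[x0 x1].
  by rewrite mulr_ge0 ?pi_ge0//= ler_piMr ?pi_ge0.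
apply: le_trans (ler_wpM2r s0 (dB x x01)) _.
by rewrite ler_piMr// sin_le1.
Qed.

(** Both sides are quadratic, so the comparison may be made for $bh$ with $b=2^{-m}$ small. There
    the second derivative is close to the second difference, the total error is at most $b^2e$, and
    $b^2$ cancels. *)
Lemma observe_hessian_lower (n : nat) (a : 'I_n -> R) (h : R -> R) :
  h = (fun x => \sum_(i < n) a i * smode (freq i) x) -> Vset h ->
  c ^+ 2 * (t * (4^-1 * \sum_(i < n) (a i * decay (freq i) t) ^+ 2)) <= c * hessian observe h h.
Proof.
move=> hE Vh.
pose v x s := \sum_(i < n) a i * (decay (freq i) s * smode (freq i) x).
have hv : heat_solution v (fun _ _ => 0).
  by apply: heat_solution_sum => i; exact: heat_mode.
have v0 x : v x 0 = h x by rewrite hE; apply: eq_bigr => i _; rewrite decay0 mul1r.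
have vE x : v x t = \sum_(i < n) (a i * decay (freq i) t) * smode (freq i) x.
  by apply: eq_bigr => i _; rewrite mulrA.
have htsq := heat_solution_tsq hv.
set Q := t * _; set X := c * _.
(* On $[0,1]$ one has $\sin\pi x\ge\sin^2\pi x$, which reduces the claim to the weighted identity
   for the modes. *)
have vlow : Q <= obs t (fun x s => s * v x s ^+ 2).
  have cs : {within `[0, 1], continuous (fun x => v x t)} by exact: heat_solution_cont_x hv t_ge0.
  have ctsq := heat_solution_cont_x htsq t_ge0.
  have sin_cont := integrable01_mul_cont (integrable01_cont ctsq) (@continuous_sinw R pi).
  have m2 : integrable01 (fun x => t * v x t ^+ 2 * sin (pi * x) ^+ 2).
    apply: (@integrable01_mul_cont R (fun x => t * v x t ^+ 2) (fun x => sin (pi * x) ^+ 2)).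
      exact: integrable01_cont ctsq.
    by move=> x; apply: cvgM; exact: continuous_sinw.
  have m3 : integrable01 (fun x => v x t ^+ 2 * sin (pi * x) ^+ 2).
    apply: (@integrable01_mul_cont R (fun x => v x t ^+ 2) (fun x => sin (pi * x) ^+ 2)).
      apply: integrable01_cont; apply/subspace_continuousP => x x01.
      by move/subspace_continuousP : cs => /(_ x x01) cs; apply: cvgM.
    by move=> x; apply: cvgM; exact: continuous_sinw.
  rewrite /Q -int01_comb_modes.
  rewrite (@eq_int01 _ _ (fun x => v x t ^+ 2 * sin (pi * x) ^+ 2)); last first.
    by move=> x _; rewrite vE.
  rewrite -int01_scale// /obs /Hobs -/(int01 _).
  rewrite (@eq_int01 _ (fun x => t * (_ * _)) (fun x => t * v x t ^+ 2 * sin (pi * x) ^+ 2)); last first.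
    by move=> x _; rewrite mulrA.
  apply: le_int01 => // x x01; apply: ler_wpM2l; first by apply: mulr_ge0 => //; exact: sqr_ge0.
  have s0 : 0 <= sin (pi * x).
    apply: sin_ge0_pi; move: x01 => /andP[x0 x1].
    by rewrite mulr_ge0 ?pi_ge0//= ler_piMr ?pi_ge0.
  by rewrite expr2 ler_piMr// sin_le1.
apply/ler_addgt0Pl => e e0.
pose n2 := Vnorm h ^+ 2; have n20 : 0 <= n2 by exact: sqr_ge0.
have En m : 0 <= E ^+ m by apply: exprn_ge0; exact: ltW.
set cR : R := derive1n 2 r 0 in X *.
pose K3 := (`|cR| * ((`|cR| + 1) * E ^+ 3 + E ^+ 2) + cR ^+ 2 * (3 * E ^+ 4)) * E.
have K30 : 0 <= K3.
  apply: mulr_ge0; last exact: ltW.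
  apply: addr_ge0; last by apply: mulr_ge0; [exact: sqr_ge0|exact: mulr_ge0].
  by apply: mulr_ge0 => //; apply: addr_ge0 => //; apply: mulr_ge0 => //; exact: addr_ge0.
have e2 : 0 < e / 2 by rewrite divr_gt0.
pose w := Num.min 1 (e / 2 / (K3 * n2 + 1)).
have wp : 0 < K3 * n2 + 1 by rewrite ltr_wpDl// mulr_ge0.
have w0 : 0 < w by rewrite lt_min ltr01 divr_gt0.
have w1 : w <= 1 by rewrite ge_min lexx.
have wK : w * (K3 * n2) <= e / 2.
  apply: (@le_trans _ _ (e / 2 / (K3 * n2 + 1) * (K3 * n2))).
    by apply: ler_wpM2r; [exact: mulr_ge0|rewrite ge_min lexx orbT].
  by apply: frac_succ_le => //; [exact: ltW|exact: mulr_ge0].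
have e3 : 0 < e / 2 / (`|cR| * n2 + 1) by rewrite divr_gt0// ltr_wpDl// mulr_ge0.
have [d d0 Hd] := observe_hessian_mixed e3.
have [del del0 [lip mix]] := small_ball w0.
have dm : 0 < Num.min d (del / (4 * E)) by rewrite lt_min d0 divr_gt0// mulr_gt0.
have [m md] := half_pow_small (Vnorm h) dm.
set b : R := 2 ^- m in md; have b0 : 0 < b by rewrite invr_gt0 exprn_gt0.
have Vb := Vset_scale b Vh.
have nb : Vnorm (fun x => b * h x) = b * Vnorm h by rewrite nZ// gtr0_norm.
have nbd : Vnorm (fun x => b * h x) <= d by rewrite nb (le_trans md)// ge_min lexx.
have nbdel : (Vnorm (fun x => b * h x) + Vnorm (fun x => b * h x)) * E < del.
  have : Vnorm (fun x => b * h x) <= del / (4 * E) by rewrite nb (le_trans md)// ge_min lexx orbT.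
  move=> q1; apply: (@le_lt_trans _ _ ((del / (4 * E) + del / (4 * E)) * E)).
    by rewrite ler_pM2r// lerD.
  have -> : (del / (4 * E) + del / (4 * E)) * E = del / 2 by field; rewrite gt_eqF.
  by lra.
pose vb x s := b * v x s + 0 * v x s.
have hvb : heat_solution vb (fun _ _ => 0).
  have := heat_solution_lin b 0 hv hv.
  by rewrite (_ : (fun x t => b * 0 + _) = (fun _ _ => 0))//; apply/funext => x; apply/funext => s; rewrite !mulr0 addr0.
have vb0 x : 0 <= x <= 1 -> vb x 0 = b * h x by rewrite /vb mul0r addr0 v0.
have Vbb := Vset_add Vb Vb.
have hY := heat_solution_sub (heat_solution_sub (heat Vbb) (heat Vb)) (heat Vb).
have hT := heat_solution_tsq hvb.
(* The pointwise comparison with the subsolution, integrated against the nonnegative weight $\sin\pi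
   x$. *)
have low : obs t (fun x s => cR ^+ 2 * (s * vb x s ^+ 2) + - cR *
     (S (fun x => b * h x + b * h x) x s - S (fun x => b * h x) x s - S (fun x => b * h x) x s))
   <= w * K3 * Vnorm (fun x => b * h x) ^+ 2.
  apply: (obs_le_cst (heat_solution_lin (cR ^+ 2) (- cR) hT hY)).
    by apply: mulr_ge0; [apply: mulr_ge0 => //; exact: ltW|exact: sqr_ge0].
  move=> x x01.
  have := sol_mixed_lower r0 hS t_ge0 del0 w0 w1 lip mix Vb (n0 _) (sup_Vnorm Vb) nbdel hvb vb0 x01 tT.
  by rewrite -/K3 -/cR mulNr; lra.
rewrite (obs_lin _ _ t_ge0 hT hY) in low.
have mE : obs t (fun x s => S (fun x => b * h x + b * h x) x s - S (fun x => b * h x) x s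
   - S (fun x => b * h x) x s) = mixed observe (fun x => b * h x) (fun x => b * h x).
  rewrite (obs_sub t_ge0 (heat_solution_sub (heat Vbb) (heat Vb)) (heat Vb)).
  by rewrite (obs_sub t_ge0 (heat Vbb) (heat Vb)).
rewrite mE in low.
have tE : obs t (fun x s => s * vb x s ^+ 2) = b ^+ 2 * obs t (fun x s => s * v x s ^+ 2).
  have := obs_lin (b ^+ 2) 0 t_ge0 htsq htsq; rewrite mul0r addr0 => <-.
  congr obs; apply/funext => x; apply/funext => s.
  by rewrite /vb !mul0r !addr0 exprMn mulrCA.
rewrite tE in low.
have [C [rho [_ _ _ _ [l1 l2 _ _]]]] := observe_twice.
have hb : hessian observe (fun x => b * h x) (fun x => b * h x) = b ^+ 2 * hessian observe h h.
  have E1 : (fun x => b * h x) = (fun x => b * h x + 0 * h x).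
    by apply/funext => x; rewrite mul0r addr0.
  have Vb' := Vset_lin b 0 Vh Vh.
  by rewrite E1 l1// l2// !mul0r !addr0 expr2 mulrA.
have := Hd _ _ Vb Vb nbd nbd; rewrite hb nb => Hb.
set e' := e / 2 / (`|cR| * n2 + 1) in Hb e3.
have e'c : `|cR| * (e' * n2) <= e / 2.
  rewrite mulrCA /e'; apply: frac_succ_le => //; [exact: ltW|exact: mulr_ge0].
rewrite nb in low.
set Hs := hessian observe h h in Hb *; set mx := mixed _ _ _ in Hb low.
have b2 : 0 < b ^+ 2 by exact: exprn_gt0.
have k1 : cR * (mx - b ^+ 2 * Hs) <= b ^+ 2 * (e / 2).
  apply: le_trans (ler_norm _) _; rewrite normrM distrC.
  apply: le_trans (ler_wpM2l (normr_ge0 _) Hb) _.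
  have -> : `|cR| * (e' * (b * Vnorm h) * (b * Vnorm h)) = b ^+ 2 * (`|cR| * (e' * n2)).
    by rewrite /n2; ring.
  by rewrite ler_pM2l.
have k2 : w * K3 * (b * Vnorm h) ^+ 2 <= b ^+ 2 * (e / 2).
  have -> : w * K3 * (b * Vnorm h) ^+ 2 = b ^+ 2 * (w * (K3 * n2)) by rewrite /n2; ring.
  by rewrite ler_pM2l.
have k3 : cR ^+ 2 * (b ^+ 2 * Q) <= cR ^+ 2 * (b ^+ 2 * obs t (fun x s => s * v x s ^+ 2)).
  by rewrite ler_wpM2l ?sqr_ge0// ler_pM2l.
rewrite -(ler_pM2l b2) /X -/Hs.
rewrite (mulrCA (b ^+ 2)); apply: (le_trans k3).
rewrite mulNr lerBlDr in low; rewrite mulrBr lerBlDr in k1.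
apply: (le_trans low); apply: (le_trans (lerD k2 k1)).
by rewrite addrA -mulrDr -splitr mulrDr (mulrCA cR).
Qed.

End ObservationFunctional.

(** * Bounds on the span of the modes, and the choice of data *)

Section MorseIndex.
Variable R : realType.

(** On a finite-dimensional span the norm is dominated by the Euclidean norm of the coefficients;
    the induction uses $(a+b)^2\le2a^2+2b^2$. *)
Lemma Vnorm_sum_bound (n : nat) (e : 'I_n -> R -> R) : (forall i, Vset (e i)) ->
  exists2 A : R, 0 <= A & forall c : 'I_n -> R,
    Vset (fun x => \sum_(i < n) c i * e i x) /\
    Vnorm (fun x => \sum_(i < n) c i * e i x) ^+ 2 <= A * \sum_(i < n) c i ^+ 2.
Proof.
elim: n e => [|n IH] e Ve.
  exists 0 => // c; rewrite (_ : (fun x => _) = (fun _ => 0)).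
    by split; [exact: Vset0|rewrite Vnorm0 expr0n mul0r].
  by apply/funext => x; rewrite big_ord0.
have [A A0 H] := IH _ (fun i => Ve (lift ord0 i)).
have n0 := sqr_ge0 (Vnorm (e ord0)).
exists (2 * Vnorm (e ord0) ^+ 2 + 2 * A); first by apply: addr_ge0; apply: mulr_ge0.
move=> c; have [V1 N1] := H (fun i => c (lift ord0 i)).
rewrite (_ : (fun x => _) = (fun x => c ord0 * e ord0 x +
    \sum_(i < n) c (lift ord0 i) * e (lift ord0 i) x)); last first.
  by apply/funext => x; rewrite big_ord_recl.
have V0 := Vset_scale (c ord0) (Ve ord0); split; first exact: Vset_add.
have N2 := Vnorm_add V0 V1.
have N3 := VnormZ (c ord0) (Ve ord0).
pose s := Vnorm (fun x => c ord0 * e ord0 x + \sum_(i < n) c (lift ord0 i) * e (lift ord0 i) x).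
rewrite -/s in N2 *; rewrite big_ord_recl; set Q := \sum_(i < n) c _ ^+ 2 in N1 *.
have Q0 : 0 <= Q by apply: sumr_ge0 => i _; exact: sqr_ge0.
set b := Vnorm (fun x => \sum_(i < n) _) in N1 N2; set a := Vnorm _ in N2; rewrite -/a in N3.
have a2 : a ^+ 2 = c ord0 ^+ 2 * Vnorm (e ord0) ^+ 2 by rewrite N3 exprMn real_normK ?num_real.
have s2 : s ^+ 2 <= (a + b) ^+ 2 by rewrite ler_pXn2r// nnegrE ?addr_ge0 ?Vnorm_ge0.
have ab : (a + b) ^+ 2 <= 2 * a ^+ 2 + 2 * b ^+ 2 by have := sqr_ge0 (a - b); rewrite !expr2; lra.
have p1 := mulr_ge0 n0 Q0; have p2 := mulr_ge0 A0 (sqr_ge0 (c ord0)).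
apply: (le_trans s2); apply: (le_trans ab); rewrite a2.
by lra.
Qed.

(** Cauchy--Schwarz for the representation of [Hobs] by the first mode. *)
Lemma Hobs_sqr_le (h : R -> R) : Vset h ->
  Hobs h ^+ 2 <= (Vnorm (@smode R 1) / pi ^+ 2) ^+ 2 * Vnorm h ^+ 2.
Proof.
move=> Vh; have p0 : 0 < (pi : R) ^+ 2 by rewrite exprn_gt0// pi_gt0.
have := Vip_CS (@Vset_smode R 1) Vh; rewrite Vip_smode1// normrM gtr0_norm// => q.
rewrite -exprMn -(real_normK (num_real (Hobs h))) ler_pXn2r// ?nnegrE//; last first.
  by rewrite !mulr_ge0 ?Vnorm_ge0// invr_ge0 ltW.
by rewrite mulrAC ler_pdivlMr// mulrC.
Qed.

Lemma decay_le (i j : nat) (t : R) : 0 <= t -> (i <= j)%N -> decay j t <= decay i t.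
Proof.
move=> t0 ij; rewrite ler_expR ler_wpM2r// lerN2 ler_pXn2r// ?nnegrE ?mulr_ge0 ?pi_ge0//.
by rewrite ler_wpM2r ?pi_ge0// ler_nat.
Qed.

(** Weighted orthogonality turns a vanishing combination into a vanishing sum of squares. *)
Lemma smode_free (k : nat) (c : 'I_k -> R) :
  (forall x : R, 0 <= x <= 1 -> \sum_(i < k) c i * smode (freq i) x = 0) -> forall i, c i = 0.
Proof.
move=> H i; have := int01_comb_modes c.
rewrite (_ : int01 _ = 0).
  move=> /esym/eqP; rewrite mulf_eq0 invr_eq0 pnatr_eq0/= psumr_eq0; last by move=> *; exact: sqr_ge0.
  by move=> /allP/(_ i (mem_index_enum _)); rewrite sqrf_eq0 => /eqP.
rewrite (eq_int01 (g := fun _ => 0)) ?int01_cst// => x x01.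
by rewrite H// expr0n mul0r.
Qed.

End MorseIndex.

Theorem theorem4 (R : realType) (r : R -> R)
  (hr : C2 r) (hgrowth : growth_cond r)
  (hr0 : r 0 = 0) (hr'0 : derive1 r 0 = 0) (hr''0 : derive1n 2 r 0 != 0)
  (S : (R -> R) -> R -> R -> R)
  (hS : forall u, Vset u -> is_solution r u (S u))
  (k : nat) (hk : (0 < k)%N) (sigma : R) (hsigma : 0 < sigma)
  (N : nat) (hN : (0 < N)%N) (ts : 'I_N -> R)
  (hts0 : forall i, 0 < ts i)
  (hts : forall i j : 'I_N, (i < j)%N -> ts i < ts j) :
  exists (zs : 'I_N -> R) (u0 : R -> R),
    Vset u0 /\ critical_Morse_ge (Jfun S ts zs sigma u0) (fun _ => 0) k.
Proof.
pose c : R := derive1n 2 r 0; pose i0 := Ordinal hN; pose t := ts i0.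
pose e (i : 'I_k) : R -> R := smode (freq i).
have Ve i : Vset (e i) by exact: Vset_smode.
have [A A0 VA] := Vnorm_sum_bound Ve.
pose M : R := (Vnorm (@smode R 1) / pi ^+ 2) ^+ 2.
pose a : R := (2 * sigma ^+ 2)^-1.
have a0 : 0 < a by rewrite invr_gt0 mulr_gt0// exprn_gt0.
(* $K\|h\|_V^2$ bounds the nonnegative part of the second derivative: the squared first derivatives
   of the observations and the prior. *)
pose K : R := (\sum_i decay 1 (ts i) ^+ 2) * M + 2 * a.
have D0 : 0 <= \sum_i decay 1 (ts i) ^+ 2 by apply: sumr_ge0 => i _; exact: sqr_ge0.
have K0 : 0 <= K.
  by apply: addr_ge0; apply: mulr_ge0 => //; [exact: sqr_ge0|exact: ltW].
(* The modes in use have indices below [k], hence frequencies below [freq k], whose decay factor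
   bounds all of theirs from below. *)
pose kap : R := c ^+ 2 * (t * (4^-1 * decay (freq k) t ^+ 2)).
have kap0 : 0 < kap.
  have c2 : 0 < c ^+ 2 by rewrite lt0r sqrf_eq0 hr''0 sqr_ge0.
  have d2 : 0 < decay (freq k) t ^+ 2 by rewrite exprn_gt0// expR_gt0.
  by apply: mulr_gt0 => //; apply: mulr_gt0; [exact: hts0|exact: mulr_gt0].
(* Gives $Z\kappa=KA+1$, which exceeds the bound $KA$ of the nonnegative part, both relative to the
   sum of squares of the coefficients. *)
pose Z : R := (K * A + 1) / kap.
have Z0 : 0 < Z by rewrite divr_gt0// ltr_wpDl// mulr_ge0.
(* The factor [c] of the first datum meets the second derivative of the first observation, and their
   product is bounded below whatever the sign of [c]. *)
pose z (i : 'I_N) : R := if i == i0 then Z * c else 0.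
have sumz (F : 'I_N -> R) : \sum_i z i * F i = Z * c * F i0.
  rewrite (bigD1 i0)//= /z eqxx big1 ?addr0// => i /negbTE ->.
  by rewrite mul0r.
(* Chosen so that the prior term cancels the gradient of the data term at [0]. *)
pose b : R := Z * c * decay 1 t / (2 * a * pi ^+ 2).
pose u0 (x : R) : R := - b * smode 1 x.
have Vu0 : Vset u0 by exact: Vset_scale (Vset_smode _ 1).
exists z, u0; split=> //; split; first exact: Vset0.
pose G i := observe S (ts i).
pose DJ v h := \sum_i (G i v - z i) * gradient (G i) v h + 2 * a * Vip (fun x => v x - u0 x) h.
pose B h g := \sum_i (gradient (G i) (fun _ => 0) h * gradient (G i) (fun _ => 0) g
  - z i * hessian (G i) h g) + 2 * a * Vip h g.
have G0 i : G i (fun _ => 0) = 0 by exact: (observe0 hr hr0 hr'0 hS (hts0 i)).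
have grad i h : Vset h -> gradient (G i) (fun _ => 0) h = decay 1 (ts i) * Hobs h.
  exact: (observe_gradient0 hr hr0 hr'0 hS (hts0 i)).
exists DJ, B; split; [|split].
- apply: twice_frechet0P.
  rewrite (_ : Jfun _ _ _ _ _ = fun u => \sum_i 2^-1 * (G i u - z i) ^+ 2
     + a * Vnorm (fun x => u x - u0 x) ^+ 2); last first.
    by apply/funext => u; rewrite /Jfun mulr_sumr.
  apply: twice_frechet0_add; last exact: twice_frechet0_quadratic (ltW a0) Vu0.
  apply: twice_frechet0_sum => i.
  have [C [rho H]] := observe_twice hr hr0 hr'0 hS (hts0 i).
  exact: twice_frechet0_square (G0 i) H.
- move=> h Vh; rewrite /DJ.
  have -> : \sum_i (G i (fun=> 0) - z i) * gradient (G i) (fun=> 0) h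
      = - (Z * c * (decay 1 t * Hobs h)).
    rewrite -(sumz (fun i => decay 1 (ts i) * Hobs h)) -sumrN.
    by apply: eq_bigr => i _; rewrite G0 grad// sub0r mulNr.
  have -> : (fun x => (fun=> 0) x - u0 x) = (fun x => b * smode 1 x + 0 * smode 1 x).
    by apply/funext => x; rewrite /u0 sub0r mulNr opprK mul0r addr0.
  rewrite Vip_linl ?Vip_smode1//; try exact: Vset_smode.
  rewrite /b -/a; move: (lt0r_neq0 (pi_gt0 R)) (lt0r_neq0 a0).
  by generalize (pi : R) a => p q p0 q0; field; rewrite p0 q0.
exists e; split=> //; split; first exact: smode_free.
move=> d [j dj]; have [Vh Nh] := VA d.
set h := fun x => _ in Vh Nh *; set Q := \sum_i d i ^+ 2 in Nh.
have Q0 : 0 < Q.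
  rewrite lt0r sumr_ge0 ?andbT; last by move=> *; exact: sqr_ge0.
  apply/eqP => /eqP; rewrite psumr_eq0; last by move=> *; exact: sqr_ge0.
  by move=> /allP/(_ j (mem_index_enum _)); rewrite /= sqrf_eq0 (negbTE dj).
have := observe_hessian_lower hr hr0 hr'0 hS (hts0 i0) (erefl h) Vh.
rewrite -/c -/t -/(G i0) => low.
have low2 : kap * Q <= c * hessian (G i0) h h.
  apply: le_trans low; rewrite /kap -(mulrA (c ^+ 2)) -(mulrA t) -(mulrA 4^-1).
  apply: (ler_wpM2l (sqr_ge0 c)); apply: ler_wpM2l; first exact: ltW (hts0 _).
  apply: ler_wpM2l => //; rewrite mulr_sumr.
  apply: ler_sum => i _; rewrite exprMn mulrC ler_wpM2l ?sqr_ge0//.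
  rewrite ler_pXn2r// ?nnegrE ?expR_ge0//; apply: decay_le; first exact: ltW (hts0 _).
  by rewrite leq_pmul2l// ltnS ltnW.
have H1 : \sum_i (gradient (G i) (fun _ => 0) h) ^+ 2
    <= (\sum_i decay 1 (ts i) ^+ 2) * M * Vnorm h ^+ 2.
  rewrite -mulrA mulr_suml; apply: ler_sum => i _.
  by rewrite grad// exprMn ler_wpM2l ?sqr_ge0// Hobs_sqr_le.
have BE : B h h = \sum_i (gradient (G i) (fun _ => 0) h) ^+ 2
    - Z * (c * hessian (G i0) h h) + 2 * a * Vnorm h ^+ 2.
  rewrite /B sumrB sumz Vnorm_sqr mulrA; congr (_ - _ + _).
have KA : K * Vnorm h ^+ 2 <= K * (A * Q) by exact: ler_wpM2l.
have ZQ : Z * (kap * Q) = (K * A + 1) * Q by rewrite /Z; field; rewrite gt_eqF.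
have := ler_wpM2l (ltW Z0) low2; rewrite ZQ BE => low3.
have H2 : \sum_i (gradient (G i) (fun _ => 0) h) ^+ 2 + 2 * a * Vnorm h ^+ 2 <= K * Vnorm h ^+ 2.
  by rewrite [leRHS]mulrDl lerD2r.
rewrite addrAC subr_lt0; apply: (le_lt_trans H2); apply: (le_lt_trans KA).
by apply: lt_le_trans low3; rewrite (mulrDl (K * A)) mul1r mulrA ltrDl.
Qed.
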